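(* Let $t$ be a non-negative integer and $\epsilon>0$. There is a randomized algorithm that, given an instance of the $t$-Dimensional Parity Perfect Matching Problem with $n$ vertices and maximum edge weight $w_{\max}$, correctly solves the problem, with probability at least $1-\epsilon$, in time $O(w_{\max}n^6\log^2 n)$.
   Context: The $t$-Dimensional Parity Perfect Matching Problem: an instance consists of a graph $G$ (parallel edges allowed), unary-encoded edge weights $w:E(G)\to\mathbb{Z}_{\ge 0}$, edge parities $\gamma:E(G)\to\mathrm{GF}(2)^t$, and a parity demand $\alpha\in\mathrm{GF}(2)^t$; the problem is to find a perfect matching $M$ of $G$ minimizing $w(M)=\sum_{e\in M}w(e)$ subject to $\gamma(M)=\sum_{e\in M}\gamma(e)=\alpha$. Here $n=|V(G)|$ and $w_{\max}=\max_{e\in E(G)}w(e)$.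
   Formalization: The time bound proved is O(max(1,w_max)·max(2,n)^6·log²(max(2,n)) + r), where r counts edges exactly duplicating another (same ends, weight, parity): the stated bound is 0 when w_max=0 or n≤1, and with unboundedly many parallel edges the input cannot be read within it. *)

(* Defs.v *)
From HB Require Import structures.
From mathcomp Require Import all_boot all_order all_algebra.
From mathcomp Require Import reals.

Set Implicit Arguments.
Unset Strict Implicit.
Unset Printing Implicit Defensive.

(** * Instances *)

(* Edges are indexed, so any number of parallel edges is allowed.  Each edge
   has two distinct ends, listed in an arbitrary order. *)
Record instance (t : nat) := Instance {
  nv : nat;
  ne : nat;
  ends : 'I_ne -> 'I_nv * 'I_nv;
  ends_neq : forall e, (ends e).1 != (ends e).2;
  wt : 'I_ne -> nat;
  par : 'I_ne -> 'rV['F_2]_t;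
  demand : 'rV['F_2]_t }.

Section Problem.
Variables (t : nat) (I : instance t).

Definition endset (e : 'I_(ne I)) : {set 'I_(nv I)} :=
  [set (ends e).1; (ends e).2].

Definition perfect_matching (M : {set 'I_(ne I)}) : bool :=
  [forall v, #|[set e in M | v \in endset e]| == 1].

Definition weight (M : {set 'I_(ne I)}) : nat := \sum_(e in M) wt e.

Definition parity (M : {set 'I_(ne I)}) : 'rV['F_2]_t :=
  (\sum_(e in M) par e)%R.

Definition feasible (M : {set 'I_(ne I)}) : bool :=
  perfect_matching M && (parity M == demand I).

Definition optimal (M : {set 'I_(ne I)}) : bool :=
  feasible M && [forall M', feasible M' ==> (weight M <= weight M')].

Definition wmax : nat := \max_e wt (i := I) e.

(* The number of edges that repeat another edge exactly: same pair of ends,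
   same weight and same parity.  Without such repetitions the number of edges
   is O(n^2 w_max) for fixed t (and w_max > 0); in general the repetitions are
   not bounded in terms of n and w_max, yet have to be read. *)
Definition repeated_edges : nat :=
  ne I - size (undup [seq (endset e, wt e, par e) | e : 'I_(ne I)]).

(* The function w_max n^6 log^2 n.  It vanishes when w_max = 0 or n <= 1, so
   there w_max and n are replaced by 1 and 2. *)
Definition time_scale : nat :=
  let n := maxn 2 (nv I) in maxn 1 wmax * n ^ 6 * trunc_log 2 n ^ 2.

End Problem.

(** * A randomized word RAM *)

(* Structured programs over registers and a random-access memory, both indexed
   by nat and holding W-bit words.  [Flip] draws a fair coin. *)
Variant op := Add | Sub | Mul | Div | Mod | Lt.

Inductive cmd :=
| Skip
| Const (x k : nat)
| Op (o : op) (x y z : nat)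
| Read (x y : nat)
| Write (x y : nat)
| Flip (x : nat)
| Seq (c d : cmd)
| If (x : nat) (c d : cmd)
| While (x : nat) (c : cmd).

Definition eval_op (o : op) (a b : nat) : nat :=
  match o with
  | Add => a + b
  | Sub => a - b
  | Mul => a * b
  | Div => a %/ b
  | Mod => a %% b
  | Lt => a < b
  end.

(* [code] is the stack of commands that remain to be executed. *)
Record state := State {
  code : seq cmd;
  reg : nat -> nat;
  cell : nat -> nat }.

Definition word (W a : nat) : nat := a %% 2 ^ W.

(* One unit of time.  Every step is offered a fresh coin [b], which only
   [Flip] reads.  A halted state is a fixed point. *)
Definition step (W : nat) (s : state) (b : bool) : state :=
  let: State code r m := s in
  match code with
  | [::] => s
  | c :: k =>
    match c with
    | Skip => State k r m
    | Const x a => State k [eta r with x |-> word W a] m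
    | Op o x y z => State k [eta r with x |-> word W (eval_op o (r y) (r z))] m
    | Read x y => State k [eta r with x |-> m (r y)] m
    | Write x y => State k r [eta m with r x |-> r y]
    | Flip x => State k [eta r with x |-> word W b] m
    | Seq c1 c2 => State (c1 :: c2 :: k) r m
    | If x c1 c2 => State ((if r x != 0 then c1 else c2) :: k) r m
    | While x c1 => State (if r x != 0 then c1 :: c :: k else k) r m
    end
  end.

Definition halted (s : state) : bool := nilp (code s).

Definition init (W : nat) (p : cmd) (input : seq nat) : state :=
  State [:: p] (fun=> 0) (fun a => word W (nth 0 input a)).

(* The state after [size coins] steps. *)
Definition run (W : nat) (p : cmd) (input : seq nat) (coins : seq bool) :
    state :=
  foldl (step W) (init W p input) coins.

(** * Solving an instance on the RAM *)

Definition encode_vec (t : nat) (a : 'rV['F_2]_t) : nat :=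
  \sum_(j < t) (a ord0 j != 0%R) * 2 ^ j.

Section Solving.
Variables (t : nat) (I : instance t).

Definition encode : seq nat :=
  [:: nv I; ne I; encode_vec (demand I)] ++
  flatten [seq [:: val (ends e).1; val (ends e).2; wt e; encode_vec (par e)]
          | e : 'I_(ne I)].

(* The size of the instance, edge weights being counted in unary.  With words
   of O(log size) bits, each weight fits in O(1) words. *)
Definition instance_size : nat :=
  nv I + ne I + \sum_e wt (i := I) e.

Definition word_size (c : nat) : nat := c * (trunc_log 2 instance_size).+1.

(* Register 0 tells whether a solution was found; if so, register 1 points to
   a list of n/2 edge indices.  An optimal set has exactly n/2 elements, so the
   list then has no repeated or invalid entries. *)
Definition output (s : state) : {set 'I_(ne I)} :=
  [set e | val e \in [seq cell s (reg s 1 + i) | i <- iota 0 (nv I)./2]].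

Definition solved (s : state) : bool :=
  if reg s 0 != 0 then optimal (output s)
  else ~~ [exists M : {set 'I_(ne I)}, feasible M].

End Solving.

(* The probability of an event determined by T independent fair coins. *)
Definition coin_prob (R : realType) (T : nat) (E : pred (T.-tuple bool)) : R :=
  (#|[set w | E w]|%:R / (2 ^ T)%:R)%R.
Arguments coin_prob : clear implicits.

(* Main.v *)
(** Fix slots (u, v, g) for u < v and g in GF(2)^t and keep the lightest edge
    of each slot.  Give slot d a random weight x_d modulo a prime p and, for a
    character chi of GF(2)^t, consider the skew matrix with entries
    sum_g chi(g) x_d y^(w_d).  Averaging chi(alpha) times its Pfaffian over all
    chi leaves the signed sum of x^M y^(w(M)) over the perfect matchings M of
    parity alpha.  If no such M is lighter than k, then the finite difference
    sum_i (-1)^i C(N, i) i^(-k) of the values at y = i, with N > n w_max / 2,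
    annihilates all terms but those with w(M) = k; by the Schwartz-Zippel lemma
    their signed sum is unlikely to vanish when there are any.

    The minimum weight is found by bit scaling, w being replaced by the integer
    parts of w / 2^q, ..., w / 2, w in turn: each minimum is within n/2 of twice
    the previous one.  Then the slots are deleted one after the other as long as
    the optimum survives; what remains is an optimal matching.  Since each test
    takes time O(w_max n (n^3 + n^2 log p)), this is fast enough as long as
    log w_max = O(n log n).  Otherwise w_max exceeds the number of (n/2)-tuples
    of slots, and exhaustive search is affordable. *)

From HB Require Import structures.
Require Import Defs.
From mathcomp Require Import all_boot all_order all_algebra.
From mathcomp Require Import reals.
From mathcomp Require Import finfield zify ring.

Set Implicit Arguments.
Unset Strict Implicit.
Unset Printing Implicit Defensive.

Import GRing.Theory.

(** * A structured language compiled to the RAM *)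

(** The same random weights serve in all tests, and what a deletion test examines depends on earlier
    answers. The run is therefore compared with an ideal one that is driven by the true answers,
    hence fixed by the instance alone. Each of its q + 1 + n^2 2^t tests asks whether one fixed
    polynomial is non-zero at the random weights; as long as none vanishes by accident the two runs
    coincide, and a union bound suffices. Errors are one-sided: an empty sum never passes a test.

    For this to be a statement about coin strings, the coins that are read must sit at positions
    that do not depend on the coins. So all tosses are made in one block after a deterministic
    prologue, and the semantics of the language counts machine steps exactly.

    The random weights are q-bit numbers with 2^q at least a constant times n^3 w_max, and p is a
    prime beyond 2^q, so that distinct weights stay distinct modulo p and the binomials of the
    finite difference can be computed by division. The signs of the matchings are never determined;
    it is enough that they are non-zero modulo p. *)

Definition upd (f : nat -> nat) x a : nat -> nat := fun y => if y == x then a else f y.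

Definition upd2 (f : nat -> nat -> nat) k i a : nat -> nat -> nat :=
  fun k' => if k' == k then upd (f k) i a else f k'.

(* [G k e] is the cell of index [e] of array [k]; [SFor x e s] executes [s] for [x] from
   [0] to [e - 1], with [e] evaluated once. *)
Inductive ex := V of nat | N of nat | B of op & ex & ex | G of nat & ex.

Inductive stm :=
| SNop
| SAsn of nat & ex
| SPut of nat & ex & ex
| SToss of nat
| SSeq of stm & stm
| SIf of ex & stm & stm
| SFor of nat & ex & stm.

Fixpoint mods (s : stm) : seq nat :=
  match s with
  | SNop | SPut _ _ _ => [::]
  | SAsn x _ | SToss x => [:: x]
  | SSeq s1 s2 | SIf _ s1 s2 => mods s1 ++ mods s2
  | SFor x _ s => x :: mods s
  end.

Fixpoint amods (s : stm) : seq nat :=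
  match s with
  | SNop | SAsn _ _ | SToss _ => [::]
  | SPut k _ _ => [:: k]
  | SSeq s1 s2 | SIf _ s1 s2 => amods s1 ++ amods s2
  | SFor _ _ s => amods s
  end.

Fixpoint ev (v : nat -> nat) (a : nat -> nat -> nat) (e : ex) : nat :=
  match e with
  | V x => v x
  | N k => k
  | B o e1 e2 => eval_op o (ev v a e1) (ev v a e2)
  | G k e => a k (ev v a e)
  end.

(** The length of [cadr]: one [Skip], or five instructions joined by four [Seq]. *)
Definition acost k := if k == 0 then 1 else 9.

Fixpoint ecost e :=
  match e with
  | V _ => 3
  | N _ => 1
  | B _ e1 e2 => ecost e1 + ecost e2 + 3
  | G k e => ecost e + acost k + 3
  end.

(* The variable [x], the bound of the loop on [x] and the [d]-th temporary live
   in the registers [3 x], [3 x + 2] and [3 d + 1]. *)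
Definition cadr d k :=
  if k == 0 then Skip else
  Seq (Const (3 * d.+1 + 1) 16) (Seq (Op Mul (3 * d + 1) (3 * d + 1) (3 * d.+1 + 1))
  (Seq (Const (3 * d.+1 + 1) k) (Seq (Op Add (3 * d + 1) (3 * d + 1) (3 * d.+1 + 1))
  (Op Add (3 * d + 1) 3 (3 * d + 1))))).

Fixpoint cexp d e :=
  match e with
  | V x => Seq (Const (3 * d + 1) 0) (Op Add (3 * d + 1) (3 * x) (3 * d + 1))
  | N k => Const (3 * d + 1) k
  | B o e1 e2 =>
      Seq (cexp d e1) (Seq (cexp d.+1 e2) (Op o (3 * d + 1) (3 * d + 1) (3 * d.+1 + 1)))
  | G k e => Seq (cexp d e) (Seq (cadr d k) (Read (3 * d + 1) (3 * d + 1)))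
  end.

Fixpoint cs s :=
  match s with
  | SNop => Skip
  | SAsn x e => Seq (cexp 0 e) (Seq (Const (3 * x) 0) (Op Add (3 * x) 1 (3 * x)))
  | SPut k e1 e2 => Seq (cexp 0 e1) (Seq (cadr 0 k) (Seq (cexp 1 e2) (Write 1 4)))
  | SToss x => Flip (3 * x)
  | SSeq s1 s2 => Seq (cs s1) (cs s2)
  | SIf e s1 s2 => Seq (cexp 0 e) (If 1 (cs s1) (cs s2))
  | SFor x e s =>
      Seq (cexp 0 e) (Seq (Const (3 * x + 2) 0) (Seq (Op Add (3 * x + 2) 1 (3 * x + 2))
      (Seq (Const (3 * x) 0) (Seq (Op Lt 1 (3 * x) (3 * x + 2))
      (While 1 (Seq (cs s) (Seq (Const 1 1) (Seq (Op Add (3 * x) (3 * x) 1)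
         (Op Lt 1 (3 * x) (3 * x + 2))))))))))
  end.

Record St := MkSt { sv : nat -> nat; sa : nat -> nat -> nat; st : nat }.

Section Language.

(* [W] is the word length, [Bs] the address below which array 0 lies, and [w]
   the sequence of coins, indexed by time. *)
Variables (W Bs : nat) (w : nat -> bool).
Hypothesis W_gt : 16 < 2 ^ W.

(** Array 0 is the plain memory below [Bs], where the input lies and the output goes. The other
    arrays are interleaved above it with stride 16, so that none needs a length fixed in advance. *)
Definition addr k i := if k == 0 then i else Bs + (16 * i + k).
Definition valid k i := if k == 0 then i < Bs else (k < 16) && (addr k i < 2 ^ W).

(** Only [Add] and [Mul] can leave the range of a word; truncated subtraction, division, remainder
    and comparison cannot. *)
Fixpoint oke v a (e : ex) : Prop :=
  match e with
  | V _ => True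
  | N k => k < 2 ^ W
  | B o e1 e2 => [/\ oke v a e1, oke v a e2 &
      match o with Add | Mul => eval_op o (ev v a e1) (ev v a e2) < 2 ^ W | _ => True end]
  | G k e => oke v a e /\ valid k (ev v a e)
  end.

(* The clock of the state counts the steps of the compiled program. *)
Definition forstep (sem : St -> St) x (s : St) : St :=
  let s1 := sem (MkSt (sv s) (sa s) (st s + 2)) in
  MkSt (upd (sv s1) x (sv s1 x).+1) (sa s1) (st s1 + 5).

(** A toss reads the coin of the current clock value. This is why steps are counted exactly: an
    upper bound would not tell which coin is read. *)
Fixpoint sem (s : stm) (c : St) : St :=
  match s with
  | SNop => MkSt (sv c) (sa c) (st c + 1)
  | SAsn x e => MkSt (upd (sv c) x (ev (sv c) (sa c) e)) (sa c) (st c + (ecost e + 4))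
  | SPut k e1 e2 =>
      MkSt (sv c) (upd2 (sa c) k (ev (sv c) (sa c) e1) (ev (sv c) (sa c) e2))
           (st c + (ecost e1 + ecost e2 + acost k + 4))
  | SToss x => MkSt (upd (sv c) x (w (st c))) (sa c) (st c + 1)
  | SSeq s1 s2 => sem s2 (sem s1 (MkSt (sv c) (sa c) (st c + 1)))
  | SIf e s1 s2 =>
      let c' := MkSt (sv c) (sa c) (st c + (ecost e + 2)) in
      if ev (sv c) (sa c) e != 0 then sem s1 c' else sem s2 c'
  | SFor x e s =>
      let c' := iter (ev (sv c) (sa c) e) (forstep (sem s) x)
                     (MkSt (upd (sv c) x 0) (sa c) (st c + (ecost e + 9))) in
      MkSt (sv c') (sa c') (st c' + 1)
  end.

(** Variable 1 may not be assigned because it holds [Bs], from which the compiled code computes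
    array addresses. *)
Fixpoint ok (s : stm) (c : St) : Prop :=
  match s with
  | SNop => True
  | SAsn x e => x != 1 /\ oke (sv c) (sa c) e
  | SPut k e1 e2 => [/\ oke (sv c) (sa c) e1, oke (sv c) (sa c) e2
                      & valid k (ev (sv c) (sa c) e1)]
  | SToss x => x != 1
  | SSeq s1 s2 => let c' := MkSt (sv c) (sa c) (st c + 1) in ok s1 c' /\ ok s2 (sem s1 c')
  | SIf e s1 s2 => oke (sv c) (sa c) e /\
      let c' := MkSt (sv c) (sa c) (st c + (ecost e + 2)) in
      if ev (sv c) (sa c) e != 0 then ok s1 c' else ok s2 c'
  | SFor x e s => [/\ oke (sv c) (sa c) e, x != 1, x \notin mods s &
      forall i, i < ev (sv c) (sa c) e ->
      let c' := iter i (forstep (sem s) x)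
                     (MkSt (upd (sv c) x 0) (sa c) (st c + (ecost e + 9))) in
      ok s (MkSt (sv c') (sa c') (st c' + 2))]
  end.

Lemma sem_frame s c x : x \notin mods s -> sv (sem s c) x = sv c x.
Proof.
elim: s c => [|y e|k e1 e2|y|s1 IH1 s2 IH2|e s1 IH1 s2 IH2|y e s IH] c //=.
- by rewrite inE /upd => /negbTE->.
- by rewrite inE /upd => /negbTE->.
- by rewrite mem_cat negb_or => /andP[h1 h2]; rewrite IH2 // IH1.
- by rewrite mem_cat negb_or => /andP[h1 h2]; case: ifP => _; rewrite ?IH1 ?IH2.
- rewrite inE negb_or => /andP[/negbTE xy h]; elim: (ev _ _ _) => [|i IHi] /=.
    by rewrite /upd xy.
  by rewrite /upd xy IH.
Qed.

Lemma sem_aframe s c k : k \notin amods s -> sa (sem s c) k = sa c k.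
Proof.
elim: s c => [|y e|k' e1 e2|y|s1 IH1 s2 IH2|e s1 IH1 s2 IH2|y e s IH] c //=.
- by rewrite inE /upd2 => /negbTE->.
- by rewrite mem_cat negb_or => /andP[h1 h2]; rewrite IH2 // IH1.
- by rewrite mem_cat negb_or => /andP[h1 h2]; case: ifP => _; rewrite ?IH1 ?IH2.
- by move=> h; elim: (ev _ _ _) => [|i IHi] //=; rewrite IH.
Qed.

(** * Correctness of the compiler *)

Definition go t s t' s' :=
  exists n, t' = t + n /\ s' = foldl (step W) s [seq w i | i <- iota t n].

Lemma go_trans t1 s1 t2 s2 t3 s3 : go t1 s1 t2 s2 -> go t2 s2 t3 s3 -> go t1 s1 t3 s3.
Proof.
move=> [n [-> ->]] [m [-> ->]]; exists (n + m).
by rewrite addnA iotaD map_cat foldl_cat.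
Qed.

Lemma go_cons t s t' s' : go t.+1 (step W s (w t)) t' s' -> go t s t' s'.
Proof. by apply: go_trans; exists 1; rewrite addn1. Qed.

Lemma go_refl t s t' : t = t' -> go t s t' s.
Proof. by move=> ->; exists 0; rewrite addn0. Qed.

(** Compiled code copies a register by adding 0, which truncates to a word; the bounds on all
    registers and cells make such copies exact. *)
Definition Rel v a (r m : nat -> nat) :=
  [/\ forall x, r (3 * x) = v x, forall x, r x < 2 ^ W,
      forall k i, valid k i -> m (addr k i) = a k i, forall z, m z < 2 ^ W & v 1 = Bs].

(** Evaluation at depth [d] may use the temporaries of depth at least [d]. Variables and loop bounds
    live in the registers that are not 1 modulo 3. *)
Definition keep d (r r' : nat -> nat) :=
  forall y, (y %% 3 != 1) || (y < 3 * d + 1) -> r' y = r y.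

Lemma Rel_keep v a r r' m d : Rel v a r m -> keep d r r' -> (forall y, r' y < 2 ^ W) ->
  Rel v a r' m.
Proof. by case=> h1 h2 h3 h4 h5 hk hb; split=> // x; rewrite hk //; lia. Qed.

Lemma word_small a : a < 2 ^ W -> word W a = a.
Proof. exact: modn_small. Qed.

Lemma word0 : word W 0 = 0.
Proof. exact: mod0n. Qed.

Lemma word_lt a : word W a < 2 ^ W.
Proof. by rewrite ltn_mod expn_gt0. Qed.

Lemma cadr_correct v a r m d k i K t : Rel v a r m -> r (3 * d + 1) = i -> valid k i ->
  exists r', [/\ go t (State (cadr d k :: K) r m) (t + acost k) (State K r' m),
    r' (3 * d + 1) = addr k i, keep d r r' & forall y, r' y < 2 ^ W].
Proof.
move=> [h1 h2 h3 h4 h5] hi; rewrite /valid /cadr /acost /addr.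
case: eqP => [_ lti|_ /andP[k16 hlt]].
  by exists r; split=> //; apply: go_cons; apply: go_refl; rewrite addn1.
eexists; split.
- do 9 apply: go_cons => /=; apply: go_refl; lia.
- have nA : (3 * d + 1 == 3 * d.+1 + 1) = false by lia.
  have n3 : (3 == 3 * d + 1) = false by lia.
  have n3' : (3 == 3 * d.+1 + 1) = false by lia.
  have e3 := h1 1; rewrite muln1 h5 in e3.
  move: (3 * d + 1) (3 * d.+1 + 1) hi nA n3 n3' => A B' hi nA n3 n3' /=.
  rewrite !eqxx nA n3 n3' hi e3 (word_small W_gt).
  have b1 : i * 16 < 2 ^ W by lia.
  have b2 : k < 2 ^ W by lia.
  rewrite (word_small b1) (word_small b2).
  have b3 : i * 16 + k < 2 ^ W by lia.
  have b4 : Bs + (i * 16 + k) < 2 ^ W by lia.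
  by rewrite (word_small b3) (word_small b4) (mulnC i).
- move=> y hy /=; do 5 (rewrite ifF; last by apply/negbTE; lia); done.
- by move=> y /=; do 5 (case: ifP => _; first exact: word_lt).
Qed.

Lemma cexp_correct v a e d r m K t : Rel v a r m -> oke v a e ->
  exists r', [/\ go t (State (cexp d e :: K) r m) (t + ecost e) (State K r' m),
    r' (3 * d + 1) = ev v a e, keep d r r' & forall y, r' y < 2 ^ W].
Proof.
elim: e d r K t => [x|k|o e1 IH1 e2 IH2|k e IH] d r K t hR hok; case: (hR) => h1 h2 h3 h4 h5.
- eexists; split.
  + do 3 apply: go_cons => /=; apply: go_refl; lia.
  + rewrite /= !eqxx (_ : (3 * x == _) = false); last lia.
    by rewrite h1 word0 addn0 word_small // -h1.
  + move=> y hy /=; do 2 (rewrite ifF; last by apply/negbTE; lia); done.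
  + by move=> y /=; do 2 (case: ifP => _; first exact: word_lt).
- eexists; split.
  + apply: go_cons; apply: go_refl => /=; lia.
  + by rewrite /= eqxx word_small.
  + move=> y hy /=; rewrite ifF //; apply/negbTE; lia.
  + by move=> y /=; case: ifP => _; first exact: word_lt.
- case: hok => o1 o2 o3.
  case: (IH1 d r (Seq (cexp d.+1 e2) (Op o (3 * d + 1) (3 * d + 1) (3 * d.+1 + 1)) :: K)
           t.+1 hR o1) => r1 [g1 e1v k1 b1].
  case: (IH2 d.+1 r1 (Op o (3 * d + 1) (3 * d + 1) (3 * d.+1 + 1) :: K)
           (t.+1 + ecost e1).+1 (Rel_keep hR k1 b1) o2) => r2 [g2 e2v k2 b2].
  eexists; split.
  + apply: go_cons; apply: go_trans g1 _; apply: go_cons; apply: go_trans g2 _.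
    apply: go_cons; apply: go_refl => /=; lia.
  + rewrite /= eqxx e2v k2; last lia.
    rewrite e1v word_small //; have := b1 (3 * d + 1); have := b2 (3 * d.+1 + 1).
    rewrite e1v e2v => bb2 bb1; move: o3; clear -bb1 bb2 W_gt; case: o => //= _.
    * by apply: leq_ltn_trans bb1; apply: leq_subr.
    * by apply: leq_ltn_trans bb1; apply: leq_div.
    * by apply: leq_ltn_trans bb1; apply: leq_mod.
    * by apply: leq_ltn_trans (leq_b1 _) _; lia.
  + move=> y hy /=; rewrite ifF; last by apply/negbTE; lia.
    rewrite k2; [by apply: k1 | lia].
  + by move=> y /=; case: ifP => _; rewrite ?word_lt.
- case: hok => o1 o2.
  case: (IH d r (Seq (cadr d k) (Read (3 * d + 1) (3 * d + 1)) :: K) t.+1 hR o1)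
    => r1 [g1 e1v k1 b1].
  case: (cadr_correct (Read (3 * d + 1) (3 * d + 1) :: K) (t.+1 + ecost e).+1
           (Rel_keep hR k1 b1) e1v o2) => r2 [g2 e2v k2 b2].
  eexists; split.
  + apply: go_cons; apply: go_trans g1 _; apply: go_cons; apply: go_trans g2 _.
    apply: go_cons; apply: go_refl => /=; lia.
  + by rewrite /= eqxx e2v h3.
  + move=> y hy /=; rewrite ifF; last by apply/negbTE; lia.
    by rewrite k2 ?k1.
  + by move=> y /=; case: ifP.
Qed.

Lemma addr_inj k i k' i' : valid k i -> valid k' i' -> addr k i = addr k' i' ->
  (k, i) = (k', i').
Proof. by rewrite /valid /addr; do 2 case: eqP => ?; move=> *; congr pair; lia. Qed.

Lemma eq33 x y : (3 * y == 3 * x) = (y == x).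
Proof. lia. Qed.

Lemma eq31 y : (3 * y == 1) = false.
Proof. lia. Qed.

Lemma eq13 y : (1 == 3 * y) = false.
Proof. lia. Qed.

Lemma eq332 x y : (3 * y == 3 * x + 2) = false.
Proof. lia. Qed.

Lemma eq323 x y : (3 * y + 2 == 3 * x) = false.
Proof. lia. Qed.

Lemma eq321 y : (3 * y + 2 == 1) = false.
Proof. lia. Qed.

Lemma eq132 y : (1 == 3 * y + 2) = false.
Proof. lia. Qed.

Definition eq3 := (eqxx, eq33, eq31, eq13, eq332, eq323, eq321, eq132).

Lemma Rel_asn v a r m x z : Rel v a r m -> z < 2 ^ W -> x != 1 ->
  forall r', (forall y, r' (3 * y) = if y == x then z else r (3 * y)) ->
    (forall y, r' y < 2 ^ W) ->
  Rel (upd v x z) a r' m.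
Proof.
case=> h1 h2 h3 h4 h5 hz hx r' hr' hb; split=> //.
- by move=> y; rewrite hr' /upd h1.
- by rewrite /upd eq_sym (negbTE hx).
Qed.

(** The last clause makes the induction pass through loops: after each round a loop on [x] reads its
    bound again from register [3 x + 2], and [x \notin mods s] guarantees that the body has left it
    alone. *)
Theorem cs_correct s c r m K : Rel (sv c) (sa c) r m -> ok s c ->
  exists r' m', [/\ go (st c) (State (cs s :: K) r m) (st (sem s c)) (State K r' m'),
    Rel (sv (sem s c)) (sa (sem s c)) r' m'
    & forall y, y \notin mods s -> r' (3 * y + 2) = r (3 * y + 2)].
Proof.
elim: s c r m K => [|x e|k e1 e2|x|s1 IH1 s2 IH2|e s1 IH1 s2 IH2|x e s IH] [v a t] r m K hR hok;
  rewrite /= in hR hok *.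
- by exists r, m; split=> //; apply: go_cons; apply: go_refl; lia.
- case: hok => hx he.
  case: (cexp_correct 0 (Seq (Const (3 * x) 0) (Op Add (3 * x) 1 (3 * x)) :: K) t.+1 hR he)
    => r1 [g1 v1 k1 b1]; rewrite muln0 add0n in v1.
  eexists; exists m; split.
  + apply: go_cons; apply: go_trans g1 _; do 3 apply: go_cons => /=; apply: go_refl; lia.
  + have hlt : ev v a e < 2 ^ W by rewrite -v1.
    apply: (Rel_asn (Rel_keep hR k1 b1) hlt hx) => y /=.
    * rewrite !eq3 v1 word0 addn0 word_small //.
      by case: (y == x).
    * by do ?(case: ifP => _); rewrite ?word_lt.
  + move=> y; rewrite inE => hy /=.
    do 2 (rewrite ifF; last by apply/negbTE; lia).
    by apply: k1; lia.
- case: hok => he1 he2 hval.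
  case: (cexp_correct 0 (Seq (cadr 0 k) (Seq (cexp 1 e2) (Write 1 4)) :: K) t.+1 hR he1)
    => r1 [g1 v1 k1 b1]; have hR1 := Rel_keep hR k1 b1.
  case: (cadr_correct (Seq (cexp 1 e2) (Write 1 4) :: K) (t.+1 + ecost e1).+1 hR1 v1 hval)
    => r2 [g2 v2 k2 b2]; have hR2 := Rel_keep hR1 k2 b2.
  case: (cexp_correct 1 (Write 1 4 :: K) ((t.+1 + ecost e1).+1 + acost k).+1 hR2 he2)
    => r3 [g3 v3 k3 b3]; have hR3 := Rel_keep hR2 k3 b3.
  exists r3; eexists; split.
  + apply: go_cons; apply: go_trans g1 _; apply: go_cons; apply: go_trans g2 _.
    apply: go_cons; apply: go_trans g3 _; apply: go_cons; apply: go_refl => /=; lia.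
  + case: hR3 => i1 i2 i3 i4 i5; split=> //=.
      move=> k' i' hv'; rewrite k3; last by rewrite muln1; lia.
      rewrite v2 v3 /upd2 /upd.
      case: (altP (addr k' i' =P addr k (ev v a e1))) => [/(addr_inj hv' hval)[-> ->]|ne].
        by rewrite !eqxx.
      case: eqP => [ek|_]; last exact: i3.
      case: eqP => [ei|_]; last by rewrite -ek; exact: i3.
      by rewrite ek ei eqxx in ne.
    by move=> z; case: ifP => _ //.
  + by move=> y _; rewrite k3 ?k2 ?k1 //; lia.
- eexists; exists m; split.
  + apply: go_cons; apply: go_refl => /=; lia.
  + have hb : (w t : nat) < 2 ^ W by apply: leq_ltn_trans (leq_b1 _) _; lia.
    case: (hR) => _ h2 _ _ _.
    apply: (Rel_asn hR hb hok) => y /=.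
    * by rewrite !eq3 word_small.
    * by case: ifP => _; rewrite ?word_lt.
  + by move=> y; rewrite inE => hy /=; rewrite ifF //; apply/negbTE; lia.
- case: hok => ok1 ok2.
  case: (IH1 (MkSt v a (t + 1)) r m (cs s2 :: K) hR ok1) => r1 [m1 [g1 hR1 l1]].
  case: (IH2 _ r1 m1 K hR1 ok2) => r2 [m2 [g2 hR2 l2]].
  exists r2, m2; split=> //.
  + by apply: go_cons; rewrite -addn1; apply: go_trans g1 g2.
  + by move=> y; rewrite mem_cat negb_or => /andP[h1 h2]; rewrite l2 ?l1.
- case: hok => he hs.
  case: (cexp_correct 0 (If 1 (cs s1) (cs s2) :: K) t.+1 hR he) => r1 [g1 v1 k1 b1].
  have hR1 := Rel_keep hR k1 b1.
  have gg : forall t' s', go (t + (ecost e + 2))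
      (State ((if ev v a e != 0 then cs s1 else cs s2) :: K) r1 m) t' s' ->
      go t (State (Seq (cexp 0 e) (If 1 (cs s1) (cs s2)) :: K) r m) t' s'.
    move=> t' s' g; apply: go_cons; apply: go_trans g1 _; apply: go_cons => /=.
    rewrite muln0 add0n in v1; rewrite v1.
    by rewrite (_ : (t.+1 + ecost e).+1 = t + (ecost e + 2)) //; lia.
  case: ifP hs gg => _ hs gg.
    case: (IH1 (MkSt v a (t + (ecost e + 2))) r1 m K hR1 hs) => r2 [m2 [g2 hR2 l2]]; exists r2, m2; split=> //.
    + exact: gg g2.
    + move=> y; rewrite mem_cat negb_or => /andP[h1 h2]; rewrite l2 // k1 //; lia.
  case: (IH2 (MkSt v a (t + (ecost e + 2))) r1 m K hR1 hs) => r2 [m2 [g2 hR2 l2]]; exists r2, m2; split=> //.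
  + exact: gg g2.
  + move=> y; rewrite mem_cat negb_or => /andP[h1 h2]; rewrite l2 // k1 //; lia.
- case: hok => he hx hxs hloop.
  set n := ev v a e in hloop *; set c0 := MkSt _ _ (t + _) in hloop *.
  set body := Seq (cs s) _; set lp := While 1 body.
  case: (cexp_correct 0 (Seq (Const (3 * x + 2) 0) (Seq (Op Add (3 * x + 2) 1 (3 * x + 2))
      (Seq (Const (3 * x) 0) (Seq (Op Lt 1 (3 * x) (3 * x + 2)) lp))) :: K) t.+1 hR he)
    => r1 [g1 v1 k1 b1]; rewrite muln0 add0n -/n in v1.
  have hn : n < 2 ^ W by rewrite -v1.
  have hR1 := Rel_keep hR k1 b1.
  have itx : forall i, sv (iter i (forstep (sem s) x) c0) x = i.
    elim=> [|i IHi]; first by rewrite /= /upd eqxx.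
    by rewrite iterS /forstep /= /upd eqxx sem_frame //= IHi.
  (* The machine is observed at the head of the [While], with the guard of round [i] already
     computed in register 1. *)
  have inv : forall i, i <= n -> exists r' m',
     [/\ go t (State (cs (SFor x e s) :: K) r m) (st (iter i (forstep (sem s) x) c0))
           (State (lp :: K) r' m'),
         Rel (sv (iter i (forstep (sem s) x) c0)) (sa (iter i (forstep (sem s) x) c0)) r' m',
         r' 1 = (i < n) :> nat, r' (3 * x + 2) = n
         & forall y, y \notin x :: mods s -> r' (3 * y + 2) = r (3 * y + 2)].
    elim=> [|i IHi] hi.
      eexists; exists m; split.
      + apply: go_cons; apply: go_trans g1 _; do 8 apply: go_cons => /=.
        apply: go_refl; lia.
      + apply: (Rel_asn hR1 _ hx); first lia.
        * by move=> y /=; rewrite !eq3 word0.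
        * by move=> y /=; do 5 (case: ifP => _; rewrite ?word_lt //).
      + by rewrite /= !eq3 word0 addn0 (word_small (_ : r1 1 < _)) v1 // word_small //; case: (0 < n); lia.
      + by rewrite /= !eq3 word0 addn0 word_small ?v1.
      + move=> y; rewrite inE negb_or => /andP[hy _] /=.
        do 4 (rewrite ifF; last by apply/negbTE; lia).
        by apply: k1; lia.
    case: (IHi (ltnW hi)) => r2 [m2 [g2 hR2 r21 r2l l2]].
    have hl := hloop i hi; rewrite /= in hl.
    set ci := iter i _ _ in g2 hR2 hl itx *.
    set K' := (Seq (Const 1 1) (Seq (Op Add (3 * x) (3 * x) 1)
                                    (Op Lt 1 (3 * x) (3 * x + 2)))) :: lp :: K.
    case: (IH (MkSt (sv ci) (sa ci) (st ci + 2)) r2 m2 K' hR2 hl) => r3 [m3 [g3 hR3 l3]].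
    rewrite iterS /forstep -/ci; set c3 := sem s _ in g3 hR3 *.
    have x3 : sv c3 x = i by rewrite /c3 sem_frame //= itx.
    case: (hR3) => e3 b3 _ _ _.
    have hi' : i.+1 < 2 ^ W by lia.
    eexists; exists m3; split.
    + apply: go_trans g2 _; apply: go_cons => /=; rewrite r21 hi /=.
      apply: go_cons => /=; rewrite addn2 in g3; apply: go_trans g3 _.
      do 5 apply: go_cons => /=; apply: go_refl; lia.
    + rewrite /= x3; apply: (Rel_asn hR3 hi' hx) => y /=.
        rewrite !eq3 e3 x3 (@word_small 1); last lia.
        by rewrite addn1 word_small.
      by do ?(case: ifP => _); rewrite ?word_lt.
    + rewrite /= !eq3 l3 // r2l e3 x3 (@word_small 1); last lia.
      rewrite addn1 (word_small hi') word_small //.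
      by apply: leq_ltn_trans (leq_b1 _) _; lia.
    + by rewrite /= !eq3 l3.
    + move=> y hy; rewrite /= !eq3 l3 ?l2 //.
      by move: hy; rewrite inE negb_or => /andP[].
  case: (inv n (leqnn n)) => r' [m' [g2 hR2 r21 _ l2]].
  exists r', m'; split=> //.
  by apply: go_trans g2 _; apply: go_cons => /=; rewrite r21 ltnn /=; apply: go_refl; lia.
Qed.

End Language.

Local Open Scope ring_scope.

(** * Pfaffians *)

Section Del.
Variable T : Type.
Implicit Types (s : seq T) (i j : nat).

Fixpoint del i s := match s, i with
  | [::], _ => [::]
  | x :: s', 0%N => s'
  | x :: s', i'.+1 => x :: del i' s'
  end.

Lemma size_del i s : (i < size s)%N -> size (del i s) = (size s).-1.
Proof. by elim: s i => [|x s IH] [|i] //= h; rewrite IH //; case: s h {IH}. Qed.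

Lemma nth_del x0 i s j : nth x0 (del i s) j = nth x0 s (bump i j).
Proof.
elim: s i j => [|x s IH] [|i] [|j] //=; rewrite ?nth_nil ?IH ?bumpS //.
Qed.

Lemma del_catl i s1 s2 : (i < size s1)%N -> del i (s1 ++ s2) = del i s1 ++ s2.
Proof. by elim: s1 i => [|x s IH] [|i] //= h; rewrite IH. Qed.

Lemma del_catr i s1 s2 : del (size s1 + i) (s1 ++ s2) = s1 ++ del i s2.
Proof. by elim: s1 => [|x s IH] //=; rewrite IH. Qed.

Lemma del_del i j s : (i < j)%N -> del j.-1 (del i s) = del i (del j s).
Proof.
elim: s i j => [|x s IH] [|i] [|j] //= h; case: j h => // j h.
by rewrite /= -(IH i j.+1).
Qed.

End Del.

Lemma map_del (T U : Type) (f : T -> U) i s : map f (del i s) = del i (map f s).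
Proof. by elim: s i => [|x s IH] [|i] //=; rewrite IH. Qed.

Lemma mem_del (T : eqType) i (s : seq T) : {subset del i s <= s}.
Proof.
elim: s i => [|x s IH] [|i] y //=; rewrite !inE; first by move->; rewrite orbT.
by case/orP=> [->//|/IH->]; rewrite orbT.
Qed.

Lemma mem_del_uniq (T : eqType) x0 i (s : seq T) y : uniq s -> (i < size s)%N ->
  (y \in del i s) = (y \in s) && (y != nth x0 s i).
Proof.
elim: s i => [|x s IH] [|i] //= /andP[xs us] h; rewrite !inE.
  case: eqP => [->|]; last by rewrite andbT.
  by rewrite (negbTE xs).
rewrite IH //; case: (altP (y =P x)) => [->|_] //=.
by apply/esym; apply: contra xs => /eqP->; rewrite mem_nth.
Qed.

Lemma del_uniq (T : eqType) i (s : seq T) : uniq s -> uniq (del i s).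
Proof.
elim: s i => [|x s IH] [|i] //= /andP[xs us] //; rewrite IH // andbT.
by apply: contra xs; apply: mem_del.
Qed.

Section Pf.
Variables (F : fieldType) (T : Type) (x0 : T) (A : T -> T -> F).
Implicit Types (s : seq T) (x y u : T).

(* The Pfaffian of the matrix indexed by [s], expanded along its first row; [m] is fuel. *)
Fixpoint pfn m s : F := match m, s with
  | m'.+1, x :: s' =>
      \sum_(0 <= i < size s') (-1) ^+ i * A x (nth x0 s' i) * pfn m' (del i s')
  | _, [::] => 1
  | 0%N, _ => 0
  end.

Definition pf s := pfn (size s) s.

Lemma pfn_eq m m' s : (size s <= m)%N -> (size s <= m')%N -> pfn m s = pfn m' s.
Proof.
elim: m m' s => [|m IH] [|m'] [|x s] //= h h'.
apply: eq_big_nat => i /andP[_ hi]; congr (_ * _).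
by apply: IH; rewrite size_del //; lia.
Qed.

Lemma pf_cons x s :
  pf (x :: s) = \sum_(0 <= i < size s) (-1) ^+ i * A x (nth x0 s i) * pf (del i s).
Proof.
rewrite {1}/pf /=; apply: eq_big_nat => i /andP[_ hi]; congr (_ * _).
by apply: pfn_eq; rewrite // size_del //; lia.
Qed.

(** The expansion along [u] is sorted by whether the partner of [u] comes before, at or after the
    marked entry [z]. Inductions on lists with a marked entry rest on this form. *)
Lemma pf_cat u s1 z s2 :
  pf (u :: s1 ++ z :: s2) =
    \sum_(0 <= i < size s1) (-1) ^+ i * A u (nth x0 s1 i) * pf (del i s1 ++ z :: s2)
    + (-1) ^+ size s1 * A u z * pf (s1 ++ s2)
    + \sum_(0 <= j < size s2)
        (-1) ^+ (size s1 + j).+1 * A u (nth x0 s2 j) * pf (s1 ++ z :: del j s2).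
Proof.
rewrite pf_cons size_cat /= (big_cat_nat (n := size s1)) ?leq_addr //=.
rewrite -addrA; congr (_ + _).
  by apply: eq_big_nat => i /andP[_ hi]; rewrite nth_cat hi del_catl.
rewrite -{1}[size s1]add0n big_addn addKn big_nat_recl //; congr (_ + _).
  rewrite add0n nth_cat ltnn subnn /=.
  by rewrite -[in del _ _](addn0 (size s1)) del_catr.
apply: eq_big_nat => j _; rewrite nth_cat ifF; last lia.
rewrite (_ : (j.+1 + size s1)%N = (size s1 + j.+1)%N); last by rewrite addnC.
by rewrite addKn del_catr addnS.
Qed.

(** [z] plays the role of the vector x + c y. Each term of the Pfaffian contains the marked index in
    exactly one matrix entry, so the Pfaffian is linear in that row and column taken together. *)
Lemma pf_lin c x y z s1 s2 :
  (forall u, A z u = A x u + c * A y u) -> (forall u, A u z = A u x + c * A u y) ->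
  pf (s1 ++ z :: s2) = pf (s1 ++ x :: s2) + c * pf (s1 ++ y :: s2).
Proof.
move=> hl hr; move: {2}(size s1 + size s2)%N (leqnn (size s1 + size s2)) => m.
elim: m s1 s2 => [|m IH] [|u s1] s2 hm; rewrite ?cat0s; try by rewrite addSn in hm.
- by case: s2 hm => // _; rewrite !pf_cons /= !big_nil mulr0 addr0.
- rewrite !pf_cons mulr_sumr -big_split; apply: eq_bigr => i _ /=.
  by rewrite hl; ring.
rewrite !cat_cons !pf_cat hr !mulrDr !mulr_sumr.
rewrite [RHS](_ : _ = \sum_(0 <= i < size s1)
     ((-1) ^+ i * A u (nth x0 s1 i) * pf (del i s1 ++ x :: s2)
      + c * ((-1) ^+ i * A u (nth x0 s1 i) * pf (del i s1 ++ y :: s2)))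
   + (-1) ^+ size s1 * (A u x + c * A u y) * pf (s1 ++ s2)
   + \sum_(0 <= j < size s2)
     ((-1) ^+ (size s1 + j).+1 * A u (nth x0 s2 j) * pf (s1 ++ x :: del j s2)
      + c * ((-1) ^+ (size s1 + j).+1 * A u (nth x0 s2 j) * pf (s1 ++ y :: del j s2))));
  last by rewrite !big_split /=; ring.
rewrite !mulrDl mulrDr mulrDl; congr (_ + _ + _).
  apply: eq_big_nat => i /andP[_ hi]; rewrite IH; first by ring.
  by rewrite size_del //; move: hm => /=; lia.
apply: eq_big_nat => j /andP[_ hj]; rewrite IH; first by ring.
by rewrite size_del //; move: hm => /=; lia.
Qed.

Hypothesis skew : forall x y, A x y = - A y x.

(** Expanding along both of the first two rows gives a sum over ordered pairs (i, j) of partners.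
    Interchanging x and y amounts to interchanging i and j, and of the two shifts [unbump i j] and
    [unbump j i] exactly one is effective, which costs a sign. *)
Lemma pf_swap0 x y s : pf (x :: y :: s) = - pf (y :: x :: s).
Proof.
(* [unbump i j] is the position of entry [j] after entry [i] has been deleted; the successor in the
   exponent accounts for [y] standing in front of [s]. *)
pose g x y i j := (-1) ^+ (i + unbump i j).+1 * A x (nth x0 s i) * A y (nth x0 s j)
   * pf (del (unbump i j) (del i s)).
have E : forall x y, pf (x :: y :: s) =
    A x y * pf s + \sum_(i < size s) \sum_(j < size s | j != i) g x y i j.
  move=> {}x {}y; rewrite pf_cons /= big_nat_recl //= mul1r; congr (_ + _).
  rewrite big_mkord; apply: eq_bigr => -[i hi] _ /=.
  rewrite pf_cons size_del // mulr_sumr big_mkord.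
  case: (size s) hi => // k hi /=; rewrite [RHS]big_mkcond /=.
  rewrite (bigD1_ord (Ordinal hi)) //= eqxx /= add0r; apply: eq_bigr => j _.
  rewrite ifT; last by rewrite eq_sym neq_lift.
  rewrite nth_del /g /= bumpK -/(bump i j) exprS exprS exprD; ring.
rewrite !E opprD skew mulNr; congr (_ + _).
rewrite -sumrN (exchange_big_dep xpredT) //=; apply: eq_bigr => j _.
rewrite -sumrN; apply: eq_big => [i|i]; first by rewrite eq_sym.
move=> ij; rewrite /g.
have [lt|gt|eq] := ltngtP i j; last by rewrite (val_inj eq) eqxx in ij.
- rewrite {1 3}/unbump /unbump lt (_ : (j < i)%N = false) /=; last lia.
  rewrite subn0 subn1 del_del // !exprS (_ : (i + j.-1)%N = (j + i).-1); last lia.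
  rewrite -[in RHS](@prednK (j + i)) ?exprS; [ring|lia].
- rewrite {1 3}/unbump /unbump gt (_ : (i < j)%N = false) /=; last lia.
  rewrite subn0 subn1 -del_del // !exprS (_ : (j + i.-1)%N = (i + j).-1); last lia.
  rewrite -[in LHS](@prednK (i + j)) ?exprS; [ring|lia].
Qed.

Lemma pf_swap x y s1 s2 : pf (s1 ++ x :: y :: s2) = - pf (s1 ++ y :: x :: s2).
Proof.
move: {2}(size s1 + size s2)%N (leqnn (size s1 + size s2)) => m.
elim: m s1 s2 => [|m IH] [|u s1] s2 hm; rewrite ?cat0s; try exact: pf_swap0.
  by rewrite addSn in hm.
rewrite !cat_cons !pf_cat /= !big_nat_recl //= addn0.
under eq_big_nat => i /andP[_ hi].
  rewrite IH; last by rewrite size_del //; move: hm => /=; lia.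
  rewrite mulrN; over.
under [X in _ + (_ + X)]eq_big_nat => j /andP[_ hj].
  rewrite IH; last by rewrite size_del //; move: hm => /=; lia.
  rewrite mulrN; over.
rewrite !sumrN !exprS; ring.
Qed.

Hypothesis two_neq0 : (2%:R : F) != 0.

(** Adjacent swaps bring the two copies together; swapping them then shows that the Pfaffian is its
    own negative. *)
Lemma pf_rep x s1 s2 s3 : pf (s1 ++ x :: s2 ++ x :: s3) = 0.
Proof.
elim: s2 s1 => [|y s2 IH] s1 /=.
  have /eqP := pf_swap x x s1 s3; rewrite -subr_eq0 opprK -mulr2n -mulr_natl mulf_eq0.
  by rewrite (negbTE two_neq0) => /eqP.
by rewrite pf_swap -cat_rcons IH oppr0.
Qed.

End Pf.

Lemma pf_map (F : fieldType) (T U : eqType) x0 y0 (A : T -> T -> F) (B : U -> U -> F)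
    (f : U -> T) s :
  {in s &, forall a b, B a b = A (f a) (f b)} -> pf x0 A (map f s) = pf y0 B s.
Proof.
move: {2}(size s) (leqnn (size s)) => m; elim: m s => [|m IH] [|x s] //= hm h.
rewrite !pf_cons size_map; apply: eq_big_nat => i /andP[_ hi].
rewrite (nth_map y0) // -map_del IH ?h ?inE ?eqxx ?mem_nth ?orbT //.
  by rewrite size_del //; lia.
by move=> a b ha hb; apply: h; rewrite inE (mem_del ha, mem_del hb) orbT.
Qed.

Lemma pf_eq (F : fieldType) (T : eqType) x0 (A B : T -> T -> F) s :
  {in s &, forall a b, A a b = B a b} -> pf x0 A s = pf x0 B s.
Proof. by move=> h; rewrite -[in RHS](map_id s); apply/esym/pf_map. Qed.

(** * Pfaffian elimination *)

Section Elimination.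
Variables (F : fieldType) (A : nat -> nat -> F).
Hypothesis skew : forall x y, A x y = - A y x.
Hypothesis two_neq0 : (2%:R : F) != 0.

Let pf0 := @pf F nat 0%N.

Lemma skew_diag x : A x x = 0.
Proof.
have /eqP := skew x x; rewrite -subr_eq0 opprK -mulr2n -mulr_natl mulf_eq0.
by rewrite (negbTE two_neq0) => /eqP.
Qed.

(* The pair [(a, c)] stands for the vector [a + c w]. *)
Lemma pf_rowop w (f : nat -> F) s : w \in s -> f w = 0 ->
  pf0 (fun a b => A a b + f a * A w b + f b * A a w) s = pf0 A s.
Proof.
move=> ws fw.
pose A2 (p q : nat * F) := A p.1 q.1 + p.2 * A w q.1 + q.2 * A p.1 w.
pose z := (0%N, 0 : F).
have sk2 p q : A2 p q = - A2 q p.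
  by rewrite /A2 (skew p.1 q.1) (skew w q.1) (skew p.1 w); ring.
(* The vectors are modified one at a time: those of [s1] are still in their original form, those of
   [s2] already modified. Each exchange is an instance of [pf_lin] whose second term contains [w]
   twice and vanishes by [pf_rep]. *)
suff main s2 s1 : w \in s1 ++ s2 ->
    pf z A2 (map (pair^~ 0) s1 ++ map (fun a => (a, f a)) s2) = pf0 A (s1 ++ s2).
  by rewrite -(main s [::]) //; apply/esym/pf_map => a b _ _.
elim: s2 s1 => [|a s2 IH] s1 hw.
  by rewrite !cats0; apply: pf_map => a b _ _; rewrite /A2 /= !mul0r !addr0.
have -> : pf z A2 (map (pair^~ 0) s1 ++ map (fun a => (a, f a)) (a :: s2)) =
    pf z A2 (map (pair^~ 0) s1 ++ (a, 0) :: map (fun a => (a, f a)) s2).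
  case: (altP (a =P w)) => [->|aw]; first by rewrite /= fw.
  rewrite /= (@pf_lin _ _ z A2 (f a) (a, 0) (w, 0)); first last.
  - by move=> q; rewrite /A2 /= skew_diag; ring.
  - by move=> q; rewrite /A2 /= skew_diag; ring.
  rewrite [X in _ + _ * X](_ : _ = 0) ?mulr0 ?addr0 //.
  move: hw; rewrite mem_cat inE eq_sym (negbTE aw) /= => /orP[] h.
    case/splitPr: h => s3 s4; rewrite map_cat /= -catA /=.
    by rewrite pf_rep.
  case/splitPr: h => s3 s4; rewrite map_cat /= fw.
  by rewrite pf_rep.
have := IH (rcons s1 a); rewrite !map_rcons !cat_rcons; exact.
Qed.

Lemma pf_head0 u s : {in s, forall a, A u a = 0} -> pf0 A (u :: s) = 0.
Proof.
move=> h; rewrite /pf0 pf_cons big1_seq // => i; rewrite mem_index_iota => hi.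
by rewrite h ?mem_nth ?mulr0 ?mul0r.
Qed.

(** For skew [A], the Schur complement of the block on [u] and [v]. *)
Definition elim_mx u v a b :=
  A a b - A u a / A u v * A v b - A u b / A u v * A a v.

(** Subtracting multiples of the vector [v] clears every entry of row [u] except the one at [v], so
    a single term of the expansion along [u] is left. *)
Lemma pf_elim u v s : uniq (u :: v :: s) -> A u v != 0 ->
  pf0 A (u :: v :: s) = A u v * pf0 (elim_mx u v) s.
Proof.
rewrite /= inE negb_or => /andP[/andP[uv us] /andP[vs _]] nz.
pose f a := if (a == u) || (a == v) then 0 else - (A u a / A u v).
rewrite -(@pf_rowop v f) /f ?eqxx ?orbT //; last by rewrite !inE eqxx orbT.
rewrite /pf0 pf_cons big_nat_recl //= big1_seq ?addr0.
  rewrite expr0 mul1r !eqxx /= orbT !mul0r !addr0; congr (_ * _).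
  apply: pf_eq => a b ha hb; rewrite /elim_mx.
  have n1 c : c \in s -> (c == u) || (c == v) = false.
    move=> hc; apply/negbTE; rewrite negb_or; apply/andP.
    by split; [apply: contraNneq us => <- | apply: contraNneq vs => <-].
  by rewrite !n1 // !mulNr.
move=> i /=; rewrite mem_index_iota => hi; set c := nth _ _ _.
have hc : c \in s by rewrite mem_nth.
rewrite eqxx !mul0r addr0 ifF.
  by rewrite mulNr divfK // subrr mulr0 mul0r.
apply/negbTE; rewrite negb_or; apply/andP.
by split; [apply: contraNneq us => <- | apply: contraNneq vs => <-].
Qed.

End Elimination.

Local Close Scope ring_scope.

(** * Binary expansions *)

Lemma bin_lt (f : nat -> bool) n : \sum_(i < n) f i * 2 ^ i < 2 ^ n.
Proof.
elim: n => [|n IH]; first by rewrite big_ord0.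
rewrite big_ord_recr /= expnS; move: IH (leq_b1 (f n)).
by move: (\sum_(i < n) f i * 2 ^ i) (2 ^ n) (nat_of_bool (f n)) => S x b; nia.
Qed.

Lemma bin_inj (f g : nat -> bool) n :
  \sum_(i < n) f i * 2 ^ i = \sum_(i < n) g i * 2 ^ i -> forall i, i < n -> f i = g i.
Proof.
elim: n => [|n IH] //; rewrite !big_ord_recr /= => h i.
have hf := bin_lt f n; have hg := bin_lt g n.
have e : f n = g n.
  move: h hf hg; move: (\sum_(i < n) f i * 2 ^ i) (\sum_(i < n) g i * 2 ^ i) => S S'.
  by case: (f n) (g n) => [] []; rewrite ?mul1n ?mul0n //; lia.
rewrite e in h; rewrite ltnS leq_eqVlt => /orP[/eqP->//|]; apply: IH.
by move/addIn: h.
Qed.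

(** * Finite differences *)

(** By induction on [d]: the identity i C(n, i) = n C(n - 1, i - 1) absorbs one factor i, and the
    binomial theorem rewrites the remaining power in terms of i - 1, where lower exponents
    appear. *)
Lemma findiff (R : comNzRingType) n d : d < n ->
  (\sum_(i < n.+1) (-1) ^+ i * 'C(n, i)%:R * i%:R ^+ d = 0 :> R)%R.
Proof.
elim/ltn_ind: d n => -[|d] IH [|n] // hd.
  transitivity (((1 - 1) ^+ n.+1)%R : R); last by rewrite subrr expr0n.
  rewrite exprDn; apply: eq_bigr => i _.
  by rewrite expr1n mul1r expr0 mulr1 mulr_natr.
rewrite big_ord_recl /= expr0n mulr0 add0r.
transitivity ((- n.+1%:R * \sum_(i < n.+1) \sum_(l < d.+1)
   'C(d, l)%:R * ((-1) ^+ i * 'C(n, i)%:R * i%:R ^+ (d - l)))%R : R).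
  rewrite mulr_sumr; apply: eq_bigr => i _.
  have -> : (\sum_(l < d.+1) 'C(d, l)%:R * ((-1) ^+ i * 'C(n, i)%:R * i%:R ^+ (d - l)) =
     (-1) ^+ i * 'C(n, i)%:R * (i.+1%:R ^+ d) :> R)%R.
    rewrite -[(i.+1%:R)%R]natr1 exprDn mulr_sumr; apply: eq_bigr => l _.
    by rewrite expr1n mulr1 -mulr_natr; ring.
  rewrite /bump /= add1n exprS (exprS _ d).
  have := mul_bin_diag n.+1 i => /= /(congr1 (fun k => k%:R : R)%R); rewrite !natrM => e.
  transitivity ((-1) ^+ i * -1 * (i.+1%:R * 'C(n.+1, i.+1)%:R) * i.+1%:R ^+ d : R)%R.
    by ring.
  by rewrite -e; ring.
rewrite exchange_big /= big1 ?mulr0 // => l _.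
by rewrite -mulr_sumr IH ?mulr0 //; lia.
Qed.

(** * Primes in an interval *)

Lemma exp2_le_bin n : 2 ^ n <= 'C(2 * n, n).
Proof.
elim: n => [|n IH] //.
have h : 'C(2 * n, n) <= 'C((2 * n).+1, n) by case: (n) => // m; rewrite [leqRHS]binS leq_addr.
rewrite (_ : 2 * n.+1 = (2 * n).+2) ?expnS; last lia.
by rewrite binS [X in _ <= X + _]binS; lia.
Qed.

(** By Legendre's formula the exponent of p is the sum over k of the differences between the integer
    part of 2n/p^k and twice that of n/p^k. Each difference is at most 1, and it is 0 once p^k
    exceeds 2n. *)
Lemma logn_central_bin p n : prime p -> p ^ logn p 'C(2 * n, n) <= maxn 1 (2 * n).
Proof.
move=> pp; have p1 := prime_gt1 pp.
case: (posnP n) => [->|n0]; first by rewrite muln0 bin0 logn1.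
have lb : logn p 'C(2 * n, n) <= trunc_log p (2 * n).
  have hf : logn p 'C(2 * n, n) + 2 * logn p n`! = logn p (2 * n)`!.
    rewrite -(@bin_fact (2 * n) n) ?leq_pmull // (_ : 2 * n - n = n); last lia.
    by rewrite !lognM ?muln_gt0 ?fact_gt0 ?bin_gt0 ?leq_pmull //; lia.
  have hn : logn p n`! = \sum_(1 <= k < (2 * n).+1) n %/ p ^ k.
    rewrite logn_fact // [RHS](big_cat_nat (n := n.+1)) //=; last lia.
    rewrite [X in _ + X]big1_seq ?addn0 // => k /andP[_]; rewrite mem_index_iota => /andP[hk _].
    by rewrite divn_small // (leq_trans _ (ltnW (ltn_expl _ p1))) // ltnW // ltnW.
  have : logn p (2 * n)`! <= trunc_log p (2 * n) + 2 * logn p n`!.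
    rewrite logn_fact // hn big_distrr /=.
    have -> : trunc_log p (2 * n) = \sum_(1 <= k < (2 * n).+1) (k <= trunc_log p (2 * n)).
      have tl : trunc_log p (2 * n) <= 2 * n.
        by rewrite (leq_trans (ltnW (ltn_expl _ p1))) // trunc_logP //; lia.
      rewrite (big_cat_nat (n := (trunc_log p (2 * n)).+1)) //=.
      rewrite [X in _ = X + _](_ : _ = trunc_log p (2 * n)); last first.
        rewrite big_nat_cond (eq_bigr (fun=> 1)) => [|k]; last by case/andP=> /andP[_ ?] _; lia.
        by rewrite -big_nat_cond sum_nat_const_nat; lia.
      rewrite big_nat_cond big1 ?addn0 // => k /andP[/andP[hk _] _]; lia.
    rewrite -big_split /= big_seq_cond [leqRHS]big_seq_cond.
    apply: leq_sum => k /andP[]; rewrite mem_index_iota => /andP[k0 _] _.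
    case: (leqP k (trunc_log p (2 * n))) => hk.
      have pk : 0 < p ^ k by rewrite expn_gt0 ltnW.
      rewrite -ltnS ltn_divLR //; have := ltn_ceil n pk.
      by move: (n %/ p ^ k) (p ^ k) => a b; nia.
    by rewrite divn_small //; rewrite (leq_trans (trunc_log_ltn _ p1)) // leq_exp2l.
  by rewrite -hf; lia.
rewrite (leq_trans (leq_pexp2l (ltnW p1) lb)) // leq_max trunc_logP ?orbT //; lia.
Qed.

(** With n = 2^q (2q + 8), suppose that no prime lies in (2^q, 2n]. Then C(2n, n) is a product of at
    most 2^q prime powers, each at most 2n, whereas it is at least 2^n. But 2n < 2^(2q + 8), so
    (2n)^(2^q) < 2^n. *)
Lemma exists_prime q : exists2 p, prime p & 2 ^ q < p <= 2 * (2 ^ q * (2 * q + 8)).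
Proof.
set n := 2 ^ q * (2 * q + 8); set Q := 2 ^ q.
have n0 : 0 < n by rewrite muln_gt0 expn_gt0; lia.
case: (boolP (has (fun p => prime p && (Q < p)) (iota 0 (2 * n).+1))) => [|/hasPn none].
  case/hasP=> p; rewrite mem_iota add0n ltnS => /andP[_ hp] /andP[pp hQ].
  by exists p => //; rewrite hQ.
have C0 : 0 < 'C(2 * n, n) by rewrite bin_gt0; lia.
have hC : 'C(2 * n, n) <= (2 * n) ^ Q.
  rewrite -{1}(partnT C0) /partn.
  apply: (@leq_trans (\prod_(0 <= p < 'C(2 * n, n).+1) (if 0 < p <= Q then 2 * n else 1))).
    rewrite big_seq_cond [X in _ <= X]big_seq_cond; apply: leq_prod => p _.
    case: (boolP (prime p)) => pp; last first.
      by rewrite lognE (negbTE pp) expn0; case: ifP => _; lia.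
    rewrite prime_gt0 //=; case: (leqP p Q) => hp.
      by rewrite (leq_trans (logn_central_bin n pp)) // geq_max; lia.
    case: (leqP p (2 * n)) => hp2.
      by have := none p; rewrite mem_iota ltnS hp2 pp hp => /(_ isT).
    rewrite lognE ifF //; apply/negbTE; rewrite pp C0 /=; apply/negP => pC.
    have : p %| (2 * n)`! by rewrite -(@bin_fact (2 * n) n) ?dvdn_mulr //; lia.
    rewrite fact_prod big_seq; elim/big_ind: _ => [||k].
    - by rewrite dvdn1 => /eqP p1; rewrite p1 in pp.
    - by move=> x y hx hy; rewrite Euclid_dvdM // => /orP[].
    - rewrite mem_index_iota => hk /dvdn_leq hh; have := hh; lia.
  rewrite -big_mkcond big_const_seq iter_muln_1 /=.
  rewrite leq_pexp2l //; first lia.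
  rewrite add0n -size_filter -[leqRHS](size_iota 1 Q); apply: uniq_leq_size.
    by rewrite filter_uniq // iota_uniq.
  by move=> p; rewrite mem_filter => /andP[h _]; rewrite mem_iota; lia.
have := leq_trans (exp2_le_bin n) hC; rewrite leqNgt => /negP[].
have h2n : 2 * n < 2 ^ (2 * q + 8).
  have e8 : 2 * q + 8 < 2 ^ (q + 7).
    by elim: (q) => [|k IH] //; rewrite addSn expnS; lia.
  have -> : 2 ^ (2 * q + 8) = 2 * (Q * 2 ^ (q + 7)).
    by rewrite /Q -expnD -expnS; congr (_ ^ _); lia.
  by rewrite ltn_pmul2l // ltn_pmul2l // expn_gt0.
rewrite [X in _ < 2 ^ X](_ : n = (2 * q + 8) * Q); last by rewrite mulnC.
rewrite expnM ltn_exp2r //.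
by rewrite expn_gt0.
Qed.

(** * The Schwartz-Zippel lemma *)

Section SchwartzZippel.
Variables (F : fieldType) (I X : finType) (v : X -> F).
Hypothesis v_inj : injective v.
Local Open Scope ring_scope.

(** A multilinear polynomial, its coefficients indexed by sets of variables; sums over matchings are
    of this kind. Values come from a finite set [X] injected into the field, later the bit strings
    of length q. *)
Definition mpeval (c : {set I} -> F) (x : {ffun I -> X}) : F :=
  \sum_(M : {set I}) c M * \prod_(e in M) v (x e).

(** Choose a variable [e] that occurs and write the polynomial as x_e G + H, both G and H free of
    x_e. A zero is either a zero of G, which has degree at most d, or its value at [e] is determined
    by its other values. *)
Lemma schwartz_zippel d (c : {set I} -> F) M0 :
  (forall M, c M != 0 -> (#|M| <= d)%N) -> c M0 != 0 ->
  (#|[set x | mpeval c x == 0%R]| * #|X| <= d * #|{: {ffun I -> X}}|)%N.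
Proof.
elim: d c M0 => [|d IH] c M0 hd hM0.
  rewrite (_ : [set x | _] = set0) ?cards0 //; apply/setP => x; rewrite !inE.
  have c0 M : M != set0 -> c M = 0.
    by move=> hM; apply/eqP; apply: contraNT hM => /hd; rewrite leqn0 cards_eq0.
  apply/negbTE; rewrite /mpeval (bigD1 set0) //= [X in _ + X]big1; last first.
    by move=> M hM; rewrite c0 ?mul0r.
  rewrite addr0.
  rewrite big_set0 mulr1; case: (altP (M0 =P set0)) hM0 => [->//|/c0->]; by rewrite eqxx.
case: (pickP [pred e | [exists M : {set I}, (e \in M) && (c M != 0)]]) => [e /= /existsP[M1 /andP[eM1 cM1]]|none].
  pose cG (M : {set I}) := if e \in M then 0 else c (e |: M).
  have hG : (#|[set x | mpeval cG x == 0%R]| * #|X| <= d * #|{: {ffun I -> X}}|)%N.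
    apply: (IH cG (M1 :\ e)).
      move=> M; rewrite /cG; case: ifP => [_|eM]; first by rewrite eqxx.
      by move/hd; rewrite cardsU1 eM.
    by rewrite /cG !inE eqxx /= setD1K.
  pose Z := [set x | (mpeval c x == 0) && (mpeval cG x != 0)].
  pose up (x : {ffun I -> X}) a := [ffun i => if i == e then a else x i].
  have sub : [set x | mpeval c x == 0] \subset [set x | mpeval cG x == 0] :|: Z.
    by apply/subsetP => x; rewrite !inE => ->; case: (mpeval cG x == 0).
  apply: leq_trans (leq_mul (leq_trans (subset_leq_card sub) (leq_card_setU _ _)) (leqnn _)) _.
  rewrite mulnDl mulSn addnC leq_add //.
  have decomp x : mpeval c x = v (x e) * mpeval cG x +
      \sum_(M : {set I} | e \notin M) c M * \prod_(i in M) v (x i).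
    rewrite /mpeval (bigID (fun M : {set I} => e \in M)) /=; congr (_ + _).
    rewrite mulr_sumr [RHS](bigID (fun M : {set I} => e \in M)) /=.
    rewrite [X in _ = X + _]big1 ?add0r; last by move=> M eM; rewrite /cG eM mul0r mulr0.
    rewrite (reindex_onto (fun M => e |: M) (fun M => M :\ e)) /=; last by move=> M; apply: setD1K.
    apply: eq_big => M; first by rewrite setU11 /=; case: (boolP (e \in M)) => eM;
       [apply/negbTE/eqP => /setP/(_ e); rewrite !inE eqxx eM | rewrite setU1K ?eqxx].
    rewrite setU11 /= => /eqP hM; have eM : e \notin M by rewrite -hM !inE eqxx.
    by rewrite /cG (negbTE eM) big_setU1 //=; ring.
  have indep (cc : {set I} -> F) x a : (forall M : {set I}, e \in M -> cc M = 0) -> mpeval cc (up x a) = mpeval cc x.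
    move=> h; apply: eq_bigr => M _; case: (boolP (e \in M)) => [/h->|eM]; first by rewrite !mul0r.
    congr (_ * _); apply: eq_bigr => i iM; rewrite ffunE ifF //.
    by apply: contraNF eM => /eqP<-.
  (* Overwriting the value at [e] maps Z x X injectively into the set of all points: the point of Z
     can be recovered from its values outside [e]. *)
  rewrite -cardsT -cardsX -(card_in_imset (f := fun p => up p.1 p.2)).
    by rewrite max_card.
  move=> [x a] [y b]; rewrite !inE !andbT /= => /andP[/eqP x0 xG] /andP[/eqP y0 yG] huv.
  have hab : a = b by have := congr1 (fun f : {ffun I -> X} => f e) huv; rewrite !ffunE eqxx.
  have hoff i : i != e -> x i = y i.
    by move=> ie; have := congr1 (fun f : {ffun I -> X} => f i) huv; rewrite !ffunE (negbTE ie).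
  have hGxy : mpeval cG x = mpeval cG y.
    have cG0 (M : {set I}) : e \in M -> cG M = 0 by rewrite /cG => ->.
    by rewrite -(indep _ x a cG0) -(indep _ y b cG0) huv.
  have hxy : v (x e) = v (y e).
    apply: (mulIf xG); rewrite {2}hGxy; apply: (addIr (\sum_(M : {set I} | e \notin M) c M * \prod_(i in M) v (x i))).
    rewrite -decomp x0 [X in _ + X](_ : _ = \sum_(M : {set I} | e \notin M) c M * \prod_(i in M) v (y i)).
      by rewrite -decomp y0.
    apply: eq_bigr => M eM; congr (_ * _); apply: eq_bigr => i iM; rewrite hoff //.
    by apply: contraNneq eM => <-.
  congr pair => //; apply/ffunP => i; case: (altP (i =P e)) => [->|/hoff//].
  exact: v_inj.
apply: leq_trans (_ : d * #|{: {ffun I -> X}}| <= _)%N; last by rewrite leq_mul2r leqnSn orbT.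
apply: (IH c M0) => // M cM; case: (set_0Vmem M) => [->|[e eM]]; first by rewrite cards0.
by have /existsP[] := none e; exists M; rewrite eM.
Qed.

End SchwartzZippel.

(** * Projections of uniform coins *)

(** All fibres of the projection have the same size, because flipping the coins at the positions
    where [b] is true exchanges the fibre over [b] with the fibre over the zero string. *)
Lemma card_proj_coins T (D : finType) (pos : D -> 'I_T) (P : pred {ffun D -> bool}) :
  injective pos ->
  #|[set w : T.-tuple bool | P [ffun d => tnth w (pos d)]]| * 2 ^ #|D|
    = #|[set b | P b]| * 2 ^ T.
Proof.
move=> pos_inj; pose pr (w : T.-tuple bool) := [ffun d => tnth w (pos d)].
pose c b := #|[set w | pr w == b]|.
have cE b : c b = c [ffun=> false].
  pose fl (w : T.-tuple bool) := [tuple tnth w i (+) [exists d, (pos d == i) && b d] | i < T].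
  have flK : involutive fl.
    by move=> w; apply: eq_from_tnth => i; rewrite !tnth_mktuple -addbA addbb addbF.
  have e d : [exists d', (pos d' == pos d) && b d'] = b d.
    apply/existsP/idP => [[d' /andP[/eqP/pos_inj->]]//|bd].
    by exists d; rewrite eqxx.
  rewrite /c -(card_imset _ (inv_inj flK)); apply: eq_card => w.
  rewrite inE -[w in LHS]flK (mem_imset _ _ (inv_inj flK)) inE.
  apply/eqP/eqP => /ffunP h; apply/ffunP => d; have := h d; rewrite !ffunE tnth_mktuple e.
    by case: (tnth w (pos d)) (b d) => [] [].
  by move=> ->.
have cT : 2 ^ T = 2 ^ #|D| * c [ffun=> false].
  rewrite -{1}card_bool -card_tuple -sum1_card (partition_big pr xpredT) //=.
  rewrite (eq_bigr (fun=> c [ffun=> false])).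
    by rewrite sum_nat_const card_ffun card_bool.
  by move=> b _; rewrite sum1dep_card -(cE b); apply: eq_card => w; rewrite !inE.
have -> : #|[set w | P (pr w)]| = #|[set b | P b]| * c [ffun=> false]; last first.
  by rewrite cT -mulnA (mulnC (c _)).
rewrite -sum1_card (partition_big pr P) => [|w]; last by rewrite inE.
rewrite (eq_bigr (fun=> c [ffun=> false])).
  by rewrite sum_nat_const; congr (_ * _); apply: eq_card => b; rewrite inE.
move=> b Pb; rewrite sum1dep_card -(cE b); apply: eq_card => w; rewrite !inE.
by case: eqP => [->|]; rewrite ?andbT ?andbF.
Qed.

(** * Characters of the elementary abelian 2-group *)

Section Characters.
Variables (F : fieldType) (t : nat).
Hypothesis two_neq0 : (2%:R : F)%R != 0%R.
Local Open Scope ring_scope.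

Definition bsgn (b : bool) : F := (-1) ^+ b.

(** With values in [bool], so that [bsgn (dotp a b)] is the value at b of the character attached to
    a. *)
Definition dotp (a b : 'rV['F_2]_t) : bool := (a *m b^T) 0 0 != 0.

Lemma F2_neq0D (x y : 'F_2) : (x + y != 0) = (x != 0) (+) (y != 0).
Proof. by case: x y => [[|[|//]] ?] [[|[|//]] ?]. Qed.

Lemma dotpDl a a' b : dotp (a + a') b = dotp a b (+) dotp a' b.
Proof. by rewrite /dotp mulmxDl mxE F2_neq0D. Qed.

Lemma dotpC a b : dotp a b = dotp b a.
Proof. by rewrite /dotp -[a *m _]trmxK trmx_mul trmxK mxE. Qed.

Lemma dotpDr a b b' : dotp a (b + b') = dotp a b (+) dotp a b'.
Proof. by rewrite dotpC dotpDl !(dotpC a). Qed.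

Lemma dotp0 a : dotp a 0 = false.
Proof. by rewrite /dotp trmx0 mulmx0 mxE eqxx. Qed.

Lemma dotp_sum (J : finType) (M : {set J}) (f : J -> 'rV['F_2]_t) a :
  bsgn (dotp a (\sum_(e in M) f e)) = \prod_(e in M) bsgn (dotp a (f e)).
Proof.
apply: (big_morph (fun b => bsgn (dotp a b))); last by rewrite dotp0.
by move=> b b'; rewrite dotpDr /bsgn signr_addb.
Qed.

(** If b has a non-zero coordinate j, translating a by the j-th unit vector negates every summand,
    so the sum equals its own negative. *)
Lemma sum_characters b :
  \sum_(a : 'rV['F_2]_t) bsgn (dotp a b) = if b == 0 then 2%:R ^+ t else 0.
Proof.
case: eqP => [->|/eqP b0].
  rewrite (eq_bigr (fun=> 1)); last by move=> a _; rewrite dotp0.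
  by rewrite sumr_const card_mx card_Fp // mul1n natrX.
have [j bj] : exists j, b 0 j != 0.
  apply/existsP; apply: contraR b0; rewrite negb_exists => /forallP h; apply/eqP/matrixP => i j.
  by rewrite ord1 mxE; apply/eqP; have := h j; rewrite negbK.
set S := \sum_a _; have : S = - S.
  rewrite {1}/S (reindex_inj (addIr (delta_mx 0 j))) -sumrN; apply: eq_bigr => a _.
  have dj : dotp (delta_mx 0 j) b = true by rewrite /dotp -rowE !mxE bj.
  by rewrite dotpDl dj /bsgn signr_addb expr1 mulrN1.
move/eqP; rewrite -subr_eq0 opprK -mulr2n -mulr_natl mulf_eq0 (negbTE two_neq0).
by move/eqP.
Qed.

End Characters.

Local Open Scope ring_scope.

(** * Pfaffians as sums over perfect matchings *)

Section MatchingSum.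
Variables (F : fieldType) (E V : finType) (x0 : V) (lo hi : E -> V).
Hypothesis lohi : forall e, lo e != hi e.

Definition at_end e x := (lo e == x) || (hi e == x).

Definition deg (M : {set E}) x := #|[set e in M | at_end e x]|.

(** Degree 0 is required outside [s], so that the condition makes sense for the shrinking lists of a
    Pfaffian expansion. *)
Definition matches (s : seq V) (M : {set E}) := [forall x, deg M x == (x \in s)].

Definition arcs (z : E -> F) u v : F :=
  \sum_(e | (lo e == u) && (hi e == v)) z e - \sum_(e | (lo e == v) && (hi e == u)) z e.

Definition joins e u v := (lo e == u) && (hi e == v) || (lo e == v) && (hi e == u).

Lemma at_end_joins e u v x : u != v -> joins e u v ->
  at_end e x = ((x == u) + (x == v))%N :> nat.
Proof.
move=> uv; have nb : ~~ ((x == u) && (x == v)).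
  by apply: contra uv => /andP[/eqP<- /eqP<-].
rewrite /at_end => /orP[] /andP[/eqP-> /eqP->]; rewrite !(eq_sym _ x);
  by case: (x == u) (x == v) nb => [] [].
Qed.

Lemma degU1 e (M : {set E}) x : e \notin M -> deg (e |: M) x = (at_end e x + deg M x)%N.
Proof.
move=> eM; rewrite /deg; case: (boolP (at_end e x)) => ex /=.
  have := cardsU1 e [set e' in M | at_end e' x]; rewrite inE (negbTE eM) /= => <-.
  by apply: eq_card => e'; rewrite !inE; case: (altP (e' =P e)) => [->|] //=.
apply: eq_card => e'; rewrite !inE; case: (altP (e' =P e)) => [->|] //=.
by rewrite (negbTE ex) andbF.
Qed.

(** Removing the edge at [v] from a perfect matching of [v :: s] mirrors one step of the expansion
    of the Pfaffian. Membership of [e] has to be tracked because [e |: M] forgets whether [e] was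
    already there. *)
Lemma matches_step v s i e (M : {set E}) : uniq (v :: s) -> (i < size s)%N -> joins e v (nth x0 s i) ->
  matches (v :: s) (e |: M) && (e \notin M) = matches (del i s) M.
Proof.
move=> /andP[vs us] hi' je; set u := nth x0 s i in je.
have us' : u \in s by rewrite mem_nth.
have uv : v != u by apply: contraNneq vs => ->.
have memE x : (x \in v :: s) = ((x == v) + (x == u) + (x \in del i s))%N :> nat.
  rewrite inE (mem_del_uniq x0) // -/u.
  case: (altP (x =P v)) => [->|_]; first by rewrite (negbTE uv) (negbTE vs).
  by case: (altP (x =P u)) => [->|_]; rewrite ?us' ?andbF ?andbT.
case: (boolP (e \in M)) => eM /=.
  rewrite andbF; apply/esym/negbTE/forallPn; exists v.
  rewrite (mem_del_uniq x0) // (negbTE vs) /=.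
  rewrite cards_eq0; apply/set0Pn; exists e; rewrite inE eM /=.
  by have := at_end_joins v uv je; rewrite eqxx (negbTE uv); case: (at_end e v).
rewrite andbT; apply: eq_forallb => x.
rewrite degU1 // (at_end_joins x uv je).
apply/eqP/eqP => [h|->]; last by rewrite memE.
by apply/eqP; rewrite -(eqn_add2l ((x == v) + (x == u))%N) h memE.
Qed.

(** The coefficients do not depend on [z], and all that is used of them is that they are non-zero on
    matchings. This spares the bookkeeping of permutation signs. *)
Lemma pf_matchings s : uniq s -> exists sg : {set E} -> F,
  (forall M, matches s M -> sg M != 0) /\
  forall z, pf x0 (arcs z) s = \sum_(M | matches s M) sg M * \prod_(e in M) z e.
Proof.
have base : exists sg : {set E} -> F, (forall M, matches [::] M -> sg M != 0) /\
    forall z, pf x0 (arcs z) [::] = \sum_(M | matches [::] M) sg M * \prod_(e in M) z e.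
  exists (fun=> 1); split=> [M _|z]; first by rewrite oner_eq0.
  rewrite (big_pred1 set0) /= ?big_set0 ?mulr1 // => M; apply/forallP/eqP => [h|-> x].
    apply/setP => e; rewrite inE; apply/negP => eM.
    by have := h (lo e); rewrite cards_eq0 => /eqP/setP/(_ e); rewrite !inE eM /at_end eqxx.
  by rewrite cards_eq0; apply/eqP/setP => e; rewrite !inE.
move: {2}(size s) (leqnn (size s)) => m; elim: m s => [|m IH] [|v s] //= hm us.
have [vs us'] := andP us.
have /fin_all_exists[sgi hsg] : forall i : 'I_(size s), exists sg : {set E} -> F,
    (forall M, matches (del i s) M -> sg M != 0) /\
    forall z, pf x0 (arcs z) (del i s) =
      \sum_(M | matches (del i s) M) sg M * \prod_(e in M) z e.
  move=> i; apply: IH; last exact: del_uniq.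
  by rewrite size_del ?ltn_ord // (leq_trans (leq_pred _)).
pose eps e : F := if lo e == v then 1 else -1.
(* On a matching of [v :: s] the double sum has one term: [e] is the only edge of [M] at [v], and
   [i] is the position of its other end. *)
pose sg (M : {set E}) : F := \sum_(i < size s) \sum_(e | joins e v (nth x0 s i) && (e \in M))
   (-1) ^+ i * eps e * sgi i (M :\ e).
have nthE i : (i < size s)%N -> v != nth x0 s i.
  by move=> hi'; apply: contraNneq vs => ->; rewrite mem_nth.
exists sg; split=> [M hM|z].
  have /forallP/(_ v) := hM; rewrite inE eqxx /= => /cards1P[e he].
  have [eM ev] : e \in M /\ at_end e v by have /setP/(_ e) := he; rewrite !inE eqxx => /andP.
  have ue e' : e' \in M -> at_end e' v -> e' = e.
    by move=> h1 h2; apply/eqP; have /setP/(_ e') := he; rewrite !inE h1 h2.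
  have [x xs jx] : exists2 x, x \in s & joins e v x.
    have /forallP h := hM.
    have inS y : at_end e y -> y \in v :: s.
      move=> ey; have := h y; case: (y \in v :: s) => //.
      by rewrite cards_eq0 => /eqP/setP/(_ e); rewrite !inE eM ey.
    case/orP: (ev) => /eqP ev'.
      exists (hi e); last by rewrite /joins ev' !eqxx.
      have := inS (hi e); rewrite /at_end eqxx orbT inE => /(_ isT) /orP[/eqP hv|//].
      by have := lohi e; rewrite ev' hv eqxx.
    exists (lo e); last by rewrite /joins ev' !eqxx orbT.
    have := inS (lo e); rewrite /at_end eqxx inE => /(_ isT) /orP[/eqP hv|//].
    by have := lohi e; rewrite ev' hv eqxx.
  have hix : (index x s < size s)%N by rewrite index_mem.
  pose i0 := Ordinal hix; have nx : nth x0 s i0 = x by rewrite nth_index.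
  have jv e' u : joins e' v u -> at_end e' v.
    by rewrite /joins /at_end => /orP[] /andP[h1 h2]; rewrite ?h1 ?h2 ?orbT.
  rewrite /sg (bigD1 i0) //= [X in _ + X]big1 => [|i ii0]; last first.
    rewrite big1 // => e' /andP[je' e'M]; case/eqP: ii0; apply/val_inj => /=.
    have ee : e' = e by apply: ue => //; apply: jv je'.
    rewrite -[val i](index_uniq x0 (ltn_ord i) us'); congr index.
    apply/eqP; have h1 := at_end_joins (nth x0 s i) (nthE i (ltn_ord i)) je'.
    have vx : v != x by rewrite -nx nthE.
    have h2 := at_end_joins (nth x0 s i) vx jx.
    move: h1; rewrite ee h2 eqxx eq_sym (negbTE (nthE i (ltn_ord i))) /=.
    by case: (_ == x).
  rewrite (big_pred1 e) => [|e'] /=; last first.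
    rewrite nth_index //; apply/andP/eqP => [[je' e'M]|->]; last by rewrite jx eM.
    by apply: ue => //; apply: jv je'.
  rewrite addr0; apply: mulf_neq0; first apply: mulf_neq0.
  - by rewrite signr_eq0.
  - by rewrite /eps; case: ifP; rewrite ?oppr_eq0 oner_eq0.
  have [-> //] := hsg i0; rewrite -(@matches_step v s i0 e) //; last by rewrite /= nth_index.
  by rewrite setD1K // hM !inE eqxx.
rewrite pf_cons big_mkord.
under [RHS]eq_bigr => M _ do rewrite /sg mulr_suml.
rewrite exchange_big /=; apply: eq_bigr => i _.
have [_ ->] := hsg i.
have -> : arcs z v (nth x0 s i) = \sum_(e | joins e v (nth x0 s i)) eps e * z e.
  rewrite /arcs [RHS](bigID (fun e => lo e == v)) /=; congr (_ + _).
    apply: eq_big => e; last by rewrite /eps => /andP[-> _]; rewrite mul1r.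
    rewrite /joins; case: (altP (lo e =P v)) => [->|_] /=; rewrite ?andbF ?andbT //.
    by rewrite (negbTE (nthE i (ltn_ord i))) orbF.
  rewrite -sumrN; apply: eq_big => e; last first.
    move=> /andP[/eqP h _]; rewrite /eps h eq_sym (negbTE (nthE i (ltn_ord i))).
    by rewrite mulN1r.
  rewrite /joins; case: (altP (lo e =P v)) => [->|_] /=; rewrite ?andbF ?andbT //.
  by rewrite (negbTE (nthE i (ltn_ord i))).
under [RHS]eq_bigr => M _ do rewrite mulr_suml.
rewrite (exchange_big_dep (fun e => joins e v (nth x0 s i))) /=; last by move=> M e _ /andP[].
rewrite -mulrA mulr_suml mulr_sumr; apply: eq_bigr => e je.
rewrite [RHS](reindex_onto (fun M => e |: M) (fun M => M :\ e)) /=; last first.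
  by move=> M /andP[_ /andP[_ eM]]; rewrite setD1K.
rewrite mulrA mulr_sumr; apply: eq_big => M.
  rewrite -(@matches_step v s i e) // je setU11 !andbT /=; congr (_ && _).
  apply/idP/eqP => [eM|<-]; first by rewrite setU1K.
  by rewrite !inE eqxx.
move=> hM; have eM : e \notin M by move: hM; rewrite -(@matches_step v s i e) // => /andP[].
by rewrite big_setU1 // setU1K //=; ring.
Qed.

End MatchingSum.

Local Close Scope ring_scope.

(** * Total correctness triples with a time bound *)

Section Triples.
Variables (W Bs : nat) (w : nat -> bool).
Implicit Types (v : nat -> nat) (a : nat -> nat -> nat).
Local Notation sem := (sem w).
Local Notation ok := (ok W Bs w).
Local Notation oke := (oke W Bs).

(* Locked, so that [done] does not try to execute programs. *)
Definition tri s T (Q : (nat -> nat) -> (nat -> nat -> nat) -> Prop) v a : Prop :=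
  locked (forall t, let c := sem s (MkSt v a t) in
    [/\ ok s (MkSt v a t), Q (sv c) (sa c) & st c <= t + T]).

Lemma triI s T Q v a : (forall t, let c := sem s (MkSt v a t) in
    [/\ ok s (MkSt v a t), Q (sv c) (sa c) & st c <= t + T]) -> tri s T Q v a.
Proof. by rewrite /tri -lock. Qed.

Lemma triW s T Q v a : tri s T Q v a -> forall t, let c := sem s (MkSt v a t) in
    [/\ ok s (MkSt v a t), Q (sv c) (sa c) & st c <= t + T].
Proof. by rewrite /tri -lock. Qed.

Lemma tri_conseq T s T' (Q Q' : _ -> _ -> Prop) v a :
  tri s T Q v a -> T <= T' -> (forall v a, Q v a -> Q' v a) -> tri s T' Q' v a.
Proof. by move/triW=> h hT hQ; apply: triI => t; have [h1 h2 h3] := h t; split; auto; lia. Qed.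

Lemma tri_le T s T' Q v a : tri s T Q v a -> T <= T' -> tri s T' Q v a.
Proof. by move=> h hT; apply: tri_conseq h hT _. Qed.

Lemma tri_nop (Q : _ -> _ -> Prop) v a : Q v a -> tri SNop 1 Q v a.
Proof. by move=> h; apply: triI => t. Qed.

Lemma tri_asn x e (Q : _ -> _ -> Prop) v a : x != 1 -> oke v a e ->
  Q (upd v x (ev v a e)) a -> tri (SAsn x e) (ecost e + 4) Q v a.
Proof. by move=> h1 h2 h3; apply: triI => t. Qed.

Lemma tri_put k e1 e2 (Q : _ -> _ -> Prop) v a : oke v a e1 -> oke v a e2 ->
  valid W Bs k (ev v a e1) -> Q v (upd2 a k (ev v a e1) (ev v a e2)) ->
  tri (SPut k e1 e2) (ecost e1 + ecost e2 + acost k + 4) Q v a.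
Proof. by move=> h1 h2 h3 h4; apply: triI => t. Qed.

Lemma tri_seq s1 s2 T1 T2 Q v a : tri s1 T1 (tri s2 T2 Q) v a ->
  tri (SSeq s1 s2) (T1 + T2 + 1) Q v a.
Proof.
move/triW=> h; apply: triI => t /=; have [h1 h2 h3] := h (t + 1).
case: (sem s1 _) h1 h2 h3 => v1 a1 t1 /= h1 h2 h3.
by have [g1 g2 g3] := triW h2 t1; split=> //; lia.
Qed.

Lemma tri_if e s1 s2 T Q v a : oke v a e ->
  (ev v a e != 0 -> tri s1 T Q v a) -> (ev v a e = 0 -> tri s2 T Q v a) ->
  tri (SIf e s1 s2) (ecost e + 2 + T) Q v a.
Proof.
move=> he h1 h2; apply: triI => t /=; case: eqP => [/h2|/eqP/h1] /triW h /=;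
  have [g1 g2 g3] := h (t + (ecost e + 2)); split=> //; lia.
Qed.

Definition framed (xs ks : seq nat) v a v' a' :=
  (forall y, y \notin xs -> v' y = v y) /\ (forall k, k \notin ks -> a' k = a k).

Lemma tri_frame s T (Q : _ -> _ -> Prop) v a : tri s T Q v a ->
  tri s T (fun v' a' => Q v' a' /\ framed (mods s) (amods s) v a v' a') v a.
Proof.
move/triW=> h; apply: triI => t; have [h1 h2 h3] := h t.
split=> //; split=> //; split=> y hy.
  by rewrite sem_frame.
by rewrite sem_aframe.
Qed.

(** The bound [Tb] may vary with the round, as the sieve requires, whose cost is a harmonic sum.
    Each round adds 7 steps of loop overhead. *)
Lemma tri_for_sum x e s (Inv : nat -> _ -> _ -> Prop) (Tb : nat -> nat)
    (Q : _ -> _ -> Prop) v a :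
  oke v a e -> x != 1 -> x \notin mods s -> Inv 0 (upd v x 0) a ->
  (forall i v' a', i < ev v a e -> v' x = i -> framed (x :: mods s) (amods s) v a v' a' ->
     Inv i v' a' -> tri s (Tb i) (fun v2 a2 => Inv i.+1 (upd v2 x i.+1) a2) v' a') ->
  (forall v' a', v' x = ev v a e -> framed (x :: mods s) (amods s) v a v' a' ->
     Inv (ev v a e) v' a' -> Q v' a') ->
  tri (SFor x e s) (ecost e + 10 + \sum_(i < ev v a e) (Tb i + 7)) Q v a.
Proof.
move=> he hx hxs h0 hS hQ; apply: triI => t /=; set n := ev v a e in hS hQ *.
set c0 := MkSt _ _ _.
have main i : i <= n -> let c := iter i (forstep (sem s) x) c0 in
   [/\ forall j, j < i -> let c' := iter j (forstep (sem s) x) c0 in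
          ok s (MkSt (sv c') (sa c') (st c' + 2)),
       Inv i (sv c) (sa c), sv c x = i, framed (x :: mods s) (amods s) v a (sv c) (sa c)
     & st c <= t + (ecost e + 9) + \sum_(j < i) (Tb j + 7)].
  elim: i => [|i IHi] hi /=.
    split=> //; first by rewrite /upd eqxx.
      by split=> // y; rewrite inE negb_or /upd => /andP[/negbTE->].
    by rewrite big_ord0 addn0.
  have [g1 g2 g3 g4 g5] := IHi (ltnW hi); move: g1 g2 g3 g4 g5.
  set c := iter i _ _ => g1 g2 g3 g4 g5.
  have [k1 k2 k3] := triW (hS i (sv c) (sa c) hi g3 g4 g2) (st c + 2).
  have e1 : sv (sem s (MkSt (sv c) (sa c) (st c + 2))) x = i by rewrite sem_frame.
  split.
  - by move=> j; rewrite ltnS leq_eqVlt => /orP[/eqP->|/g1].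
  - by rewrite e1.
  - by rewrite /upd eqxx e1.
  - case: g4 => g41 g42; split=> y hy.
      move: (hy); rewrite inE negb_or /upd => /andP[/negbTE-> hy'].
      by rewrite sem_frame ?g41.
    by rewrite sem_aframe ?g42.
  - rewrite big_ord_recr /=; move: g5 k3; clear; move: (\sum_(j < i) _) => S; lia.
have [g1 g2 g3 g4 g5] := main n (leqnn n).
split=> //; first exact: hQ.
by move: g5; clear; move: (\sum_(j < n) _) => S; rewrite /n; lia.
Qed.

Lemma tri_for N x e s (Inv : nat -> _ -> _ -> Prop) Tb (Q : _ -> _ -> Prop) v a :
  ev v a e = N -> oke v a e -> x != 1 -> x \notin mods s -> Inv 0 (upd v x 0) a ->
  (forall i v' a', i < N -> v' x = i -> framed (x :: mods s) (amods s) v a v' a' ->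
     Inv i v' a' -> tri s Tb (fun v2 a2 => Inv i.+1 (upd v2 x i.+1) a2) v' a') ->
  (forall v' a', v' x = N -> framed (x :: mods s) (amods s) v a v' a' ->
     Inv N v' a' -> Q v' a') ->
  tri (SFor x e s) (ecost e + 10 + N * (Tb + 7)) Q v a.
Proof.
move=> <- h1 h2 h3 h4 h5 h6; apply: tri_le (tri_for_sum h1 h2 h3 h4 h5 h6) _.
by rewrite sum_nat_const card_ord.
Qed.

Lemma tri_call T s (Q0 Q : _ -> _ -> Prop) v a : tri s T Q0 v a ->
  (forall v' a', Q0 v' a' -> framed (mods s) (amods s) v a v' a' -> Q v' a') ->
  tri s T Q v a.
Proof. by move=> /tri_frame h hQ; apply: tri_conseq h _ _ => // v' a' [] /hQ. Qed.

End Triples.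

(** * The program *)

Declare Scope ex_scope.
Delimit Scope ex_scope with ex.
Notation "x + y" := (B Add x%ex y%ex) : ex_scope.
Notation "x - y" := (B Defs.Sub x%ex y%ex) : ex_scope.
Notation "x * y" := (B Mul x%ex y%ex) : ex_scope.
Notation "x / y" := (B Div x%ex y%ex) : ex_scope.
Notation "x 'mod' y" := (B Mod x%ex y%ex) (at level 40, left associativity) : ex_scope.
Notation "x < y" := (B Lt x%ex y%ex) : ex_scope.
Arguments SAsn x e%_ex.
Arguments SPut k e1%_ex e2%_ex.
Arguments SFor x e%_ex s.
Arguments SIf e%_ex s1 s2.
Arguments G k e%_ex.
Notation "s1 ';;' s2" := (SSeq s1 s2) (at level 85, right associativity).
Notation "x '::=' e" := (SAsn x e%ex) (at level 80).

(** [Z] is to exceed all indices and residues. Products of two of them, short sums and addresses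
    [Bs + (16 * i + k)] then fit in a word, and so do constants up to 1000. *)
Definition Zbound W Z := (100 * Z * Z < 2 ^ W) && (100 < Z).

Lemma smallW W Z x : Zbound W Z -> x <= 1000 -> x < 2 ^ W.
Proof. by case/andP=> *; nia. Qed.

Ltac bnd := rewrite /= /upd /=; repeat split; try done; try assumption; try (eapply smallW; [eassumption|done]).
Ltac tseq := eapply tri_seq.
Ltac tasn := eapply tri_asn; [by []|bnd|].

(* Variable 0 is the answer flag, 1 the address Bs, 19 the number of coins.  Array 0
   is the input and the output, 1 the lightest edges of the slots, 2 the coins, 3 the
   random weights, 4 the matrix, 5 the characters, 6 the sieve, 7 the addition table
   of GF(2)^t, 8 the marks of exhaustive search. *)
Notation vn := 2 (only parsing).
Notation vne := 3 (only parsing).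
Notation va := 4 (only parsing).
Notation vh := 5 (only parsing).
Notation vE := 6 (only parsing).
Notation vwm := 7 (only parsing).
Notation vQ := 8 (only parsing).
Notation vq := 9 (only parsing).
Notation vlg := 10 (only parsing).
Notation vX := 11 (only parsing).
Notation vp := 12 (only parsing).
Notation vN := 13 (only parsing).
Notation vdj := 14 (only parsing).
Notation vk := 15 (only parsing).
Notation vprod := 17 (only parsing).
Notation vwm1 := 18 (only parsing).

(** Square-and-multiply with a fixed number [vlg] of rounds. It reads only the low [vlg] bits of the
    exponent, whence the remainders modulo [2 ^ lg] in the specifications. *)
Definition ppow b e :=
  23 ::= N 1;; 20 ::= b;; 21 ::= e;;
  SFor 22 (V vlg) (
    SIf (V 21 mod N 2) (23 ::= (V 23 * V 20) mod V vp) SNop;;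
    20 ::= (V 20 * V 20) mod V vp;; 21 ::= V 21 / N 2).

Lemma modn_expS k i : k %% 2 ^ i.+1 = (k %/ 2 ^ i) %% 2 * 2 ^ i + k %% 2 ^ i.
Proof.
rewrite [in LHS](divn_eq k (2 ^ i)) [in LHS](divn_eq (k %/ 2 ^ i) 2).
rewrite mulnDl -addnA -mulnA -expnS modnMDl modn_small //.
have h1 : (k %/ 2 ^ i) %% 2 < 2 by rewrite ltn_mod.
have h2 : k %% 2 ^ i < 2 ^ i by rewrite ltn_mod expn_gt0.
suff aux r s x : r < 2 -> s < x -> r * x + s < 2 * x by rewrite expnS aux.
clear; nia.
Qed.

Arguments ppow b%_ex e%_ex.

Definition prow :=
  SFor 84 (V vn) (SPut 4 (V 82 * V vn + V 84)
    ((G 4 (V 82 * V vn + V 84) + G 4 (V 83 * V vn + V 84)) mod V vp)).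

Definition pcol :=
  SFor 84 (V vn) (SPut 4 (V 84 * V vn + V 82)
    ((G 4 (V 84 * V vn + V 82) + G 4 (V 84 * V vn + V 83)) mod V vp)).

(** A zero pivot is repaired by adding a row and the matching column, which preserves the Pfaffian,
    where an exchange would change its sign. As long as the pivot is zero every later row is tried;
    adding a row with a zero in the relevant place does no harm. *)
Definition ppivot :=
  SFor 83 (V vn) (
    SIf ((V 82 < V 83) * (G 4 (V 81 * V vn + V 82) < N 1)) (prow;; pcol) SNop).

Definition pelimrow :=
  87 ::= (G 4 (V 81 * V vn + V 83) * V 86) mod V vp;;
  SFor 84 (V vn) (
    SIf (V 82 < V 84) (
      88 ::= (G 4 (V 81 * V vn + V 84) * V 86) mod V vp;;
      SPut 4 (V 83 * V vn + V 84)
        ((G 4 (V 83 * V vn + V 84)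
          + (V vp - (V 87 * G 4 (V 82 * V vn + V 84)) mod V vp)
          + (V vp - (V 88 * G 4 (V 83 * V vn + V 82)) mod V vp)) mod V vp)) SNop).

Definition pelim := SFor 83 (V vn) (SIf (V 82 < V 83) pelimrow SNop).

Definition ppfaff :=
  70 ::= N 1;;
  SFor 80 (V vh) (
    81 ::= N 2 * V 80;; 82 ::= V 81 + N 1;;
    ppivot;;
    85 ::= G 4 (V 81 * V vn + V 82);;
    70 ::= (V 70 * V 85) mod V vp;;
    ppow (V 85) (V vp - N 2);;
    86 ::= V 23;;
    pelim).

Lemma idx_lt n x y : x < n -> y < n -> x * n + y < n * n.
Proof. by move=> *; nia. Qed.

Lemma idx_eq n x y x' y' : y < n -> y' < n ->
  (x' * n + y' == x * n + y) = (x' == x) && (y' == y).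
Proof.
move=> hy hy'; apply/eqP/andP => [e|[/eqP-> /eqP->] //].
have := congr1 (fun k => k %/ n) e; have := congr1 (fun k => k %% n) e.
by rewrite !modnMDl !divnMDl ?modn_small ?divn_small ?addn0 //; lia.
Qed.

(** * Residues modulo the prime *)

Section Residues.
Variable p : nat.
Hypothesis p_pr : prime p.
Import GRing.Theory.

Definition rep (x : nat) (z : 'F_p) := x < p /\ (x%:R = z)%R.

Lemma rep_mod x : rep (x %% p) (x%:R)%R.
Proof. by split; [rewrite ltn_mod prime_gt0 | rewrite Fp_nat_mod]. Qed.

Lemma rep_add x y z t : rep x z -> rep y t -> rep ((x + y) %% p) (z + t)%R.
Proof. by case=> _ <- [_ <-]; rewrite -natrD; apply: rep_mod. Qed.

Lemma rep_mul x y z t : rep x z -> rep y t -> rep ((x * y) %% p) (z * t)%R.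
Proof. by case=> _ <- [_ <-]; rewrite -natrM; apply: rep_mod. Qed.

Lemma rep_opp x z : rep x z -> ((p - x)%:R = - z)%R.
Proof. by case=> /ltnW hx <-; rewrite natrB // pchar_Fp_0 // sub0r. Qed.

Lemma rep_sub x y z t : rep x z -> rep y t -> rep ((x + (p - y)) %% p) (z - t)%R.
Proof. by move=> [_ <-] hy; rewrite -(rep_opp hy) -natrD; apply: rep_mod. Qed.

Lemma rep_sub2 x y y' z t t' : rep x z -> rep y t -> rep y' t' ->
  rep ((x + (p - y) + (p - y')) %% p) (z - t - t')%R.
Proof. by move=> [_ <-] hy hy'; rewrite -(rep_opp hy) -(rep_opp hy') -!natrD; apply: rep_mod. Qed.

Lemma rep_pow x z k : rep x z -> rep ((x ^ k) %% p) (z ^+ k)%R.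
Proof. by case=> _ <-; rewrite -natrX; apply: rep_mod. Qed.

Lemma rep_eq0 x z : rep x z -> (x == 0) = (z == 0)%R.
Proof.
case=> hx <-; rewrite -(dvdn_pcharf (pchar_Fp p_pr)); apply/eqP/idP => [->//|].
by move/dvdnP=> [[|k] e] //; move: hx; rewrite e mulSn ltnNge leq_addr.
Qed.

Lemma rep_neg x z : rep x z -> rep ((p - x) %% p) (- z)%R.
Proof. by move=> hx; rewrite -(rep_opp hx); apply: rep_mod. Qed.

Hypothesis p_gt2 : 2 < p.

(** Also true at 0, where the inverse is 0 by convention, so the elimination needs no separate
    branch for a vanishing pivot. *)
Lemma Fp_inv (z : 'F_p) : (z ^+ (p - 2) = z^-1)%R.
Proof.
case: (eqVneq z 0%R) => [->|nz]; first by rewrite invr0 expr0n (_ : (p - 2 == 0) = false) //; lia.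
apply: (mulfI nz); rewrite divff //; apply: (mulfI nz); rewrite mulr1 -!exprS.
rewrite (_ : (p - 2).+2 = p); last lia.
by have h := expf_card z; rewrite card_Fp in h.
Qed.

Lemma two_neq0 : (2%:R : 'F_p)%R != 0%R.
Proof. by rewrite -(dvdn_pcharf (pchar_Fp p_pr)); apply/negP => /dvdn_leq; lia. Qed.

End Residues.

(** * Modular powers and Pfaffians by elimination *)

Section Programs.
Variables (W Bs : nat) (w : nat -> bool).
Implicit Types (v : nat -> nat) (a : nat -> nat -> nat).
Local Notation tri := (tri W Bs w).
Local Notation oke := (oke W Bs).

(* [Z] bounds all indices and residues. *)
Variable Z : nat.
Hypothesis Z_W : Zbound W Z.

Lemma mulW x y (hx : x < Z) (hy : y < Z) : x * y < 2 ^ W.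
Proof. by case/andP: Z_W => *; have := ltn_mul hx hy; lia. Qed.

Lemma addW x y : x < Z * 5 -> y < Z * 5 -> x + y < 2 ^ W.
Proof. by case/andP: Z_W => *; nia. Qed.

Lemma tri_pow p lg b e b0 k v a : v vp = p -> v vlg = lg ->
  1 < p < Z -> b0 < p ->
  oke (upd v 23 1) a b -> ev (upd v 23 1) a b = b0 ->
  oke (upd (upd v 23 1) 20 b0) a e -> ev (upd (upd v 23 1) 20 b0) a e = k ->
  tri (ppow b e) (70 * lg + (ecost b + ecost e + 60))
    (fun v' a' => v' 23 = (b0 ^ (k %% 2 ^ lg)) %% p) v a.
Proof.
move=> hp hlg p1 b0p ob eb oe ee.
apply: tri_le; first do [tseq; tasn; tseq; eapply tri_asn; [by []|done|];
  tseq; eapply tri_asn; [by []|by rewrite eb|]].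
- rewrite eb ee.
  pose Inv i v (_ : nat -> nat -> nat) := [/\ v 21 = k %/ 2 ^ i, v 20 = (b0 ^ (2 ^ i)) %% p
    & v 23 = (b0 ^ (k %% 2 ^ i)) %% p].
  apply: (@tri_for _ _ _ lg _ _ _ Inv) => //.
  + rewrite /Inv /upd /= modn1 !expn0 !expn1 divn1 !modn_small //; lia.
  + move=> i v' a' hi v'i [fv fa] [i1 i2 i3].
    have vp' : v' 12 = p by rewrite fv.
    have l20 : v' 20 < p by rewrite i2 ltn_mod; lia.
    have l23 : v' 23 < p by rewrite i3 ltn_mod; lia.
    have b1 : v' 23 * v' 20 < 2 ^ W by apply: mulW; lia.
    have b2 : v' 20 * v' 20 < 2 ^ W by apply: mulW; lia.
    have kE := modn_expS k i.
    tseq; eapply (@tri_call _ _ _ _ _ (fun v'' a'' => v'' 23 = (b0 ^ (k %% 2 ^ i.+1)) %% p)).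
      eapply tri_if; first by bnd.
      * rewrite /= i1 => hodd; eapply tri_le; first (tasn; rewrite /upd /= i2 i3 vp').
          by rewrite kE (_ : (k %/ 2 ^ i) %% 2 = 1) ?mul1n ?expnD ?modnMm 1?mulnC //; lia.
        by [].
      * rewrite /= i1 => hodd; eapply tri_le; first (apply: tri_nop; rewrite i3 kE hodd //).
        by [].
    move=> v1 a1 h23 [fv1 fa1].
    have e20 : v1 20 = v' 20 by rewrite fv1.
    have e21 : v1 21 = v' 21 by rewrite fv1.
    have e12 : v1 12 = p by rewrite fv1.
    rewrite -e20 in b2.
    tseq; tasn; tasn.
    rewrite /Inv /upd /= e20 e21 e12 i1 i2 h23; split=> //.
      by rewrite -divnMA expnS mulnC.
    by rewrite modnMm -expnD addnn -mul2n -expnS.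
  + by move=> v' a' h22 _ [_ _ ->].
- rewrite /=; lia.
Qed.

Hypothesis Bs_lt : Bs < Z.

Lemma validZ k i : 0 < k < 16 -> i < Z -> valid W Bs k i.
Proof.
move=> hk hi; have /andP[h1 h2] := Z_W.
by rewrite /valid /addr; case: eqP => [|_]; first lia; apply/andP; split; nia.
Qed.

Section Field.
Variable p : nat.
Hypothesis p_pr : prime p.
Hypothesis p_gt2 : 2 < p.
Hypothesis p_lt : p < Z.

Import GRing.Theory.

Section Pfaffian.
Variables (n h lg : nat).
Hypothesis nn_lt : n * n < Z.
Hypothesis n_lt : n < Z.

Definition mxr (a : nat -> nat -> nat) (M : nat -> nat -> 'F_p) :=
  forall x y, x < n -> y < n -> rep (a 4 (x * n + y)) (M x y).

Lemma mxr_ext a a' M M' : mxr a M -> a' 4 = a 4 ->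
  (forall x y, x < n -> y < n -> M x y = M' x y) -> mxr a' M'.
Proof. by move=> h1 h2 h3 x y hx hy; rewrite -h3 // h2; apply: h1. Qed.

Lemma mxr_put a M x y c z : mxr a M -> y < n -> rep c z ->
  mxr (upd2 a 4 (x * n + y) c) (fun x' y' => if (x' == x) && (y' == y) then z else M x' y').
Proof.
move=> hM hy hc x' y' hx' hy'; rewrite /upd2 /= /upd idx_eq //.
by case: ifP => // _; apply: hM.
Qed.

Ltac slv := repeat split; try done; try (eapply smallW; [eassumption|done]);
  try (apply: validZ; [done|lia]); try (apply: mulW; lia); try (apply: addW; lia).

Lemma tri_row u g M v a : v vn = n -> v vp = p -> v 82 = u -> v 83 = g ->
  u < n -> g < n -> u != g -> mxr a M ->
  tri prow (20 + n * 110) (fun _ a' =>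
    mxr a' (fun x y => if x == u then (M u y + M g y)%R else M x y)) v a.
Proof.
move=> h2 h12 h82 h83 hu hg ug hM.
apply: tri_le; first apply: (@tri_for _ _ _ n _ _ _ (fun i _ a' =>
  mxr a' (fun x y => if (x == u) && (y < i) then (M u y + M g y)%R else M x y))) => //.
- by apply: mxr_ext hM _ _ => // x y _ _; rewrite ltn0 andbF.
- move=> i v' a' hi v'i [fv fa] hM'.
  have e2 : v' 2 = n by rewrite fv.
  have e12 : v' 12 = p by rewrite fv.
  have e82 : v' 82 = u by rewrite fv.
  have e83 : v' 83 = g by rewrite fv.
  have i1 := idx_lt hu hi; have i2 := idx_lt hg hi.
  have r1 := hM' u i hu hi; have r2 := hM' g i hg hi.
  rewrite eqxx ltnn /= in r1; rewrite eq_sym (negbTE ug) /= in r2.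
  have [b1 _] := r1; have [b2 _] := r2.
  apply: tri_put; rewrite /= ?e2 ?e12 ?e82 ?e83 ?v'i; try by slv.
  apply: mxr_ext (mxr_put u hM' hi (rep_add p_pr r1 r2)) _ _ => // x y hx hy.
  rewrite [in RHS]ltnS [in RHS]leq_eqVlt; case: (altP (x =P u)) => [->|_] //=.
  by case: (altP (y =P i)) => [->|].
- move=> v' a' _ _ hM'; apply: mxr_ext hM' _ _ => // x y hx hy.
  by rewrite hy andbT.
- by rewrite /= /acost /=; lia.
Qed.

Lemma tri_col u g M v a : v vn = n -> v vp = p -> v 82 = u -> v 83 = g ->
  u < n -> g < n -> u != g -> mxr a M ->
  tri pcol (20 + n * 110) (fun _ a' =>
    mxr a' (fun x y => if y == u then (M x u + M x g)%R else M x y)) v a.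
Proof.
move=> h2 h12 h82 h83 hu hg ug hM.
apply: tri_le; first apply: (@tri_for _ _ _ n _ _ _ (fun i _ a' =>
  mxr a' (fun x y => if (y == u) && (x < i) then (M x u + M x g)%R else M x y))) => //.
- by apply: mxr_ext hM _ _ => // x y _ _; rewrite ltn0 andbF.
- move=> i v' a' hi v'i [fv fa] hM'.
  have e2 : v' 2 = n by rewrite fv.
  have e12 : v' 12 = p by rewrite fv.
  have e82 : v' 82 = u by rewrite fv.
  have e83 : v' 83 = g by rewrite fv.
  have i1 := idx_lt hi hu; have i2 := idx_lt hi hg.
  have r1 := hM' i u hi hu; have r2 := hM' i g hi hg.
  rewrite eqxx ltnn /= in r1; rewrite eq_sym (negbTE ug) /= in r2.
  have [b1 _] := r1; have [b2 _] := r2.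
  apply: tri_put; rewrite /= ?e2 ?e12 ?e82 ?e83 ?v'i; try by slv.
  apply: mxr_ext (mxr_put i hM' hu (rep_add p_pr r1 r2)) _ _ => // x y hx hy.
  rewrite [in RHS]ltnS [in RHS]leq_eqVlt andbC; case: (altP (y =P u)) => [->|_] //=.
  by case: (altP (x =P i)) => [->|].
- move=> v' a' _ _ hM'; apply: mxr_ext hM' _ _ => // x y hx hy.
  by rewrite hx andbT.
- by rewrite /= /acost /=; lia.
Qed.

Definition skewf (M : nat -> nat -> 'F_p) := forall x y, M x y = (- M y x)%R.

(** The last clause is what a failed search for a pivot leaves behind: row [u] is zero to the right
    of the diagonal, so the Pfaffian vanishes by [pf_head0]. *)
Lemma tri_pivot u M v a : v vn = n -> v vp = p -> v 81 = u -> v 82 = u.+1 ->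
  u.+1 < n -> skewf M -> mxr a M ->
  tri ppivot (20 + n * (200 + n * 220)) (fun _ a' => exists M', [/\ skewf M', mxr a' M',
    pf 0 M' (iota u (n - u)) = pf 0 M (iota u (n - u)) &
    M' u u.+1 = 0%R -> forall j, u.+1 < j < n -> M' u j = 0%R]) v a.
Proof.
move=> h2 h12 h81 h82 hu sk hM.
apply: tri_le; first apply: (@tri_for _ _ _ n _ _ _ (fun i _ a' => exists M', [/\ skewf M', mxr a' M',
    pf 0 M' (iota u (n - u)) = pf 0 M (iota u (n - u)) &
    M' u u.+1 = 0%R -> forall j, u.+1 < j < i -> M' u j = 0%R])) => //.
- by exists M; split=> // _ j; rewrite ltn0 andbF.
- move=> i v1 a1 hi v1i [fv fa] [M1 [sk1 hM1 pf1 z1]].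
  have e2 : v1 2 = n by rewrite fv.
  have e12 : v1 12 = p by rewrite fv.
  have e81 : v1 81 = u by rewrite fv.
  have e82 : v1 82 = u.+1 by rewrite fv.
  have i1 := idx_lt (ltnW hu) hu; have r1 := hM1 u u.+1 (ltnW hu) hu.
  have [b1 _] := r1.
  apply: tri_if; rewrite /= ?e2 ?e12 ?e81 ?e82 ?v1i; first by slv.
    rewrite muln_eq0 negb_or !eqb0 !negbK => /andP[hui]; rewrite ltnS leqn0 (rep_eq0 p_pr r1) => /eqP m0.
    have ne : u.+1 != i by lia.
    apply: tri_seq; apply: tri_call (tri_row e2 e12 e82 v1i hu hi ne hM1) _ => v2 a2 hM2 [fv2 fa2].
    have {}e2 : v2 2 = n by rewrite fv2.
    have {}e12 : v2 12 = p by rewrite fv2.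
    have {}e82 : v2 82 = u.+1 by rewrite fv2.
    have e83 : v2 83 = i by rewrite fv2.
    apply: tri_call (tri_col e2 e12 e82 e83 hu hi ne hM2) _ => v3 a3 hM3 _.
    pose f c : 'F_p := (if c == u.+1 then 1 else 0)%R.
    exists (fun c d => (M1 c d + f c * M1 i d + f d * M1 c i)%R); split.
    - by move=> c d; rewrite (sk1 d c) (sk1 i c) (sk1 d i); ring.
    - apply: mxr_ext hM3 _ _ => // c d hc hd; rewrite /f.
      (* Adding the row and then the column contributes [M1 i i] to the diagonal entry, a term that
         [pf_rowop] does not have; it is zero by skewness. *)
      have mii : M1 i i = 0%R by apply: skew_diag sk1 (two_neq0 p_pr p_gt2) i.
      case: (altP (d =P u.+1)) => [->|_]; case: (altP (c =P u.+1)) => [->|_];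
        rewrite ?mii; ring.
    - rewrite -pf1; apply: (pf_rowop sk1 (two_neq0 p_pr p_gt2)); first by rewrite mem_iota; lia.
      by rewrite /f eq_sym (negbTE ne).
    - rewrite m0 /f eqxx (_ : (u == u.+1) = false); last lia.
      rewrite !mul0r !add0r mul1r => mi j /andP[hj1 hj2].
      rewrite (_ : (j == u.+1) = false) ?mul0r ?addr0; last lia.
      move: hj2; rewrite ltnS leq_eqVlt => /orP[/eqP->//|hj2].
      by apply: z1; rewrite ?hj1.
  rewrite -[LHS]/(_ * _) => /eqP; rewrite muln_eq0 !eqb0 => hc.
  apply: tri_le; first apply: tri_nop.
    exists M1; split=> // m0 j /andP[hj1 hj2]; apply: z1 => //; rewrite hj1 /=.
    move: hj2; rewrite ltnS leq_eqVlt => /orP[/eqP ej|//].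
    by case/orP: hc; [rewrite -ej hj1 | rewrite ltnS leqn0 (rep_eq0 p_pr r1) m0 eqxx].
  lia.
- by rewrite /= /acost /=; lia.
Qed.

Lemma tri_elimrow u x0 (M : nat -> nat -> 'F_p) v a : v vn = n -> v vp = p -> v 81 = u -> v 82 = u.+1 ->
  v 83 = x0 -> rep (v 86) (M u u.+1)^-1%R ->
  u.+1 < n -> x0 < n -> u.+1 < x0 -> mxr a M ->
  tri pelimrow (60 + n * 250) (fun _ a' =>
    mxr a' (fun x y => if (x == x0) && (u.+1 < y) then elim_mx M u u.+1 x0 y else M x y)) v a.
Proof.
move=> h2 h12 h81 h82 h83 h86 hu hx ux hM.
have hu' := ltnW hu; have [b86 _] := h86.
have i1 := idx_lt hu' hx; have r1 := hM _ _ hu' hx; have [b1 _] := r1.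
apply: tri_le; first apply: tri_seq; first apply: tri_asn => //.
- by rewrite /= h2 h81 h83; slv.
- rewrite /= h2 h12 h81 h83; have r87 := rep_mul p_pr r1 h86.
  move: (_ %% p) r87 => c87 r87; have [b87 _] := r87.
  apply: (@tri_for _ _ _ n _ _ _ (fun i _ a' => mxr a' (fun x y =>
     if [&& x == x0, u.+1 < y & y < i] then elim_mx M u u.+1 x0 y else M x y))) => //.
  + by apply: mxr_ext hM _ _ => // x y _ _; rewrite !andbF.
  + move=> i v1 a1 hi v1i [fv fa] hM1.
    have e2 : v1 2 = n by rewrite fv.
    have e12 : v1 12 = p by rewrite fv.
    have e81 : v1 81 = u by rewrite fv.
    have e82 : v1 82 = u.+1 by rewrite fv.
    have e83 : v1 83 = x0 by rewrite fv.
    have e86 : v1 86 = v 86 by rewrite fv.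
    have e87 : v1 87 = c87 by rewrite fv.
    apply: tri_if; rewrite /= ?e2 ?e12 ?e81 ?e82 ?v1i; first by slv.
      rewrite eqb0 negbK => hui.
      have q1 : rep (a1 4 (u * n + i)) (M u i).
        by have := hM1 u i hu' hi; rewrite (_ : (u == x0) = false) //; lia.
      have q2 : rep (a1 4 (u.+1 * n + i)) (M u.+1 i).
        by have := hM1 u.+1 i hu hi; rewrite (_ : (u.+1 == x0) = false) //; lia.
      have q3 : rep (a1 4 (x0 * n + i)) (M x0 i).
        by have := hM1 x0 i hx hi; rewrite ltnn !andbF.
      have q4 : rep (a1 4 (x0 * n + u.+1)) (M x0 u.+1).
        by have := hM1 x0 u.+1 hx hu; rewrite ltnn !andbF.
      have j1 := idx_lt hu' hi; have j2 := idx_lt hu hi; have j3 := idx_lt hx hi.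
      have j4 := idx_lt hx hu.
      have [c1 _] := q1; have [c2 _] := q2; have [c3 _] := q3; have [c4 _] := q4.
      apply: tri_seq; apply: tri_asn => //.
        by rewrite /= ?e2 ?e12 ?e81 ?e86 ?v1i; slv.
      rewrite /= e2 e12 e81 e86 v1i; have r88 := rep_mul p_pr q1 h86.
      move: (_ %% p) r88 => c88 r88; have [b88 _] := r88.
      have m1 : (c87 * a1 4 (u.+1 * n + i)) %% p < p by rewrite ltn_mod; lia.
      have m2 : (c88 * a1 4 (x0 * n + u.+1)) %% p < p by rewrite ltn_mod; lia.
      apply: tri_put; rewrite /= /upd /= ?e2 ?e12 ?e82 ?e83 ?e87 ?v1i; [by slv| |by slv|].
        move: (_ %% p) m1 (_ %% p) m2 => k1 lk1 k2 lk2.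
        by clear -Z_W Bs_lt p_lt nn_lt n_lt hx hi hu j2 j3 j4 c2 c3 c4 b87 b88 lk1 lk2; slv.
      have := mxr_put x0 hM1 hi (rep_sub2 p_pr q3 (rep_mul p_pr r87 q2) (rep_mul p_pr r88 q4)).
      move/mxr_ext; apply=> // x y hx' hy'; rewrite (_ : (y < i.+1) = (y == i) || (y < i)); last by rewrite ltnS leq_eqVlt.
      case: (altP (x =P x0)) => [->|_] //=; case: (altP (y =P i)) => [->|_] //=.
      by rewrite hui /elim_mx.
    move/eqP; rewrite eqb0 => hui; apply: tri_le; first apply: tri_nop.
      apply: mxr_ext hM1 _ _ => // x y _ _; rewrite (_ : (y < i.+1) = (y == i) || (y < i)); last by rewrite ltnS leq_eqVlt.
      by case: (altP (y =P i)) => [->|_] //=; rewrite (negbTE hui) !andbF.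
    done.
  + move=> v1 a1 _ _ hM1; apply: mxr_ext hM1 _ _ => // x y _ hy.
    by rewrite hy andbT.
- by rewrite /= /acost /=; lia.
Qed.

(** The matrix can be updated in place: only entries with both indices beyond [u.+1] change, and
    besides the entry itself the formula reads entries in which [u] or [u.+1] is an index. *)
Lemma tri_elim u (M : nat -> nat -> 'F_p) v a : v vn = n -> v vp = p -> v 81 = u -> v 82 = u.+1 ->
  rep (v 86) (M u u.+1)^-1%R -> u.+1 < n -> mxr a M ->
  tri pelim (20 + n * (150 + n * 250)) (fun _ a' =>
    mxr a' (fun x y => if (u.+1 < x) && (u.+1 < y) then elim_mx M u u.+1 x y else M x y)) v a.
Proof.
move=> h2 h12 h81 h82 h86 hu hM.
apply: tri_le; first apply: (@tri_for _ _ _ n _ _ _ (fun i _ a' => mxr a' (fun x y =>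
   if [&& x < i, u.+1 < x & u.+1 < y] then elim_mx M u u.+1 x y else M x y))) => //.
- move=> i v1 a1 hi v1i [fv fa] hM1.
  have e2 : v1 2 = n by rewrite fv.
  have e12 : v1 12 = p by rewrite fv.
  have e81 : v1 81 = u by rewrite fv.
  have e82 : v1 82 = u.+1 by rewrite fv.
  have e86 : v1 86 = v 86 by rewrite fv.
  rewrite -e86 in h86.
  apply: tri_if; rewrite /= ?e82 ?v1i; first by slv.
    rewrite eqb0 negbK => hui.
    have h86' : rep (v1 86) ((if [&& u < i, u.+1 < u & u.+1 < u.+1]%N
       then elim_mx M u u.+1 u u.+1 else M u u.+1)^-1)%R by rewrite ltnn !andbF.
    apply: tri_call (tri_elimrow e2 e12 e81 e82 v1i h86' hu hi hui hM1) _ => v2 a2 hM2 _.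
    apply: mxr_ext hM2 _ _ => // x y hx hy; rewrite [in RHS]ltnS [in RHS]leq_eqVlt.
    case: (altP (x =P i)) => [->|_] //=; rewrite hui ltnn /=.
    case: (u.+1 < y) => //=.
    by rewrite /elim_mx !ltnn (_ : (u.+1 < u) = false) ?andbF //; lia.
  move/eqP; rewrite eqb0 => hui; apply: tri_le; first apply: tri_nop.
    apply: mxr_ext hM1 _ _ => // x y _ _; rewrite [in RHS]ltnS [in RHS]leq_eqVlt.
    by case: (altP (x =P i)) => [->|_] //=; rewrite (negbTE hui) !andbF.
  lia.
- move=> v1 a1 _ _ hM1; apply: mxr_ext hM1 _ _ => // x y hx _.
  by rewrite hx.
- by rewrite /= /acost /=; lia.
Qed.

Lemma skew_elim M u c : skewf M -> skewf (elim_mx M u c).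
Proof. by move=> sk x y; rewrite /elim_mx (sk y x) (sk c x) (sk c y); ring. Qed.

Hypothesis n2h : n = 2 * h.
Hypothesis lg_gt : p - 2 < 2 ^ lg.

Lemma tri_pfaff M0 v a : v vn = n -> v vh = h -> v vlg = lg -> v vp = p ->
  skewf M0 -> mxr a M0 ->
  tri ppfaff (30 + h * (500 + 70 * lg + n * (350 + n * 470)))
    (fun v' _ => rep (v' 70) (pf 0 M0 (iota 0 n))) v a.
Proof.
move=> h2 h5 h10 h12 sk0 hM0.
eapply tri_le; [eapply tri_seq; eapply tri_asn; [by []| |]|].
- by rewrite /=; slv.
- apply: (@tri_for _ _ _ h _ _ _ (fun l v' a' => exists M r, [/\ skewf M, mxr a' M, rep (v' 70) r
     & (r * pf 0 M (iota (2 * l) (n - 2 * l)) = pf 0 M0 (iota 0 n))%R]));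
    [by []|by []|by []|by []| | |].
  + exists M0, 1%R; split=> //; last by rewrite muln0 subn0 mul1r.
    by split; rewrite /upd //=; lia.
  + move=> l v1 a1 hl v1i [fv fa] [M [r [sk hM hr hpf]]].
    have e2 : v1 2 = n by rewrite fv.
    have e12 : v1 12 = p by rewrite fv.
    have e10 : v1 10 = lg by rewrite fv.
    have hu : (2 * l).+1 < n by lia.
    apply: tri_seq; (apply: tri_asn; [by []| |]).
      by rewrite /= v1i; slv.
    apply: tri_seq; (apply: tri_asn; [by []| |]).
      by rewrite /= /upd /= v1i; slv.
    rewrite [ev _ _ _]/= [ev _ _ _]/= /upd /= v1i addn1; set v2 := (fun y : nat => _).
    apply: tri_seq; apply: tri_call (@tri_pivot (2 * l) M v2 a1 e2 e12 _ _ hu sk hM) _ => //.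
    move=> v3 a3 [M1 [sk1 hM1 pf1 z1]] [fv3 fa3].
    have e2' : v3 2 = n by rewrite fv3.
    have e12' : v3 12 = p by rewrite fv3.
    have e10' : v3 10 = lg by rewrite fv3.
    have e81 : v3 81 = 2 * l by rewrite fv3.
    have e82 : v3 82 = (2 * l).+1 by rewrite fv3.
    have e70 : v3 70 = v1 70 by rewrite fv3.
    have [b70 _] := hr; have hu' := ltnW hu.
    have i1 := idx_lt hu' hu; have r1 := hM1 _ _ hu' hu; have [b1 _] := r1.
    apply: tri_seq; (apply: tri_asn; [by []| |]); first by rewrite /= e2' e81 e82; slv.
    rewrite [ev _ _ _]/= e2' e81 e82.
    move: (a3 4 _) r1 b1 => c85 r1 b1.
    apply: tri_seq; (apply: tri_asn; [by []| |]); first by rewrite /= /upd /= e70; slv.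
    rewrite [ev _ _ _]/= /upd /= e70 e12'; set v4 := (fun y : nat => _).
    apply: tri_seq; apply: tri_call (@tri_pow p lg (V 85) (V vp - N 2)%ex c85 (p - 2) v4 a3 e12' e10' _ b1 _ _ _ _) _ => //=.
    * lia.
    * by slv.
    * by rewrite /v4 /= /upd /= e12'.
    move=> v5 a5 h23 [fv5 fa5].
    have r23 : rep (v5 23) (M1 (2 * l) (2 * l).+1)^-1%R.
      have <- := Fp_inv p_pr p_gt2 (M1 (2 * l) (2 * l).+1).
      by rewrite h23 (modn_small lg_gt); apply: rep_pow.
    apply: tri_seq; (apply: tri_asn; [by []|by []|]); set v6 := upd _ _ _.
    have f6 x : x \notin [:: 20; 21; 22; 23; 86] -> v6 x = v4 x.
      move=> hx; rewrite /v6 /upd ifF ?fv5 //=; move: hx; rewrite !inE; lia.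
    have hM5 : mxr a5 M1 by rewrite /mxr fa5.
    apply: tri_call (@tri_elim (2 * l) M1 v6 a5 _ _ _ _ r23 hu hM5) _;
      rewrite ?f6 //; rewrite ?/v4 //=.
    move=> v7 a7 hM7 [fv7 _].
    exists (fun x y => if ((2 * l).+1 < x) && ((2 * l).+1 < y)
      then elim_mx M1 (2 * l) (2 * l).+1 x y else M1 x y), (r * M1 (2 * l) (2 * l).+1)%R; split.
    * by move=> x y; rewrite andbC; case: ifP => _; [apply: skew_elim|].
    * by apply: mxr_ext hM7 _ _.
    * by rewrite /upd /= fv7 // f6 // /v4 /=; apply: rep_mul.
    * rewrite -hpf -pf1 -mulrA; congr (_ * _)%R.
      have e1 : iota (2 * l) (n - 2 * l) =
          [:: 2 * l, (2 * l).+1 & iota (2 * l.+1) (n - 2 * l.+1)].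
        by rewrite (_ : n - 2 * l = (n - 2 * l.+1).+2) /= ?mulnS //; lia.
      have hpfE : pf 0 (fun x y => if ((2 * l).+1 < x) && ((2 * l).+1 < y)
          then elim_mx M1 (2 * l) (2 * l).+1 x y else M1 x y) (iota (2 * l.+1) (n - 2 * l.+1)) =
          pf 0 (elim_mx M1 (2 * l) (2 * l).+1) (iota (2 * l.+1) (n - 2 * l.+1)).
        apply: pf_eq => x y; rewrite !mem_iota => hx hy.
        by rewrite ifT //; lia.
      rewrite hpfE e1; have ui : uniq [:: 2 * l, (2 * l).+1 & iota (2 * l.+1) (n - 2 * l.+1)].
        by rewrite -e1 iota_uniq.
      (* For a zero pivot both sides are 0. The accumulated product is then 0 for good, so the
         invariant remains true whatever the later rounds compute. *)
      case: (eqVneq (M1 (2 * l) (2 * l).+1) 0%R) => [m0|nz].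
        rewrite m0 mul0r pf_head0 // => x; rewrite inE => /orP[/eqP->//|].
        by rewrite mem_iota => hx; apply: z1; rewrite // ; lia.
      by rewrite (pf_elim sk1 (two_neq0 p_pr p_gt2) ui nz).
  + move=> v1 a1 _ _ [M [r [_ _ hr]]]; rewrite -n2h subnn /= => <-.
    by rewrite mulr1.
- rewrite /= /acost /=; lia.
Qed.
End Pfaffian.
End Field.
End Programs.

(** * The algebraic test *)

Lemma ltZW W Z x : Zbound W Z -> x < Z -> x < 2 ^ W.
Proof. by case/andP=> *; nia. Qed.

Ltac slv := repeat split; try done; try (eapply smallW; [eassumption|done]);
  try (eapply ltZW; [eassumption|lia]);
  try (eapply validZ; [eassumption|eassumption|done|lia]);
  try (eapply mulW; [eassumption|lia|lia]); try (eapply addW; [eassumption|lia|lia]).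

Ltac asn := eapply tri_asn; [by []| |].

Section Test.
Variables (W Bs : nat) (w : nat -> bool) (Z : nat).
Hypothesis Z_W : Zbound W Z.
Hypothesis Bs_lt : Bs < Z.
Local Notation tri := (tri W Bs w).
Variables (p n h lg T2 dj Np al : nat).
Hypothesis p_pr : prime p.
Hypothesis p_gt2 : 2 < p.
Hypothesis p_lt : p < Z.
Hypothesis n_gt0 : 0 < n.
Hypothesis nnT_lt : n * n * T2 < Z.
Hypothesis n2h : n = 2 * h.
Hypothesis lg_gt : p < 2 ^ lg.
Hypothesis TT_lt : T2 * T2 < Z.
Hypothesis T2_gt0 : 0 < T2.
Hypothesis dj_gt0 : 0 < dj.
Hypothesis Np_lt : Np < p.
Hypothesis al_lt : al < T2.

Variables (a0 g X : nat -> nat) (chi : nat -> nat -> bool).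
Hypothesis g_ok : forall d, d < n * n * T2 -> g d != 0 -> 4 * g d + 1 < Bs /\ a0 (4 * g d + 1) < 2 ^ lg.
Hypothesis X_lt : forall d, d < n * n * T2 -> X d < p.

Lemma T2_lt : T2 < Z.
Proof. by apply: leq_ltn_trans TT_lt; rewrite leq_pmulr. Qed.

Lemma nn_lt : n * n < Z.
Proof. by apply: leq_ltn_trans nnT_lt; rewrite leq_pmulr. Qed.

Lemma n_lt : n < Z.
Proof. by apply: leq_ltn_trans nn_lt; rewrite leq_pmulr. Qed.

Definition slot u v c := (u * n + v) * T2 + c.

Lemma slot_lt u v c : u < n -> v < n -> c < T2 -> slot u v c < n * n * T2.
Proof.
move=> hu hv hc; apply: (@leq_trans ((u * n + v).+1 * T2)); first by rewrite /slot mulSn; lia.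
by rewrite leq_mul2r idx_lt ?orbT.
Qed.

(** [g d] is 0 for an empty slot and otherwise one more than the index of an edge, whose weight lies
    in the input at [4 * g d + 1]. The divisor [dj] is the scale of the current level. *)
Definition sterm y c d ga : 'F_p :=
  (if g d == 0%N then 0 else (-1) ^+ chi c ga * ((X d)%:R * y%:R ^+ (a0 (4 * g d + 1) %/ dj)))%R.

Definition tval y c u v : 'F_p := (\sum_(ga < T2) sterm y c (slot u v ga) ga)%R.

Definition amx y c u v : 'F_p :=
  (if (u < v)%N then tval y c u v else if (v < u)%N then - tval y c v u else 0)%R.

Lemma amx_skew y c : skewf (amx y c).
Proof. by move=> u v; rewrite /amx; case: ltngtP => _; rewrite ?opprK ?oppr0. Qed.

Definition arrs (a : nat -> nat -> nat) :=
  [/\ a 0 = a0, a 1 =1 g, forall d, d < n * n * T2 -> a 3 d = X d & forall c ga, c < T2 -> ga < T2 -> a 5 (c * T2 + ga) = chi c ga].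

Definition vars (v : nat -> nat) :=
  [/\ v vn = n, v vh = h, v vlg = lg, v vp = p & v vdj = dj].

Lemma arrs_frame ks v v' a a' xs : framed xs ks v a v' a' ->
  [&& 0 \notin ks, 1 \notin ks, 3 \notin ks & 5 \notin ks] -> arrs a -> arrs a'.
Proof.
move=> [_ hf]; case/and4P=> h0 h1 h3 h5 [e0 e1 e3 e5].
by split; rewrite ?hf //; move=> *; rewrite hf ?e5 ?e3.
Qed.

Lemma vars_frame ks v v' a a' xs : framed xs ks v a v' a' ->
  [&& vn \notin xs, vh \notin xs, vlg \notin xs, vp \notin xs & vdj \notin xs] -> vars v -> vars v'.
Proof.
move=> [hf _]; case/and5P=> h0 h1 h3 h5 h6 [e0 e1 e3 e5 e6].
by split; rewrite hf.
Qed.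

Definition psum :=
  75 ::= (V 71 * V vn + V 72) * N T2 + V 74;; 76 ::= G 1 (V 75);;
  SIf (V 76) (
    ppow (V 63) (G 0 (N 4 * V 76 + N 1) / V vdj);;
    77 ::= (G 3 (V 75) * V 23) mod V vp;;
    SIf (G 5 (V 68 * N T2 + V 74)) (73 ::= (V 73 + (V vp - V 77)) mod V vp)
      (73 ::= (V 73 + V 77) mod V vp)) SNop.

Definition pentry :=
  73 ::= N 0;; SFor 74 (N T2) psum;;
  SPut 4 (V 71 * V vn + V 72) (V 73);;
  SPut 4 (V 72 * V vn + V 71) ((V vp - V 73) mod V vp).

Definition pbuild :=
  SFor 71 (V vn) (SFor 72 (V vn) (
    SIf (V 71 < V 72) pentry
      (SIf (V 72 < V 71) SNop (SPut 4 (V 71 * V vn + V 72) (N 0))))).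

Lemma tri_sum u x ga y c z v a : vars v -> arrs a -> v 71 = u -> v 72 = x -> v 74 = ga ->
  v 63 = y -> v 68 = c -> u < n -> x < n -> ga < T2 -> c < T2 -> y < p -> rep (v 73) z ->
  tri psum (400 + 70 * lg) (fun v' _ => rep (v' 73) (z + sterm y c (slot u x ga) ga)%R) v a.
Proof.
move=> [h2 h5 h10 h12 h14] [r0 r1 r3 r5] h71 h72 h74 h63 h68 hu hx hga hc hy hz.
have i1 := idx_lt hu hx; have i2 := slot_lt hu hx hga; have := nnT_lt; have := nn_lt.
have i3 : c * T2 + ga < T2 * T2 by apply: idx_lt.
have T2_lt := T2_lt; have n_lt := n_lt.
have hprod : (u * n + x) * T2 < Z by apply: leq_ltn_trans nnT_lt; rewrite leq_mul2r ltnW ?orbT.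
move=> hnn hnnT; have := TT_lt; have [b73 _] := hz.
move=> hTT; rewrite /slot in i2; set d := _ + ga in i2.
eapply tri_le.
  eapply tri_seq; asn.
    by rewrite /= h2 h71 h72 h74; slv.
  rewrite [ev _ _ _]/= h2 h71 h72 h74 -/d.
  eapply tri_seq; asn; first by rewrite /= /upd /=; slv.
  have e1 : ev (upd v 75 d) a (G 1 (V 75)) = g d by rewrite /= /upd /= r1.
  rewrite e1; set v1 := upd (upd v 75 d) 76 (g d).
  have rX := rep_mod p_pr (X d); rewrite (modn_small (X_lt i2)) in rX.
  eapply tri_if; first by [].
  move=> gd; have [g1 g2] := g_ok i2 gd.
  have g3 : a0 (4 * g d + 1) %/ dj < 2 ^ lg by apply: leq_ltn_trans (leq_div _ _) g2.
  have gZ : g d < Z by lia.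
  eapply tri_seq; eapply tri_call.
    eapply (tri_pow w Z_W (p := p) (lg := lg) (b0 := y) (k := a0 (4 * g d + 1) %/ dj)).
    - by [].
    - by [].
    - lia.
    - by [].
    - by [].
    - by [].
    - by rewrite /= /upd /v1 /upd /=; slv.
    - by rewrite /= /upd /v1 /upd /= h14 r0.
  move=> v2 a2; rewrite (modn_small g3) => h23 [fv2 fa2].
  have ry := rep_mod p_pr y; rewrite (modn_small hy) in ry.
  have r23 := rep_pow p_pr (a0 (4 * g d + 1) %/ dj) ry; rewrite -h23 in r23.
  have r77 := rep_mul p_pr rX r23; have [b23 _] := r23; have := X_lt i2 => bX.
  have e75 : v2 75 = d by rewrite fv2.
  have e12 : v2 12 = p by rewrite fv2.
  have e68 : v2 68 = c by rewrite fv2.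
  have e74 : v2 74 = ga by rewrite fv2.
  have e73 : v2 73 = v 73 by rewrite fv2.
  eapply tri_seq; asn.
    by rewrite /= e75 fa2 // r3; slv.
  rewrite [ev _ _ _]/= e75 e12 fa2 // r3 //.
  move: (_ %% p) r77 => c77 r77; have [b77 _] := r77.
  eapply tri_if.
  - by rewrite /= /upd /= e68 e74; slv.
  - rewrite /= /upd /= e68 e74 fa2 // r5 // eqb0 negbK => hchi.
    asn; first by rewrite /= /upd /= e73 e12; slv.
    rewrite /upd /= e73 e12 /sterm /slot -/d (negbTE gd) hchi expr1 mulN1r.
    exact: rep_sub.
  - rewrite /= /upd /= e68 e74 fa2 // r5 // => /eqP; rewrite eqb0 => hchi.
    eapply tri_le; first asn; first by rewrite /= /upd /= e73; slv.
      rewrite /upd /= e73 e12 /sterm /slot -/d (negbTE gd) (negbTE hchi) expr0 mul1r.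
      exact: rep_add.
    by [].
  move=> gd; eapply tri_le; first apply: tri_nop.
    rewrite [v1 _]/= /sterm (_ : slot u x ga = d) // (_ : g d = 0) // eqxx addr0; exact: hz.
  by rewrite /=; lia.
by rewrite /= /acost /=; lia.
Qed.

Lemma tri_entry u x y c v a : vars v -> arrs a -> v 71 = u -> v 72 = x ->
  v 63 = y -> v 68 = c -> u < x -> x < n -> c < T2 -> y < p ->
  tri pentry (150 + T2 * (410 + 70 * lg)) (fun _ a' =>
    exists k k', [/\ rep k (amx y c u x), rep k' (amx y c x u) &
     a' 4 = upd (upd (a 4) (u * n + x) k) (x * n + u) k']) v a.
Proof.
move=> hv ha h71 h72 h63 h68 hux hx hc hy.
have hu : u < n by lia.
have T2_lt := T2_lt; have n_lt := n_lt; have nn_lt := nn_lt.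
eapply tri_le.
  eapply tri_seq; asn; first by slv.
  eapply tri_seq; eapply tri_call.
    eapply (@tri_for _ _ _ T2 _ _ _ (fun i v' a' =>
      rep (v' 73) (\sum_(ga < i) sterm y c (slot u x ga) ga)%R)).
    - by [].
    - by rewrite /=; apply: leq_trans T2_lt _; case/andP: Z_W => *; nia.
    - by [].
    - by [].
    - by rewrite big_ord0; split; rewrite /upd //=; lia.
    - move=> i v1 a1 hi v1i hf hr.
      eapply tri_conseq.
      + apply: (tri_sum (u := u) (x := x) (ga := i) (y := y) (c := c) (z := (\sum_(ga < i) sterm y c (slot u x ga) ga)%R)) => //.
        * by apply: (vars_frame hf).
        * exact: (arrs_frame hf).
        * by rewrite hf.1.
        * by rewrite hf.1.
        * by rewrite hf.1.
        * by rewrite hf.1.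
      + by [].
      + by move=> v2 a2; rewrite /upd /= big_ord_recr.
    - by move=> v1 a1 _ _; apply.
  move=> v1 a1 hr hf.
  have [e2 _ _ e12 _] := vars_frame hf isT hv.
  have e71 : v1 71 = u by rewrite hf.1.
  have e72 : v1 72 = x by rewrite hf.1.
  have e4 : a1 4 = a 4 by rewrite hf.2.
  have i1 := idx_lt hu hx; have i2 := idx_lt hx hu.
  have [b73 _] := hr.
  eapply tri_seq; eapply tri_put.
  - rewrite /= e2 e71 e72; slv.
  - by rewrite /=; slv.
  - by rewrite /= e2 e71 e72; slv.
  rewrite /= e2 e71 e72; eapply tri_put.
  - by rewrite /= e2 e71 e72; slv.
  - by rewrite /=; slv.
  - by rewrite /= e2 e71 e72; slv.
  rewrite /= e2 e71 e72 e12; exists (v1 73), ((p - v1 73) %% p); split.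
  - by rewrite /amx hux.
  - rewrite /amx hux ifF; last lia.
    exact: rep_neg.
  - by rewrite /upd2 /= e4.
by rewrite /= /acost /=; lia.
Qed.

(** The entries (u, x) and (x, u) are written together, in the round of the pair (min, max). *)
Definition cells y c (a : nat -> nat -> nat) i j := forall u x, u < n -> x < n ->
  (minn u x < i) || ((minn u x == i) && (maxn u x < j)) -> rep (a 4 (u * n + x)) (amx y c u x).

Lemma tri_build y c v a : vars v -> arrs a -> v 63 = y -> v 68 = c -> c < T2 -> y < p ->
  tri pbuild (20 + n * (40 + n * (200 + T2 * (410 + 70 * lg)))) (fun _ a' => mxr n a' (amx y c)) v a.
Proof.
move=> hv ha h63 h68 hc hy.
have T2_lt := T2_lt; have n_lt := n_lt; have nn_lt := nn_lt.
have [h2 _ _ _ _] := hv.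
eapply tri_le.
  eapply (@tri_for _ _ _ n _ _ _ (fun i _ a' => cells y c a' i 0)).
  - by [].
  - by [].
  - by [].
  - by [].
  - by move=> u x _ _; rewrite !ltn0 andbF.
  - move=> i v1 a1 hi v1i hf hcell.
    have hv1 := vars_frame hf isT hv; have ha1 := arrs_frame hf isT ha.
    have [e2 _ _ _ _] := hv1.
    eapply (@tri_for _ _ _ n _ _ _ (fun j _ a' => cells y c a' i j)).
    + by [].
    + by [].
    + by [].
    + by [].
    + by [].
    + move=> j v2 a2 hj v2j hf2 hcell2.
      have hv2 := vars_frame hf2 isT hv1; have ha2 := arrs_frame hf2 isT ha1.
      have [f2 _ _ f12 _] := hv2.
      have e71 : v2 71 = i by rewrite hf2.1.
      have e63 : v2 63 = y by rewrite hf2.1 // hf.1.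
      have e68 : v2 68 = c by rewrite hf2.1 // hf.1.
      have i1 := idx_lt hi hj.
      eapply tri_if; first by [].
        rewrite /= e71 v2j eqb0 negbK => hij.
        apply: tri_conseq (tri_entry hv2 ha2 e71 v2j e63 e68 hij hj hc hy) (leqnn _) _.
        move=> _ a3 [k [k' [rk rk' e4]]] u x hu hx hux; rewrite e4 /upd !idx_eq //.
        case: ifP => [/andP[/eqP-> /eqP->] //|c1]; case: ifP => [/andP[/eqP-> /eqP->] //|c2].
        by apply: hcell2 => //; move: hux c1 c2; lia.
      rewrite /= e71 v2j => /eqP; rewrite eqb0 -leqNgt => hij.
      eapply tri_le; first eapply tri_if; first by [].
      * rewrite /= e71 v2j eqb0 negbK => hij'; eapply tri_le; first apply: tri_nop.
          move=> u x hu hx hux; apply: hcell2 => //; move: hux; lia.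
        exact: (leq_addr 100).
      * rewrite /= e71 v2j => /eqP; rewrite eqb0 -leqNgt => hij'.
        have eij : i = j by lia.
        eapply tri_le; first eapply tri_put.
        -- by rewrite /= f2 e71 v2j; slv.
        -- by rewrite /=; slv.
        -- by rewrite /= f2 e71 v2j; slv.
        -- rewrite /= f2 e71 v2j => u x hu hx hux; rewrite /upd2 /= /upd idx_eq //.
           case: (altP (u =P i)) => [ui|ui]; case: (altP (x =P j)) => [xj|xj] /=;
             try (by apply: hcell2 => //; move: hux; lia).
           by rewrite ui xj eij /amx ltnn; split=> //; lia.
        by rewrite /= /acost.
      by rewrite /=; lia.
    + move=> v2 a2 _ _ hcell2 u x hu hx hux; apply: hcell2 => //; move: hux; lia.
  - move=> v1 a1 _ _ hcell u x hu hx; apply: hcell => //; lia.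
by rewrite /= /acost /=; lia.
Qed.

Definition pchars :=
  67 ::= N 0;;
  SFor 68 (N T2) (
    pbuild;; ppfaff;;
    SIf (G 5 (V 68 * N T2 + V va)) (67 ::= (V 67 + (V vp - V 70)) mod V vp)
      (67 ::= (V 67 + V 70) mod V vp)).

Definition charsum y m : 'F_p := (\sum_(c < m) (-1) ^+ chi c al * pf 0%N (amx y c) (iota 0 n))%R.

Definition Tchars := 30 + T2 * (200 + (n * (40 + n * (200 + T2 * (410 + 70 * lg)))
  + h * (500 + 70 * lg + n * (350 + n * 470)))).

Lemma tri_chars y v a : vars v -> arrs a -> v 63 = y -> v va = al -> y < p ->
  tri pchars Tchars (fun v' _ => rep (v' 67) (charsum y T2)) v a.
Proof.
move=> hv ha h63 h4 hy; have T2_lt := T2_lt; have n_lt := n_lt; have nn_lt := nn_lt.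
eapply tri_le.
  eapply tri_seq; asn; first by slv.
  eapply (@tri_for _ _ _ T2 _ _ _ (fun i v' a' => rep (v' 67) (charsum y i))).
  - by [].
  - by rewrite /=; apply: leq_trans T2_lt _; case/andP: Z_W => *; nia.
  - by [].
  - by [].
  - by rewrite /charsum big_ord0; split; rewrite /upd //=; lia.
  - move=> i v1 a1 hi v1i hf hr.
    have hv0 : vars (upd v 67 (ev v a (N 0))) by case: hv.
    have hv1 := vars_frame hf isT hv0; have ha1 := arrs_frame hf isT ha.
    have e63 : v1 63 = y by rewrite hf.1.
    have e4 : v1 4 = al by rewrite hf.1.
    eapply tri_seq; apply: tri_call (tri_build hv1 ha1 e63 v1i hi hy) _ => v2 a2 hM hf2.
    have hv2 := vars_frame hf2 isT hv1; have ha2 := arrs_frame hf2 isT ha1.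
    have [e2 e5 e10 e12 _] := hv2.
    have lg2 : p - 2 < 2 ^ lg by apply: leq_ltn_trans lg_gt; apply: leq_subr.
    eapply tri_seq; apply: tri_call (tri_pfaff w Z_W Bs_lt p_pr p_gt2 p_lt nn_lt n_lt n2h lg2
       e2 e5 e10 e12 (amx_skew y i) hM) _ => v3 a3 h70 hf3.
    have [f2 _ _ f12 _] := vars_frame hf3 isT hv2; have [_ _ _ f5] := arrs_frame hf3 isT ha2.
    have f67 : v3 67 = v1 67 by rewrite hf3.1 // hf2.1.
    have f68 : v3 68 = i by rewrite hf3.1 // hf2.1.
    have f4 : v3 4 = al by rewrite hf3.1 // hf2.1.
    have i3 : i * T2 + al < T2 * T2 by apply: idx_lt.
    have TT_lt' := TT_lt; have [b67 _] := hr; have [b70 _] := h70.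
    have ech : charsum y i.+1 = (charsum y i + (-1) ^+ chi i al * pf 0%N (amx y i) (iota 0 n))%R.
      by rewrite /charsum big_ord_recr.
    eapply tri_if.
    + by rewrite /= f68 f4; slv.
    + rewrite /= f68 f4 f5 // eqb0 negbK => hchi.
      asn; first (rewrite /= f67 f12; slv).
      by rewrite /upd /= f67 f12 ech hchi expr1 mulN1r; apply: rep_sub.
    + rewrite /= f68 f4 f5 // => /eqP; rewrite eqb0 => hchi.
      eapply tri_le; first asn; first by rewrite /= f67; slv.
        by rewrite /upd /= f67 f12 ech (negbTE hchi) expr0 mul1r; apply: rep_add.
      by [].
  - by move=> v1 a1 _ _.
by rewrite /Tchars /= /acost /=; lia.
Qed.

(** Variable 61 runs through (-1)^i C(N, i) by way of (i + 1) C(N, i + 1) = (N - i) C(N, i), where N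
    < p makes i + 1 invertible. The inverse in variable 64 is reused for the power (i + 1)^(-k). *)
Definition ptest :=
  60 ::= N 0;; 61 ::= N 1;;
  SFor 62 (V vN) (
    63 ::= V 62 + N 1;;
    ppow (V 63) (V vp - N 2);; 64 ::= V 23;;
    61 ::= (V 61 * (V vN - V 62)) mod V vp;; 61 ::= (V 61 * V 64) mod V vp;;
    61 ::= (V vp - V 61) mod V vp;;
    ppow (V 64) (V vk);;
    66 ::= (V 61 * V 23) mod V vp;;
    pchars;;
    60 ::= (V 60 + (V 66 * V 67) mod V vp) mod V vp).

Definition testsum k m : 'F_p := (\sum_(i < m) (-1) ^+ i.+1 * 'C(Np, i.+1)%:R
   * ((i.+1%:R^-1) ^+ (k %% 2 ^ lg) * charsum i.+1 T2))%R.

Lemma tri_test k v a : vars v -> arrs a -> v va = al -> v vN = Np -> v vk = k ->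
  tri ptest (50 + Np * (800 + 140 * lg + Tchars)) (fun v' _ => rep (v' 60) (testsum k Np)) v a.
Proof.
move=> hv ha h4 h13 h15.
eapply tri_le.
  eapply tri_seq; asn; first by slv.
  eapply tri_seq; asn; first by slv.
  rewrite [ev _ _ _]/= [ev _ _ _]/=.
  eapply (@tri_for _ _ _ Np _ _ _ (fun i v' a' => rep (v' 60) (testsum k i) /\
     rep (v' 61) ((-1) ^+ i * 'C(Np, i)%:R : 'F_p)%R)).
  - by [].
  - by [].
  - by [].
  - by [].
  - rewrite /testsum big_ord0 expr0 bin0 mul1r /upd /=.
    by split; split=> //; lia.
  - move=> i v1 a1 hi v1i hf [hr60 hr61].
    have hv0 : vars (upd (upd v 60 0) 61 1) by case: hv.
    have hv1 := vars_frame hf isT hv0; have ha1 := arrs_frame hf isT ha.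
    have e4 : v1 4 = al by rewrite hf.1.
    have e13 : v1 13 = Np by rewrite hf.1.
    have e15 : v1 15 = k by rewrite hf.1.
    have [e2 e5 e10 e12 e14] := hv1.
    have hi1 : i.+1 < p by lia.
    have ri := rep_mod p_pr i.+1; rewrite (modn_small hi1) in ri.
    have lg2 : p - 2 < 2 ^ lg by apply: leq_ltn_trans lg_gt; apply: leq_subr.
    have [b60 _] := hr60; have [b61 _] := hr61.
    eapply tri_seq; asn; first by rewrite /= v1i; slv.
    rewrite [ev _ _ _]/= v1i addn1; set v2 := upd v1 63 _.
    have hv2 : vars v2 by [].
    eapply tri_seq; eapply tri_call.
      eapply (tri_pow w Z_W (p := p) (lg := lg) (b0 := i.+1) (k := p - 2)) => //=.
      - lia.
      - by rewrite /upd /=; slv.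
      - by rewrite /upd /v2 /upd /= e12.
    move=> v3 a3; rewrite (modn_small lg2) => h23 hf3.
    have r23 := rep_pow p_pr (p - 2) ri; rewrite -h23 Fp_inv // in r23.
    have hv3 := vars_frame hf3 isT hv2; have ha3 := arrs_frame hf3 isT ha1.
    have [g2 g5 g10 g12 g14] := hv3.
    eapply tri_seq; asn; first by [].
    have f61 : v3 61 = v1 61 by rewrite hf3.1.
    have f62 : v3 62 = i by rewrite hf3.1.
    have f13 : v3 13 = Np by rewrite hf3.1.
    have [b23 _] := r23.
    eapply tri_seq; asn; first by rewrite /= /upd /= f61 f62 f13; clear -Z_W b61 Np_lt p_lt; slv.
    rewrite [ev _ _ _]/= /upd /= f61 f62 f13 g12.
    have rNi := rep_mod p_pr (Np - i); rewrite modn_small in rNi; last lia.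
    have rm := rep_mul p_pr hr61 rNi.
    move: (_ %% p) rm => c1 rm; have [bc1 _] := rm.
    eapply tri_seq; asn; first by rewrite /=; slv.
    rewrite [ev _ _ _]/= /upd /= g12; have rm2 := rep_mul p_pr rm r23; move: (_ %% p) rm2 => c2 rm2; have [bc2 _] := rm2.
    eapply tri_seq; asn; first by rewrite /=; slv.
    rewrite [ev _ _ _]/= /upd /= g12; have rm3 := rep_neg p_pr rm2; move: (_ %% p) rm3 => c3 rm3.
    have [bc3 _] := rm3.
    have i0 : (i.+1%:R : 'F_p)%R != 0%R.
      by rewrite -(rep_eq0 p_pr ri).
    have e61 : (- ((-1) ^+ i * 'C(Np, i)%:R * (Np - i)%:R * i.+1%:R^-1) =
       (-1) ^+ i.+1 * 'C(Np, i.+1)%:R :> 'F_p)%R.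
      have := mul_bin_left Np i => /(congr1 (fun m => m%:R : 'F_p)%R); rewrite !natrM => eb.
      have -> : ('C(Np, i.+1)%:R = (Np - i)%:R * 'C(Np, i)%:R / i.+1%:R :> 'F_p)%R.
        by rewrite -eb mulrC mulKf.
      by rewrite exprS; ring.
    rewrite e61 in rm3.
    set v4 := (fun y : nat => _); have hv4 : vars v4 by case: hv3.
    eapply tri_seq; eapply tri_call.
      eapply (tri_pow w Z_W (p := p) (lg := lg) (b0 := v3 23) (k := k)) => //=.
      - lia.
      - by rewrite /upd /v4 /= hf3.1.
    move=> v5 a5 h23' hf5.
    have hv5 := vars_frame hf5 isT hv4; have ha5 := arrs_frame hf5 isT ha3.
    have r23' := rep_pow p_pr (k %% 2 ^ lg) r23; rewrite -h23' in r23'.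
    have f5_61 : v5 61 = c3 by rewrite hf5.1.
    have [_ _ _ f5_12 _] := hv5; have [b23' _] := r23'.
    eapply tri_seq; asn; first by rewrite /= f5_61; clear -Z_W bc3 b23' p_lt; slv.
    rewrite [ev _ _ _]/= f5_61 f5_12.
    have r66 := rep_mul p_pr rm3 r23'; move: (_ %% p) r66 => c66 r66; have [b66 _] := r66.
    set v6 := upd v5 66 _; have hv6 : vars v6 by case: hv5.
    have f63 : v6 63 = i.+1 by rewrite /v6 /upd /= hf5.1 // /v4 /= hf3.1.
    have f4 : v6 4 = al by rewrite /v6 /upd /= hf5.1 // /v4 /= hf3.1.
    eapply tri_seq; apply: tri_call (tri_chars hv6 ha5 f63 f4 hi1) _ => v7 a7 r67 hf7.
    have [_ _ _ f7_12 _] := vars_frame hf7 isT hv6.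
    have f7_66 : v7 66 = c66 by rewrite hf7.1.
    have f7_60 : v7 60 = v1 60 by rewrite hf7.1 // /v6 /upd /= hf5.1 // /v4 /= hf3.1.
    have f7_61 : v7 61 = c3 by rewrite hf7.1.
    have [b67 _] := r67; have rr := rep_mul p_pr r66 r67.
    have b66' : (c66 * v7 67) %% p < Z by apply: ltn_trans p_lt; rewrite ltn_mod; lia.
    asn.
      rewrite /= f7_60 f7_66 f7_12; move: (_ %% p) b66' => z b66'.
      by clear -Z_W b60 b66 b67 b66' p_lt; slv.
    rewrite [ev _ _ _]/= f7_60 f7_66 f7_12 /upd /=.
    split; last by rewrite f7_61.
    rewrite /testsum big_ord_recr /= -/(testsum k i) mulrA.
    exact: rep_add.
  - by move=> v1 a1 _ _ [].
by rewrite /= /acost /=; lia.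
Qed.

End Test.

(** * Searching for the optimum *)

Section Search.
Variables (W Bs : nat) (w : nat -> bool) (Z : nat).
Hypothesis Z_W : Zbound W Z.
Hypothesis Bs_lt : Bs < Z.
Local Notation tri := (tri W Bs w).
Variables (p n h lg T2 Np al q : nat).
Hypothesis p_pr : prime p.
Hypothesis p_gt2 : 2 < p.
Hypothesis p_lt : p < Z.
Hypothesis n_gt0 : 0 < n.
Hypothesis nnT_lt : n * n * T2 < Z.
Hypothesis n2h : n = 2 * h.
Hypothesis lg_gt : p < 2 ^ lg.
Hypothesis TT_lt : T2 * T2 < Z.
Hypothesis T2_gt0 : 0 < T2.
Hypothesis Np_lt : Np < p.
Hypothesis al_lt : al < T2.
Hypothesis n_Bs : n < Bs.
Hypothesis k_lt : h.+1 * 2 ^ q.+2 < Z.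

Variables (a0 X : nat -> nat) (chi : nat -> nat -> bool).
Definition gok (g : nat -> nat) :=
  forall d, d < n * n * T2 -> g d != 0 -> 4 * g d + 1 < Bs /\ a0 (4 * g d + 1) < 2 ^ lg.
Hypothesis X_lt : forall d, d < n * n * T2 -> X d < p.

Local Notation arrs := (arrs n T2 a0).
Local Notation ptest := (ptest T2).

Definition tst dj g k : bool :=
  (testsum p n lg T2 dj Np al a0 g X chi k Np != 0)%R.

Definition vars0 (v : nat -> nat) :=
  [/\ v vn = n, v vh = h, v vlg = lg, v vp = p & v va = al] /\ v vN = Np.

Lemma vars0_frame ks v v' a a' xs : framed xs ks v a v' a' ->
  [&& vn \notin xs, vh \notin xs, vlg \notin xs, vp \notin xs, va \notin xs & vN \notin xs] ->
  vars0 v -> vars0 v'.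
Proof.
move=> [hf _]; case/and5P=> h0 h1 h3 h5 /andP[h6 h7] [[e0 e1 e3 e5 e6] e7].
by split; first split; rewrite hf.
Qed.

Definition Ttest := 50 + Np * (800 + 140 * lg + Tchars n h lg T2).

Lemma tri_tst dj g k v a : 0 < dj -> gok g -> vars0 v -> arrs g X chi a -> v vdj = dj -> v vk = k ->
  tri ptest Ttest (fun v' _ => (v' 60 != 0) = tst dj g k) v a.
Proof.
move=> dj0 hg [[e0 e1 e3 e5 e6] e7] ha hdj hk.
eapply tri_conseq; [|exact: leqnn|].
  by eapply (tri_test w Z_W Bs_lt p_pr p_gt2 p_lt n_gt0 nnT_lt n2h lg_gt TT_lt T2_gt0 dj0 Np_lt al_lt hg X_lt);
    [split=> //|exact: ha|exact: e6|exact: e7|exact: hk].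
by move=> v' _ /(rep_eq0 p_pr) e; rewrite /tst -e.
Qed.

Definition sstep dj g (s : nat * bool) : nat * bool :=
  if s.2 then s else if tst dj g s.1 then (s.1, true) else (s.1.+1, false).

Definition lstep g (s : nat * bool * nat) : nat * bool * nat :=
  (iter h.+1 (sstep s.2 g) (2 * s.1.1, false), s.2 %/ 2).

Definition levels g l := iter l (lstep g) (0, false, 2 ^ q).

Lemma levels_dj g l : (levels g l).2 = 2 ^ q %/ 2 ^ l.
Proof.
elim: l => [|l IH]; first by rewrite divn1.
by rewrite /levels iterS -/(levels g l) /lstep /= IH -divnMA expnSr.
Qed.

Lemma iter_sstep_le dj g k i : (iter i (sstep dj g) (k, false)).1 <= k + i.
Proof.
elim: i => [|i IH]; first by rewrite addn0.
move: IH; rewrite iterS; move: (iter i _ _) => [k' []] /= IH; rewrite /sstep /=; first lia.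
by case: ifP => _ /=; lia.
Qed.

(** Valid whatever the tests answer, so that even an unlucky run does not overflow. *)
Lemma levels_le g l : (levels g l).1.1 + h.+1 <= h.+1 * 2 ^ l.
Proof.
elim: l => [|l IH]; first by rewrite /= expn0; lia.
have -> : (levels g l.+1).1.1 =
  (iter h.+1 (sstep (levels g l).2 g) (2 * (levels g l).1.1, false)).1 by [].
have := iter_sstep_le (levels g l).2 g (2 * (levels g l).1.1) h.+1.
rewrite expnS; move: (iter h.+1 (sstep (levels g l).2 g) (2 * (levels g l).1.1, false)).1 => x.
by move: (levels g l).1.1 (2 ^ l) IH => y z; nia.
Qed.

Definition pcand :=
  SFor 51 (V vh + N 1) (
    SIf (V 0) SNop (ptest;; SIf (V 60) (0 ::= N 1) (15 ::= V 15 + N 1))).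

Definition plevels :=
  14 ::= V vQ;; 15 ::= N 0;; 0 ::= N 0;;
  SFor 50 (V vq + N 1) (15 ::= N 2 * V 15;; 0 ::= N 0;; pcand;; 14 ::= V 14 / N 2).

Lemma tri_cand dj g k v a : 0 < dj -> gok g -> vars0 v -> arrs g X chi a -> v vdj = dj ->
  v vk = k -> v 0 = 0 -> k + h.+2 < Z ->
  tri pcand (30 + h.+1 * (60 + Ttest)) (fun v' _ =>
    v' vk = (iter h.+1 (sstep dj g) (k, false)).1 /\
    (v' 0 != 0) = (iter h.+1 (sstep dj g) (k, false)).2) v a.
Proof.
move=> dj0 hg hv ha hdj hk h0 kZ.
have [[h2 h5 _ _ _] _] := hv.
eapply tri_le.
  eapply (@tri_for _ _ _ h.+1 _ _ _ (fun i v' a' =>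
    v' vk = (iter i (sstep dj g) (k, false)).1 /\
    (v' 0 != 0) = (iter i (sstep dj g) (k, false)).2)).
  - by rewrite /= h5 addn1.
  - by rewrite /= h5; slv.
  - by [].
  - by [].
  - by rewrite /upd /= hk h0.
  - move=> i v1 a1 hi v1i hf [i1 i2].
    have hv1 := vars0_frame hf isT hv; have ha1 := arrs_frame hf isT ha.
    have e14 : v1 14 = dj by rewrite hf.1.
    have kb := iter_sstep_le dj g k i.
    eapply tri_if; first by [].
    + rewrite [ev _ _ _]/= i2 => hfl; eapply tri_le; first apply: tri_nop.
        by rewrite /upd /= i1 i2 /sstep hfl.
      exact: (leq_addr (40 + Ttest)).
    + rewrite [ev _ _ _]/= => z0; move: i2; rewrite z0 eqxx => /esym hfl.
      eapply tri_le; first eapply tri_seq.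
        apply: tri_call (tri_tst dj0 hg hv1 ha1 e14 i1) _ => v2 a2 h60 hf2.
        have e15 : v2 15 = v1 15 by rewrite hf2.1.
        eapply tri_if; first by [].
        * rewrite [ev _ _ _]/= h60 => ht; eapply tri_le; first asn; first by slv.
            by rewrite /upd /= e15 i1 /sstep hfl ht.
          exact: (leq_addr 20).
        * rewrite [ev _ _ _]/= => /eqP ht; eapply tri_le; first asn.
          -- by rewrite /= e15 i1; slv.
          -- rewrite /upd /= e15 i1 addn1 hf2.1 // z0 /sstep hfl.
             by move: h60; rewrite ht => /esym ->.
          by [].
      by rewrite /=; lia.
  - by move=> v1 a1 _ _.
by rewrite /=; lia.
Qed.

Lemma tri_levels g v a : gok g -> vars0 v -> arrs g X chi a -> v vQ = 2 ^ q -> v vq = q ->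
  tri plevels (70 + q.+1 * (120 + h.+1 * (60 + Ttest))) (fun v' _ =>
    v' vk = (levels g q.+1).1.1 /\ (v' 0 != 0) = (levels g q.+1).1.2) v a.
Proof.
move=> hg hv ha hQ hq.
have qZ : q.+2 < Z.
  by apply: leq_ltn_trans k_lt; apply: leq_trans (ltnW (ltn_expl q.+2 (isT : 1 < 2))) _; rewrite leq_pmull.
eapply tri_le.
  eapply tri_seq; asn; first by [].
  eapply tri_seq; asn; first by slv.
  eapply tri_seq; asn; first by slv.
  rewrite [ev _ _ _]/= [ev _ _ _]/= [ev _ _ _]/= hQ; set v0 := upd _ _ _.
  have hv0 : vars0 v0 by case: hv => [[? ? ? ? ?] ?].
  eapply (@tri_for _ _ _ q.+1 _ _ _ (fun l v' a' =>
    [/\ v' vk = (levels g l).1.1, (v' 0 != 0) = (levels g l).1.2 & v' 14 = (levels g l).2])).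
  - by rewrite /= /v0 /upd /= hq addn1.
  - by rewrite /= /v0 /upd /= hq; slv.
  - by [].
  - by [].
  - by [].
  - move=> l v1 a1 hl v1i hf [i1 i2 i3].
    have hv1 := vars0_frame hf isT hv0; have ha1 := arrs_frame hf isT ha.
    have kb := levels_le g l.
    have dj0 : 0 < (levels g l).2 by rewrite levels_dj divn_gt0 ?expn_gt0 // leq_exp2l.
    have l2 : 2 ^ l.+2 <= 2 ^ q.+2 by rewrite leq_exp2l //; lia.
    have kb4 : 4 * (levels g l).1.1 + 4 * h.+1 < Z.
      apply: leq_ltn_trans k_lt; apply: leq_trans (_ : h.+1 * 2 ^ l.+2 <= _); last by rewrite leq_mul2l l2 orbT.
      by move: kb; rewrite !expnS; move: (2 ^ l) => x; lia.
    eapply tri_seq; asn; first by rewrite /= i1; slv.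
    eapply tri_seq; asn; first by slv.
    rewrite [ev _ _ _]/= [ev _ _ _]/= i1; set v2 := upd _ _ _.
    have hv2 : vars0 v2 by case: hv1 => [[? ? ? ? ?] ?].
    have k2 : 2 * (levels g l).1.1 + h.+2 < Z by lia.
    eapply tri_seq; apply: tri_call (tri_cand dj0 hg hv2 ha1 i3 (erefl _) (erefl _) k2) _ => v3 a3 [j1 j2] hf3.
    have e14 : v3 14 = (levels g l).2 by rewrite hf3.1.
    asn; first by slv.
    by rewrite /levels iterS -/(levels g l) /lstep /upd /= e14 j1 j2.
  - by move=> v1 a1 _ _ [].
by rewrite /=; lia.
Qed.

(** * Deletion of slots and output *)

Definition pdel :=
  14 ::= N 1;;
  SFor 52 (V vE) (
    53 ::= G 1 (V 52);;
    SIf (V 53) (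
      SPut 1 (V 52) (N 0);; ptest;;
      SIf (V 60) SNop (SPut 1 (V 52) (V 53))) SNop).

Definition dstep k (g : nat -> nat) d :=
  if (g d != 0) && tst 1 (upd g d 0) k then upd g d 0 else g.

Definition dels k g m := foldl (dstep k) g (iota 0 m).

Lemma gok_upd0 g d : gok g -> gok (upd g d 0).
Proof. by move=> hg d' hd'; rewrite /upd; case: ifP => // _; apply: hg. Qed.

Lemma gok_dels k g m : gok g -> gok (dels k g m).
Proof.
move=> hg; rewrite /dels; elim: (iota 0 m) g hg => //= d s IH g hg; apply: IH.
by rewrite /dstep; case: ifP => // _; apply: gok_upd0.
Qed.

Lemma tri_del k g v a : gok g -> vars0 v -> arrs g X chi a -> v vk = k -> v vE = n * n * T2 ->
  tri pdel (30 + n * n * T2 * (100 + Ttest)) (fun _ a' => a' 1 =1 dels k g (n * n * T2)) v a.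
Proof.
move=> hg hv ha hk hE.
eapply tri_le.
  eapply tri_seq; asn; first by slv.
  rewrite [ev _ _ _]/=; set v0 := upd _ _ _.
  have hv0 : vars0 v0 by case: hv => [[? ? ? ? ?] ?].
  eapply (@tri_for _ _ _ (n * n * T2) _ _ _ (fun d _ a' => arrs (dels k g d) X chi a')).
  - by rewrite /= /v0 /upd /= hE.
  - by [].
  - by [].
  - by [].
  - by [].
  - move=> d v1 a1 hd v1i hf ha1.
    have hv1 := vars0_frame hf isT hv0.
    have [r0 r1 r3 r5] := ha1.
    have e14 : v1 14 = 1 by rewrite hf.1.
    have e15 : v1 15 = k by rewrite hf.1.
    have dS : dels k g d.+1 = dstep k (dels k g d) d.
      by rewrite /dels -addn1 iotaD foldl_cat.
    eapply tri_seq; asn; first by rewrite /= v1i; slv.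
    rewrite [ev _ _ _]/= v1i r1; set gd := dels k g d in r1 dS *; set v2 := upd _ _ _.
    eapply tri_if; first by [].
    + move=> nz; rewrite [ev _ _ _]/= /v2 /upd /= in nz.
      eapply tri_seq; eapply tri_put.
      * by [].
      * by slv.
      * by rewrite /= /v2 /upd /= v1i; slv.
      rewrite [ev _ _ _]/= [ev _ _ _]/= (_ : v2 52 = d) //; set a2 := upd2 _ _ _ _.
      have ha2 : arrs (upd gd d 0) X chi a2.
        by split=> // x; rewrite /a2 /upd2 /= /upd; case: ifP => // _; apply: r1.
      have hv2 : vars0 v2 by case: hv1 => [[? ? ? ? ?] ?].
      have hgd : gok (upd gd d 0) by apply: gok_upd0; apply: gok_dels.
      eapply tri_seq; apply: tri_call (tri_tst (isT : 0 < 1) hgd hv2 ha2 e14 e15) _ => v3 a3 h60 hf3.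
      have [s0 s1 s3 s5] := arrs_frame hf3 isT ha2.
      eapply tri_if; first by [].
      * rewrite [ev _ _ _]/= h60 => ht; eapply tri_le; first apply: tri_nop.
          by rewrite dS /dstep nz ht.
        exact: (leq_addr 40).
      * rewrite [ev _ _ _]/= => /eqP ht; eapply tri_le; first eapply tri_put.
        -- by [].
        -- by [].
        -- by rewrite /= hf3.1 // /v2 /upd /= v1i; slv.
        -- rewrite /= !hf3.1 // /v2 /upd /= v1i dS /dstep nz -h60 ht /=.
           split=> // x; rewrite /upd2 /=; rewrite /upd; case: ifP => [/eqP-> //|ne].
           by rewrite s1 /upd ne.
        by [].
    + move=> z; rewrite [ev _ _ _]/= /v2 /upd /= in z; eapply tri_le; first apply: tri_nop.
        by rewrite dS /dstep z.
      by rewrite /=; apply: leq_trans (leq_addl _ _).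
  - by move=> v1 a1 _ _ [].
by rewrite /= /acost /=; lia.
Qed.

(** In an unlucky run more than n/2 slots may survive; the comparison with [vn] keeps the output
    inside array 0 all the same. The input may be overwritten, since the edge indices come from
    array 1. *)
Definition pout :=
  54 ::= N 0;;
  SFor 52 (V vE) (
    53 ::= G 1 (V 52);;
    SIf (V 53) (SIf (V 54 < V vn) (SPut 0 (V 54) (V 53 - N 1);; 54 ::= V 54 + N 1) SNop) SNop).

Definition outs (g : nat -> nat) m := [seq (g d).-1 | d <- iota 0 m & g d != 0].

Lemma tri_out g v a : v vn = n -> v vE = n * n * T2 -> a 1 =1 g ->
  tri pout (40 + n * n * T2 * 150) (fun v' a' =>
    forall i, i < n -> i < size (outs g (n * n * T2)) -> a' 0 i = nth 0 (outs g (n * n * T2)) i) v a.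
Proof.
move=> hn hE hg; have n_lt' := ltn_trans n_Bs Bs_lt.
eapply tri_le.
  eapply tri_seq; asn; first by slv.
  eapply (@tri_for _ _ _ (n * n * T2) _ _ _ (fun d v' a' =>
    v' 54 = minn n (size (outs g d)) /\ forall i, i < v' 54 -> a' 0 i = nth 0 (outs g d) i)).
  - by rewrite /= /upd /= hE.
  - by [].
  - by [].
  - by [].
  - by rewrite /upd /= minn0.
  - move=> d v1 a1 hd v1i hf [i1 i2].
    have e1 : a1 1 =1 g by move=> x; rewrite hf.2.
    have e2 : v1 2 = n by rewrite hf.1.
    have oS : outs g d.+1 = outs g d ++ (if g d != 0 then [:: (g d).-1] else [::]).
      by rewrite /outs -addn1 iotaD filter_cat map_cat /=; case: ifP.
    eapply tri_seq; asn; first by rewrite /= v1i; slv.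
    rewrite [ev _ _ _]/= v1i e1; set v2 := upd _ _ _.
    eapply tri_if; first by [].
    + move=> nz; rewrite [ev _ _ _]/= /v2 /upd /= in nz; rewrite nz in oS.
      eapply tri_if; first by [].
      * rewrite [ev _ _ _]/= /v2 /upd /= e2 eqb0 negbK => lt.
        have e54 : v1 54 = size (outs g d) by move: i1 lt; lia.
        eapply tri_seq; eapply tri_put.
        -- by [].
        -- by slv.
        -- by rewrite /= /valid /=; apply: ltn_trans lt n_Bs.
        asn; first by rewrite /=; slv.
        rewrite /= /upd /= addn1 oS size_cat /= addn1 e54; split; first by move: lt; rewrite e54; lia.
        move=> i; rewrite ltnS leq_eqVlt /upd2 /= /upd nth_cat subn1 => /orP[/eqP->|hi].
          by rewrite eqxx ltnn subnn.
        by rewrite hi ifF ?i2 ?e54 //; apply/negbTE; lia.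
      * rewrite [ev _ _ _]/= /v2 /upd /= e2 => /eqP; rewrite eqb0 -leqNgt => ge.
        eapply tri_le; first apply: tri_nop.
          rewrite /= oS size_cat /= addn1; have e54 : v1 54 = n by move: i1 ge; lia.
          have le : n <= size (outs g d) by move: i1 e54; lia.
          split; first by rewrite e54; lia.
          by move=> i hi; rewrite nth_cat ifT ?i2 //; move: hi; rewrite e54; lia.
        by [].
    + move=> z; rewrite [ev _ _ _]/= /v2 /upd /= in z; rewrite z /= cats0 in oS.
      eapply tri_le; first apply: tri_nop; first by rewrite /upd /= oS.
      by rewrite /=; apply: leq_trans (leq_addl _ _).
  - move=> v1 a1 _ _ [i1 i2] i hn' hs; apply: i2; rewrite i1; lia.
by rewrite /= /acost /=; lia.
Qed.

End Search.

(** * Reading the input *)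

(** Dyadic blocks: the 2^L terms from i = 2^L - 1 on are each at most X / 2^L, so every block
    contributes at most X. *)
Lemma harmonic X L : \sum_(i < 2 ^ L - 1) X %/ i.+1 <= L * X.
Proof.
elim: L => [|L IH]; first by rewrite big_ord0.
rewrite -!(big_mkord xpredT (fun i => X %/ i.+1)) in IH *.
have l0 : 0 < 2 ^ L by rewrite expn_gt0.
rewrite (big_cat_nat (n := 2 ^ L - 1)) //=; last by rewrite expnS; lia.
rewrite mulSn addnC leq_add //.
apply: (@leq_trans (\sum_(2 ^ L - 1 <= i < 2 ^ L.+1 - 1) X %/ 2 ^ L)).
  rewrite big_seq_cond [leqRHS]big_seq_cond; apply: leq_sum => i; rewrite mem_index_iota andbT => hi.
  by apply: leq_div2l => //; lia.
rewrite sum_nat_const_nat (_ : 2 ^ L.+1 - 1 - (2 ^ L - 1) = 2 ^ L); last by rewrite expnS; lia.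
by rewrite mulnC leq_trunc_div.
Qed.

Fixpoint horner (b : nat -> nat) i := if i is j.+1 then 2 * horner b j + b j else 0.

Lemma horner_lt b i : (forall j, j < i -> b j <= 1) -> horner b i < 2 ^ i.
Proof.
elim: i => //= i IH h; have := IH (fun j hj => h j (ltnW hj)); have := h i (leqnn _).
by rewrite expnS; lia.
Qed.

Lemma horner_inj b b' i : (forall j, j < i -> b j <= 1) -> (forall j, j < i -> b' j <= 1) ->
  horner b i = horner b' i -> forall j, j < i -> b j = b' j.
Proof.
elim: i => //= i IH h h' e j; have hi := h i (leqnn _); have hi' := h' i (leqnn _).
have e1 : b i = b' i by lia.
rewrite ltnS leq_eqVlt => /orP[/eqP->//|]; apply: IH; last by lia.
  by move=> *; apply: h; lia.
by move=> *; apply: h'; lia.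
Qed.

Section Setup.
Variables (W Bs : nat) (w : nat -> bool) (Z : nat).
Hypothesis Z_W : Zbound W Z.
Hypothesis Bs_lt : Bs < Z.
Local Notation tri := (tri W Bs w).

(** Straight-line code that stores a table. Since t is fixed, the tables of characters and of
    addition in GF(2)^t can be part of the program. *)
Fixpoint ptab k (f : nat -> nat) m :=
  if m is m'.+1 then ptab k f m';; SPut k (N m') (N (f m')) else SNop.

Lemma amods_ptab k f m : {subset amods (ptab k f m) <= [:: k]}.
Proof. by elim: m => //= m IH x; rewrite mem_cat => /orP[/IH|]. Qed.

Lemma tri_tab k f m v a : 0 < k < 16 -> m <= Z -> (forall i, i < m -> f i < Z) ->
  tri (ptab k f m) (20 * m + 1) (fun _ a' => forall i, i < m -> a' k i = f i) v a.
Proof.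
move=> hk; elim: m => [|m IH] hm hf; first by apply: tri_nop.
have hfm := hf m (leqnn _).
eapply tri_le; first eapply tri_seq.
  apply: tri_conseq (IH _ _) (leqnn _) _; [lia|by move=> i hi; apply: hf; lia|].
  move=> v1 a1 h1; eapply tri_put.
  - by rewrite /=; slv.
  - by rewrite /=; slv.
  - by rewrite /=; slv.
  move=> i; rewrite ltnS leq_eqVlt /upd2 eqxx /upd => /orP[/eqP->|hi]; first by rewrite eqxx.
  by rewrite /= ifF ?h1 //; apply/negbTE; lia.
by rewrite /= /acost; case: ifP => _; lia.
Qed.

Variables (n ne T2 al : nat) (a0 eu ev' wt ga : nat -> nat).
Hypothesis T2_gt0 : 0 < T2.
Hypothesis Bs_eq : Bs = 4 + 4 * ne + n.
Hypothesis a0_0 : a0 0 = n.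
Hypothesis a0_1 : a0 1 = ne.
Hypothesis a0_2 : a0 2 = al.
Hypothesis a0_u : forall e, e < ne -> a0 (4 * e + 3) = eu e.
Hypothesis a0_v : forall e, e < ne -> a0 (4 * e + 4) = ev' e.
Hypothesis a0_w : forall e, e < ne -> a0 (4 * e + 5) = wt e.
Hypothesis a0_g : forall e, e < ne -> a0 (4 * e + 6) = ga e.
Hypothesis eu_lt : forall e, e < ne -> eu e < n.
Hypothesis ev_lt : forall e, e < ne -> ev' e < n.
Hypothesis uv_ne : forall e, e < ne -> eu e != ev' e.
Hypothesis ga_lt : forall e, e < ne -> ga e < T2.
Hypothesis nnT_lt : n * n * T2 < Z.
Hypothesis T2_lt : T2 < Z.

Definition ecls e := slot n T2 (minn (eu e) (ev' e)) (maxn (eu e) (ev' e)) (ga e).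

Definition gspec m (g : nat -> nat) := forall d, d < n * n * T2 ->
  (g d = 0 /\ forall e, e < m -> ecls e != d) \/
  (exists e, [/\ e < m, g d = e.+1, ecls e = d & forall e', e' < m -> ecls e' = d -> wt e <= wt e']).

Definition wmx m := \max_(e < m) wt e.

Definition pedge :=
  31 ::= N 4 * V 30;;
  32 ::= G 0 (V 31 + N 3);; 33 ::= G 0 (V 31 + N 4);;
  34 ::= G 0 (V 31 + N 5);; 35 ::= G 0 (V 31 + N 6);;
  SIf (V 32 < V 33) SNop (36 ::= V 32;; 32 ::= V 33;; 33 ::= V 36);;
  37 ::= (V 32 * V vn + V 33) * N T2 + V 35;;
  38 ::= G 1 (V 37);;
  SIf (V 38) (SIf (V 34 < G 0 (N 4 * V 38 + N 1)) (SPut 1 (V 37) (V 30 + N 1)) SNop)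
    (SPut 1 (V 37) (V 30 + N 1));;
  SIf (V vwm < V 34) (vwm ::= V 34) SNop.

Lemma ecls_lt e : e < ne -> ecls e < n * n * T2.
Proof.
move=> he; have hu := eu_lt he; have hv := ev_lt he; have hg := ga_lt he.
rewrite /ecls /slot; apply: (@leq_trans ((minn (eu e) (ev' e) * n + maxn (eu e) (ev' e)).+1 * T2)).
  by rewrite mulSn; lia.
by rewrite leq_mul2r idx_lt ?orbT //; lia.
Qed.

Lemma tri_edge e v a : e < ne -> v 30 = e -> v vn = n -> v vwm = wmx e ->
  a 0 = a0 -> gspec e (a 1) ->
  tri pedge 300 (fun v' a' => v' vwm = wmx e.+1 /\ gspec e.+1 (a' 1)) v a.
Proof.
move=> he h30 h2 h7 ha0 hg.
have hu := eu_lt he; have hv := ev_lt he; have hga := ga_lt he; have hne := uv_ne he.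
have hc := ecls_lt he.
have nnZ : n * n < Z by apply: leq_ltn_trans nnT_lt; rewrite leq_pmulr.
have TZ : T2 < Z by apply: leq_ltn_trans nnT_lt; rewrite leq_pmull; nia.
have nZ : n < Z by lia.
have i0 : minn (eu e) (ev' e) < n by lia.
have i1 : maxn (eu e) (ev' e) < n by lia.
have i2 := idx_lt i0 i1.
have hprod : (minn (eu e) (ev' e) * n + maxn (eu e) (ev' e)) * T2 < Z.
  by apply: leq_ltn_trans nnT_lt; rewrite leq_mul2r ltnW ?orbT.
have gB d : d < n * n * T2 -> a 1 d <= ne.
  by move=> hd; case: (hg d hd) => [[->]|[e' [? -> _ _]]] //; lia.
eapply tri_le.
  eapply tri_seq; asn; first by rewrite /= h30; slv; lia.
  rewrite [ev _ _ _]/= h30.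
  eapply tri_seq; asn; first by rewrite /= /upd /= /valid /=; slv; lia.
  eapply tri_seq; asn; first by rewrite /= /upd /= /valid /=; slv; lia.
  eapply tri_seq; asn; first by rewrite /= /upd /= /valid /=; slv; lia.
  eapply tri_seq; asn; first by rewrite /= /upd /= /valid /=; slv; lia.
  rewrite [ev _ _ _]/= [ev _ _ _]/= [ev _ _ _]/= [ev _ _ _]/= /upd /= ha0 a0_u // a0_v // a0_w // a0_g //.
  set v1 := (fun y : nat => _).
  eapply tri_seq; eapply (@tri_call _ _ _ _ _ (fun v' _ => v' 32 = minn (eu e) (ev' e) /\ v' 33 = maxn (eu e) (ev' e))).
    eapply tri_if; first by [].
    - rewrite [ev _ _ _]/= /v1 /= eqb0 negbK => lt; eapply tri_le; first apply: tri_nop; first by rewrite /=; lia.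
      exact: (leq_addr 40).
    - rewrite [ev _ _ _]/= /v1 /= => /eqP; rewrite eqb0 -leqNgt => ge.
      eapply tri_le; first (eapply tri_seq; asn; [by []|eapply tri_seq; asn; [by []|asn; [by []|]]]).
        by rewrite /upd /=; lia.
      by [].
  move=> v2 a2 [e32 e33] [fv fa].
  have e2 : v2 2 = n by rewrite fv.
  have e35 : v2 35 = ga e by rewrite fv.
  have e34 : v2 34 = wt e by rewrite fv.
  have e30 : v2 30 = e by rewrite fv.
  have e7 : v2 7 = wmx e by rewrite fv.
  have eA1 : a2 1 = a 1 by rewrite fa.
  have eA0 : a2 0 = a0 by rewrite fa.
  eapply tri_seq; asn; first by rewrite /= e2 e32 e33 e35; slv.
  rewrite [ev _ _ _]/= e2 e32 e33 e35 -/(slot n T2 _ _ _) -/(ecls e).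
  eapply tri_seq; asn; first by rewrite /= /upd /=; slv.
  rewrite [ev _ _ _]/= /upd /= eA1; set v3 := (fun y : nat => _).
  eapply tri_seq; eapply (@tri_call _ _ _ _ _ (fun _ a' => gspec e.+1 (a' 1))).
    (* Only the slot of [e] can change. Either [e] becomes its lightest edge, or an earlier edge is
       there already and is no heavier. *)
    have keepg : forall g', (forall d, d != ecls e -> g' d = a 1 d) ->
        ((g' (ecls e) = e.+1 /\ forall e', e' < e -> ecls e' = ecls e -> wt e <= wt e') \/
         (exists e', [/\ e' < e, g' (ecls e) = e'.+1, ecls e' = ecls e, wt e' <= wt e &
            forall e2, e2 < e -> ecls e2 = ecls e -> wt e' <= wt e2])) -> gspec e.+1 g'.
      move=> g' k1 k2 d hd; case: (altP (d =P ecls e)) => [->|nd].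
        right; case: k2 => [[g1 g2]|[e' [g1 g2 g3 g4 g5]]].
          exists e; split=> // e'; rewrite ltnS leq_eqVlt => /orP[/eqP->//|]; exact: g2.
        exists e'; split=> //; first by lia.
        by move=> e2'; rewrite ltnS leq_eqVlt => /orP[/eqP->//|]; exact: g5.
      rewrite k1 //; case: (hg d hd) => [[z1 z2]|[e' [z1 z2 z3 z4]]].
        left; split=> // e'; rewrite ltnS leq_eqVlt => /orP[/eqP->|]; last exact: z2.
        by rewrite eq_sym.
      right; exists e'; split=> //; first by lia.
      move=> e2'; rewrite ltnS leq_eqVlt => /orP[/eqP->|]; last exact: z4.
      by move=> ee; rewrite ee eqxx in nd.
    eapply tri_if; first by [].
    - rewrite [ev _ _ _]/= /v3 /= => nz.
      case: (hg _ hc) => [[z1 _]|[e' [z1 z2 z3 z4]]]; first by rewrite z1 in nz.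
      have e4 : a2 0 (4 * a 1 (ecls e) + 1) = wt e'.
        by rewrite eA0 z2 -a0_w; [congr a0|]; lia.
      eapply tri_if.
      + by rewrite /= /valid /= z2; slv; lia.
      + rewrite [ev _ _ _]/= e4 /= e34 eqb0 negbK => lt.
        eapply tri_put.
        * by [].
        * by rewrite /= e30; slv; lia.
        * by rewrite /=; slv.
        rewrite /= e30 addn1 /upd2 /= eA1; apply: keepg; first by move=> d nd; rewrite /upd (negbTE nd).
        left; rewrite /upd eqxx; split=> // e2' l2 c2; apply: leq_trans (ltnW lt) _; exact: z4.
      + rewrite [ev _ _ _]/= e4 /= e34 => /eqP; rewrite eqb0 -leqNgt => ge.
        eapply tri_le; first apply: tri_nop.
          by rewrite eA1; apply: keepg => //; right; exists e'.
        by [].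
    - rewrite [ev _ _ _]/= /v3 /= => z.
      case: (hg _ hc) => [[z1 z2]|[e' [_ z2 _ _]]]; last by rewrite z2 in z.
      eapply tri_le; first eapply tri_put.
      + by [].
      + by rewrite /= e30; slv; lia.
      + by rewrite /=; slv.
      + rewrite /= e30 addn1 /upd2 /= eA1; apply: keepg; first by move=> d nd; rewrite /upd (negbTE nd).
        left; rewrite /upd eqxx; split=> // e2' l2 c2.
        by have := z2 e2' l2; rewrite c2 eqxx.
      by rewrite /=; lia.
  move=> v4 a4 hg4 [fv4 fa4].
  have f7 : v4 7 = wmx e by rewrite fv4.
  have f34 : v4 34 = wt e by rewrite fv4.
  have wS : wmx e.+1 = maxn (wmx e) (wt e) by rewrite /wmx big_ord_recr.
  eapply tri_if; first by [].
  - rewrite [ev _ _ _]/= f7 f34 eqb0 negbK => lt; asn; first by [].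
    by rewrite /upd /= f34 wS; split=> //; lia.
  - rewrite [ev _ _ _]/= f7 f34 => /eqP; rewrite eqb0 -leqNgt => ge.
    eapply tri_le; first apply: tri_nop; first by rewrite f7 wS; split=> //; lia.
    by [].
by rewrite /= /acost /=; lia.
Qed.

Definition pread :=
  vn ::= G 0 (N 0);; vne ::= G 0 (N 1);; va ::= G 0 (N 2);;
  vh ::= V vn / N 2;; vE ::= V vn * V vn * N T2;; vwm ::= N 0;;
  SFor 30 (V vne) pedge.

Lemma tri_read v a : a 0 = a0 -> (forall i, a 1 i = 0) ->
  tri pread (100 + ne * 310) (fun v' a' => [/\ v' vn = n, v' vne = ne, v' va = al, v' vh = n %/ 2
    & v' vE = n * n * T2] /\ v' vwm = wmx ne /\ gspec ne (a' 1)) v a.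
Proof.
move=> ha0 ha1.
have nnZ : n * n < Z by apply: leq_ltn_trans nnT_lt; rewrite leq_pmulr.
eapply tri_le.
  eapply tri_seq; asn; first by rewrite /= /valid /=; slv; lia.
  eapply tri_seq; asn; first by rewrite /= /valid /=; slv; lia.
  eapply tri_seq; asn; first by rewrite /= /valid /=; slv; lia.
  rewrite [ev _ _ _]/= [ev _ _ _]/= [ev _ _ _]/= ha0 a0_0 a0_1 a0_2.
  eapply tri_seq; asn; first by slv.
  eapply tri_seq; asn.
    rewrite /= /upd /=; have nZ : n < Z by nia.
    by slv.
  eapply tri_seq; asn; first by slv.
  rewrite [ev _ _ _]/= [ev _ _ _]/= [ev _ _ _]/= /upd /=; set v1 := (fun y : nat => _).
  eapply (@tri_for _ _ _ ne _ _ _ (fun i v' a' => v' vwm = wmx i /\ gspec i (a' 1))).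
  - by [].
  - by [].
  - by [].
  - by [].
  - rewrite /upd /= /wmx big_ord0; split=> // d _; left; split=> //.
  - move=> i v2 a2 hi v2i hf [i1 i2].
    have e2 : v2 2 = n by rewrite hf.1.
    have eA : a2 0 = a0 by rewrite hf.2.
    by apply: tri_conseq (tri_edge hi v2i e2 i1 eA i2) (leqnn _) _.
  - move=> v2 a2 _ hf [i1 i2]; split=> //; by split; rewrite hf.1.
by rewrite /= /acost /=; lia.
Qed.

(** Decides whether E^h exceeds w_max. The power itself need not fit in a word, so multiplication
    stops as soon as w_max is exceeded. *)
Definition pprod :=
  vwm1 ::= V vwm + (V vwm < N 1);; vprod ::= N 1;;
  SFor 30 (V vh) (SIf (V vprod < V vwm1 + N 1) (vprod ::= V vprod * V vE) SNop).

Lemma tri_prod h E wm v a : v vh = h -> v vE = E -> v vwm = wm -> h = 0 \/ 0 < E -> E < Z -> wm.+1 < Z ->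
  tri pprod (50 + h * 70) (fun v' _ => v' vwm1 = maxn 1 wm /\
    ((v' vprod <= maxn 1 wm /\ v' vprod = E ^ h) \/
     (maxn 1 wm < v' vprod <= E ^ h))) v a.
Proof.
move=> hh hE hwm E0 EZ wZ.
eapply tri_le.
  eapply tri_seq; asn.
    rewrite /= hwm; have := leq_b1 (wm < 1) => hb.
    by slv.
  rewrite [ev _ _ _]/= hwm (_ : wm + (wm < 1) = maxn 1 wm); last by case: (wm) => //= k; lia.
  eapply tri_seq; asn; first by slv.
  rewrite [ev _ _ _]/=; set v1 := upd _ _ _.
  eapply (@tri_for _ _ _ h _ _ _ (fun i v' a' => (v' vprod <= maxn 1 wm /\ v' vprod = E ^ i) \/
     (maxn 1 wm < v' vprod <= E ^ i))).
  - by [].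
  - by [].
  - by [].
  - by [].
  - by left; rewrite /upd /= /v1 /upd /=; split=> //; lia.
  - move=> i v2 a2 hi v2i hf hI.
    have e6 : v2 6 = E by rewrite hf.1.
    have e18 : v2 18 = maxn 1 wm by rewrite hf.1.
    have {}E0 : 0 < E by case: E0 hi => // ->.
    have eS : E ^ i <= E ^ i.+1 by rewrite leq_pexp2l.
    eapply tri_if; first by rewrite /= e18; slv.
    + rewrite [ev _ _ _]/= e18 eqb0 negbK addn1 ltnS => le.
      case: hI => [[i1 i2]|]; last by lia.
      asn; first by rewrite /= e6; slv.
      rewrite /upd /= e6 i2 -expnSr.
      by case: (leqP (E ^ i.+1) (maxn 1 wm)) => hh'; [left|right; rewrite leqnn].
    + rewrite [ev _ _ _]/= e18 => /eqP; rewrite eqb0 addn1 ltnS -ltnNge => ge.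
      eapply tri_le; first apply: tri_nop.
        right; rewrite /upd /=; case: hI => [[i1 i2]|]; first by lia.
        by case/andP=> h1 h2; rewrite h1 (leq_trans h2).
      by [].
  - move=> v2 a2 _ hf hI; split=> //; by rewrite hf.1.
by rewrite /=; lia.
Qed.

End Setup.

(** * Random numbers and a prime *)

Fixpoint last_prime Q i :=
  if i is j.+1 then if (Q < j) && prime j then j else last_prime Q j else 0.

Lemma last_primeP Q i : (exists2 p, prime p & Q < p < i) ->
  prime (last_prime Q i) && (Q < last_prime Q i < i).
Proof.
elim: i => [|i IH] /= [p p_pr hp]; first by lia.
case: ifP => [/andP[-> ->]|ni]; first by rewrite ltnS leqnn.
suff /andP[-> /andP[-> hlt]] : prime (last_prime Q i) && (Q < last_prime Q i < i) by rewrite ltnS ltnW.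
apply: IH; exists p => //; case: (eqVneq p i) => [e|ne]; last by lia.
by move: ni; rewrite -e p_pr andbT; lia.
Qed.

Section Randomness.
Variables (W Bs : nat) (w : nat -> bool) (Z : nat).
Hypothesis Z_W : Zbound W Z.
Hypothesis Bs_lt : Bs < Z.
Local Notation tri := (tri W Bs w).
Variables (K n h E wm : nat).
Hypothesis K_gt0 : 0 < K.
(** A lower bound for the range 2^q of the random weights. The cube pays for the degree n/2 and the
    roughly n^2 tests, [wm.+1] makes 2^q exceed the order of the finite difference, and [K] carries
    the error probability and the factor 2^t. *)
Definition Yb := K * n.+1 * n.+1 * n.+1 * wm.+1.
Definition primes_to q := 2 * (2 ^ q * (2 * q + 8)).
Hypothesis YZ : 2 * Yb < Z.
Hypothesis XZ : forall q, 2 ^ q < 2 * Yb -> 4 * primes_to q + 8 < Z.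

Definition pQ :=
  16 ::= N K * (V vn + N 1);; 16 ::= V 16 * (V vn + N 1);; 16 ::= V 16 * (V vn + N 1);;
  16 ::= V 16 * (V vwm + N 1);; vQ ::= N 1;; vq ::= N 0;;
  SFor 30 (V 16) (SIf (V vQ < V 16) (vQ ::= N 2 * V vQ;; vq ::= V vq + N 1) SNop);;
  vlg ::= N 2 * V vq + N 6;; vX ::= N 2 * (V vQ * (N 2 * V vq + N 8)).

Lemma tri_Q v a : v vn = n -> v vwm = wm ->
  tri pQ (200 + Yb * 70) (fun v' _ => exists q, [/\ Yb <= 2 ^ q, 2 ^ q < 2 * Yb,
    v' vQ = 2 ^ q, v' vq = q & v' vlg = 2 * q + 6] /\ v' vX = primes_to q) v a.
Proof.
move=> h2 h7.
have y4 : Yb < Z by lia.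
have y3 : K * n.+1 * n.+1 * n.+1 < Z by apply: leq_ltn_trans y4; rewrite leq_pmulr.
have y2 : K * n.+1 * n.+1 < Z by apply: leq_ltn_trans y3; rewrite leq_pmulr.
have y1 : K * n.+1 < Z by apply: leq_ltn_trans y2; rewrite leq_pmulr.
have y0 : n.+1 < Z by apply: leq_ltn_trans y1; rewrite leq_pmull.
have yK : K < Z by apply: leq_ltn_trans y1; rewrite leq_pmulr.
have yw : wm.+1 < Z by apply: leq_ltn_trans y4; rewrite leq_pmull // !muln_gt0 K_gt0.
have Y0 : 0 < Yb by rewrite !muln_gt0 K_gt0.
eapply tri_le.
  eapply tri_seq; asn; first by rewrite /= h2; slv.
  rewrite [ev _ _ _]/= h2 addn1.
  eapply tri_seq; asn; first by rewrite /= /upd /= h2; slv.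
  rewrite [ev _ _ _]/= /upd /= h2 addn1.
  eapply tri_seq; asn; first by rewrite /= h2; slv.
  rewrite [ev _ _ _]/= h2 addn1.
  eapply tri_seq; asn; first by rewrite /= /upd /= h7; slv.
  rewrite [ev _ _ _]/= /upd /= h7 addn1 -/Yb.
  eapply tri_seq; asn; first by slv.
  eapply tri_seq; asn; first by slv.
  rewrite [ev _ _ _]/= [ev _ _ _]/=; set v0 := upd _ _ _.
  eapply tri_seq; eapply (@tri_for _ _ _ Yb _ _ _ (fun i v' a' =>
    [/\ v' vQ = 2 ^ v' vq, v' vQ < 2 * Yb & (Yb <= v' vQ) || (v' vq == i)])).
  - by rewrite /v0 /= /upd /=.
  - by [].
  - by [].
  - by [].
  - by rewrite /upd /v0 /= /upd /=; split=> //; [lia|rewrite orbT].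
  - move=> i v1 a1 hi v1i hf [i1 i2 i3].
    have e16 : v1 16 = Yb by rewrite hf.1 // /v0 /upd.
    have v9 : v1 vq < Z by apply: ltn_trans (ltn_expl _ (isT : 1 < 2)) _; rewrite -i1; lia.
    eapply tri_if; first by [].
    + rewrite [ev _ _ _]/= e16 eqb0 negbK => lt.
      eapply tri_seq; asn; first by rewrite /=; slv.
      asn; first by rewrite /upd /=; slv.
      rewrite /upd /= addn1 expnS -i1; split=> //; first by rewrite ltn_pmul2l.
      by move: i3; rewrite leqNgt lt /= => /eqP->; rewrite eqxx orbT.
    + rewrite [ev _ _ _]/= e16 => /eqP; rewrite eqb0 -leqNgt => ge.
      eapply tri_le; first apply: tri_nop.
        by rewrite /upd /= ge.
      by [].
  - move=> v1 a1 _ hf [i1 i2 i3].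
    have ge : Yb <= v1 vQ.
      case/orP: i3 => // /eqP i3; rewrite i1 i3; exact: ltnW (ltn_expl _ _).
    have v9 : v1 vq < Z by apply: ltn_trans (ltn_expl _ (isT : 1 < 2)) _; rewrite -i1; lia.
    have := XZ (_ : 2 ^ v1 vq < 2 * Yb); rewrite -i1 => /(_ i2); rewrite /primes_to -i1.
    move=> hX.
    have b1 : v1 vQ * (2 * v1 vq + 8) < Z by lia.
    have b2 : 2 * v1 vq + 8 < Z by apply: leq_ltn_trans b1; rewrite leq_pmull //; lia.
    eapply tri_seq; asn; first by rewrite /=; slv.
    rewrite [ev _ _ _]/=; set v2 := upd _ _ _.
    asn.
      rewrite /v2 /= /upd /=; slv.
    rewrite /v2 /upd /=; exists (v1 vq); rewrite -i1.
    by [].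
by rewrite /=; lia.
Qed.

Variable q : nat.
Hypothesis q_lt : 2 ^ q < 2 * Yb.

Definition passem :=
  SFor 31 (V vE) (32 ::= N 0;;
    SFor 33 (V vq) (32 ::= N 2 * V 32 + G 2 (V 31 * V vq + V 33));;
    SPut 3 (V 31) (V 32)).

Lemma tri_assem (b : nat -> nat) v a : v vE = E -> v vq = q -> E * q < Z -> E < Z ->
  (forall i, i < E * q -> b i <= 1) -> (forall i, i < E * q -> a 2 i = b i) ->
  tri passem (20 + E * (70 + q * 60)) (fun _ a' =>
    forall d, d < E -> a' 3 d = horner (fun i => b (d * q + i)) q) v a.
Proof.
move=> hE hq EqZ EZ hb ha.
have qZ : q < Z by have := ltn_expl q (isT : 1 < 2); lia.
eapply tri_le.
  eapply (@tri_for _ _ _ E _ _ _ (fun i v' a' =>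
    forall d, d < i -> a' 3 d = horner (fun i => b (d * q + i)) q)).
  - by rewrite /=.
  - by [].
  - by [].
  - by [].
  - by [].
  - move=> i v1 a1 hi v1i hf hI.
    have e9 : v1 9 = q by rewrite hf.1.
    have eA : a1 2 = a 2 by rewrite hf.2.
    have iq : i * q + q <= E * q by rewrite -mulSnr leq_mul2r hi orbT.
    have iqZ : i * q < Z by lia.
    eapply tri_seq; asn; first by slv.
    rewrite [ev _ _ _]/=; set v2 := upd _ _ _.
    eapply tri_seq; eapply (@tri_for _ _ _ q _ _ _ (fun j v' a' =>
      v' 32 = horner (fun l => b (i * q + l)) j)).
    + by rewrite /= /v2 /upd.
    + by [].
    + by [].
    + by [].
    + by [].
    + move=> j v3 a3 hj v3j hf3 h32.
      have e31 : v3 31 = i by rewrite hf3.1 // /v2 /upd.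
      have e9' : v3 9 = q by rewrite hf3.1 // /v2 /upd.
      have eA' : a3 2 = a 2 by rewrite hf3.2.
      have b1 : b (i * q + j) <= 1 by apply: hb; lia.
      have b2 : horner (fun l => b (i * q + l)) j < 2 ^ j.
        by apply: horner_lt => l hl; apply: hb; lia.
      have b3 : 2 ^ j < 2 ^ q by rewrite ltn_exp2l.
      asn; first by rewrite /= e31 e9' v3j h32 eA' ha; [slv|]; lia.
      by rewrite /upd /= h32 e31 e9' v3j eA' ha //; lia.
    + move=> v3 a3 _ hf3 h32.
      have e31 : v3 31 = i by rewrite hf3.1 // /v2 /upd.
      eapply tri_put.
      * by [].
      * by [].
      * by rewrite /= e31; slv.
      move=> d; rewrite ltnS leq_eqVlt /= e31 h32 /upd2 /= /upd => /orP[/eqP->|hd]; first by rewrite eqxx.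
      by rewrite ifF ?hf3.2 // ?hI //; apply/negbTE; lia.
  - by [].
by rewrite /= /acost /=; lia.
Qed.

(** * Sieving for the prime *)

Definition psieve :=
  SFor 31 (V vX) (SFor 32 (V vX / (V 31 + N 2)) (SPut 6 ((V 31 + N 2) * (V 32 + N 2)) (N 1))).

Lemma tri_sieve X L v a : v vX = X -> 4 * X + 8 < Z -> X < 2 ^ L -> (forall i, a 6 i = 0) ->
  tri psieve (100 + X * 50 + L * X * 60) (fun _ a' => forall x, 1 < x <= X ->
    (a' 6 x == 0) = prime x) v a.
Proof.
move=> hX bX XL ha.
eapply tri_le.
  eapply (@tri_for_sum _ _ _ _ _ _ (fun i v' a' => (forall x, a' 6 x != 0 -> ~~ prime x) /\
    forall i' j, i' < i -> j < X %/ i'.+2 -> a' 6 (i'.+2 * j.+2) != 0) (fun i => 40 + X %/ i.+2 * 60)).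
  - by [].
  - by [].
  - by [].
  - by split=> // x; rewrite ha.
  - move=> i v1 a1; rewrite [ev _ _ _]/= hX => hi v1i hf [i1 i2].
    have e11 : v1 11 = X by rewrite hf.1.
    eapply tri_le.
      eapply (@tri_for _ _ _ (X %/ i.+2) _ _ _ (fun j v' a' => [/\ forall x, a' 6 x != 0 -> ~~ prime x,
         forall i' j, i' < i -> j < X %/ i'.+2 -> a' 6 (i'.+2 * j.+2) != 0 &
         forall j', j' < j -> a' 6 (i.+2 * j'.+2) != 0])).
      + by rewrite /= e11 v1i addn2.
      + by rewrite /= v1i; slv.
      + by [].
      + by [].
      + by [].
      + move=> j v2 a2 hj v2j hf2 [j1 j2 j3].
        have e31 : v2 31 = i by rewrite hf2.1.
        have bj : i.+2 * j.+1 <= X by have := leq_trunc_div X i.+2; nia.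
        have bj2 : i.+2 * j.+2 < Z by rewrite mulnS; lia.
        have bj3 : j < Z by nia.
        eapply tri_put.
        * by rewrite /= e31 v2j; slv.
        * by slv.
        * by rewrite /= e31 v2j !addn2; slv.
        rewrite /= e31 v2j !addn2 /upd2 /= /upd; split=> [x|i' j' hi' hj'|j'].
        * case: ifP => [/eqP-> _|_]; last exact: j1.
          by apply/negP => /primeP[_ /(_ i.+2 (dvdn_mulr _ (dvdnn _)))] /orP[/eqP|/eqP] //; nia.
        * by case: ifP => // _; apply: j2.
        * rewrite ltnS leq_eqVlt => /orP[/eqP->|hj']; first by rewrite eqxx.
          by case: ifP => // _; apply: j3.
      + move=> v2 a2 _ hf2 [j1 j2 j3]; split=> // i' j'; rewrite ltnS leq_eqVlt => /orP[/eqP->|].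
          exact: j3.
        exact: j2.
    by rewrite /= /acost /=; move: (X %/ _) => z; lia.
  - move=> v1 a1 _ hf [i1 i2] x /andP[x1 xX].
    apply/idP/idP => [/eqP z|px]; last by apply: contraTT px; apply: i1.
    (* A composite x is the product of its smallest prime factor and the cofactor; both are at least
       2, and the pair was visited by the two loops, whose counters are shifted by 2. *)
    case: (boolP (prime x)) => // npx.
    have d0 := pdiv_dvd x; have d1 : 1 < pdiv x by rewrite (prime_gt1 (pdiv_prime x1)).
    have /eqP ex := divnK d0.
    have d2 : 1 < x %/ pdiv x.
      case: (ltnP 1 (x %/ pdiv x)) => // le; suff ep : x = pdiv x by rewrite ep pdiv_prime in npx.
      by case: (x %/ pdiv x) le ex => [|[]] //= _ /eqP; lia.
    have lex : pdiv x <= x by apply: dvdn_leq => //; lia.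
    move: z d1 d2 lex ex; case: (pdiv x) => [|[|i']] //; case: (x %/ _) => [|[|j']] // z _ _ lex /eqP ex.
    have hi : i' < ev v a (V vX) by rewrite /= hX; lia.
    have hj : j' < X %/ i'.+2 by rewrite leq_divRL //; nia.
    by have := i2 i' j' hi hj; rewrite mulnC ex z.
rewrite [ev _ _ _]/= hX.
have -> : \sum_(i < X) (40 + X %/ i.+2 * 60 + 7) = X * 47 + 60 * \sum_(i < X) X %/ i.+2.
  rewrite big_distrr -[in X * 47](card_ord X) -sum_nat_const -big_split /=.
  by apply: eq_bigr => i _; lia.
have : \sum_(i < X) X %/ i.+2 <= L * X; last by rewrite /=; nia.
apply: leq_trans (harmonic X L).
rewrite -!(big_mkord xpredT (fun i => X %/ i.+1)) -(big_mkord xpredT (fun i => X %/ i.+2)).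
rewrite [leqRHS](big_cat_nat (n := X)) //=; last by lia.
by apply: leq_trans (leq_addr _ _); apply: leq_sum => i _; apply: leq_div2l.
Qed.

Definition pfind :=
  vp ::= N 0;;
  SFor 31 (V vX + N 1) (SIf ((V vQ < V 31) * (G 6 (V 31) < N 1)) (vp ::= V 31) SNop).

Lemma tri_find Q X v a : v vQ = Q -> v vX = X -> 4 * X + 8 < Z -> 1 < Q ->
  (forall x, 1 < x <= X -> (a 6 x == 0) = prime x) ->
  tri pfind (60 + X.+1 * 60) (fun v' _ => v' vp = last_prime Q X.+1) v a.
Proof.
move=> hQ hX bX Q1 ha.
eapply tri_le.
  eapply tri_seq; asn; first by slv.
  eapply (@tri_for _ _ _ X.+1 _ _ _ (fun i v' _ => v' vp = last_prime Q i)).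
  - by rewrite /= /upd /= hX addn1.
  - by rewrite /= /upd /= hX; slv.
  - by [].
  - by [].
  - by [].
  - move=> i v1 a1 hi v1i hf hI.
    have e8 : v1 8 = Q by rewrite hf.1.
    have eA : a1 6 = a 6 by rewrite hf.2.
    have hb x y : ((x : bool) * (y : bool))%N = (x && y) by case: x; case: y.
    have cE : (Q < i) && (a 6 i < 1) = (Q < i) && prime i.
      by case: (ltnP Q i) => //= lt; rewrite ltnS leqn0 ha; lia.
    eapply tri_if; first by rewrite /= v1i; repeat split; slv; rewrite hb; slv; case: (_ && _); slv.
    + rewrite [ev _ _ _]/= e8 eA v1i hb cE eqb0 negbK => c.
      by asn; [|rewrite /upd /= v1i c].
    + rewrite [ev _ _ _]/= e8 eA v1i hb cE => /eqP; rewrite eqb0 => /negbTE c.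
      by eapply tri_le; [apply: tri_nop; rewrite /upd /= c|].
  - by [].
by rewrite /= /acost /=; lia.
Qed.

End Randomness.

(** * Exhaustive search *)

Section BruteForce.
Variables (W Bs : nat) (w : nat -> bool) (Z : nat).
Hypothesis Z_W : Zbound W Z.
Hypothesis Bs_lt : Bs < Z.
Local Notation tri := (tri W Bs w).
Variables (n h T2 al B wm : nat) (a0 g : nat -> nat) (xr : nat -> nat -> nat).
Local Notation E := (n * n * T2).

Definition dig c i := c %/ E ^ i %% E.
Definition du d := d %/ T2 %/ n.
Definition dv d := (d %/ T2) %% n.
Definition digs c i := [seq dig c j | j <- iota 0 i].
Definition dends ds := flatten [seq [:: du d; dv d] | d <- ds].
Definition dok ds := all (fun d => g d != 0) ds && uniq (dends ds).
Definition dxr ds := foldl (fun x d => xr x (d %% T2)) 0 ds.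
Definition dwt ds := \sum_(d <- ds) a0 (4 * g d + 1).
Definition valid_code c := dok (digs c h) && (dxr (digs c h) == al).

Hypothesis n_gt0 : 0 < n.
Hypothesis T2_gt0 : 0 < T2.
Hypothesis E_lt : E < Z.
Hypothesis TT_lt : T2 * T2 < Z.
Hypothesis B_lt : B.+1 < Z.
Hypothesis wm_lt : h.+1 * wm.+1 < Z.
Hypothesis h_Bs : h < Bs.
Hypothesis xr_lt : forall x y, xr x y < T2.
Hypothesis g_ok : forall d, d < E -> g d != 0 -> 4 * g d + 1 < Bs /\ a0 (4 * g d + 1) <= wm.
Hypothesis g_uv : forall d, d < E -> g d != 0 -> du d != dv d.

(* A vertex is covered by the current candidate [c] iff its mark is [c + 1], so the marks
   need not be erased. *)
Definition pdigit :=
  46 ::= V 41 mod V vE;; 41 ::= V 41 / V vE;; 47 ::= G 1 (V 46);;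
  SIf (V 44 * V 47) (
    49 ::= V 46 / N T2 / V vn;; 39 ::= (V 46 / N T2) mod V vn;;
    SIf ((G 8 (V 49) < V 40 + N 1) * (G 8 (V 39) < V 40 + N 1)) (
      SPut 8 (V 49) (V 40 + N 1);; SPut 8 (V 39) (V 40 + N 1);;
      42 ::= G 7 (V 42 * N T2 + V 46 mod N T2);; 43 ::= V 43 + G 0 (N 4 * V 47 + N 1))
      (44 ::= N 0))
    (44 ::= N 0).

Definition bvars (v : nat -> nat) (a : nat -> nat -> nat) :=
  [/\ v vn = n, v vh = h, v vE = E & v va = al] /\
  [/\ a 0 = a0, a 1 =1 g & forall x y, x < T2 -> y < T2 -> a 7 (x * T2 + y) = xr x y].

Lemma bvars_frame ks v v' a a' xs : framed xs ks v a v' a' ->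
  [&& vn \notin xs, vh \notin xs, vE \notin xs & va \notin xs] ->
  [&& 0 \notin ks, 1 \notin ks & 7 \notin ks] -> bvars v a -> bvars v' a'.
Proof.
move=> [hf hg]; case/and4P=> h0 h1 h3 h5; case/and3P=> k0 k1 k3 [[e0 e1 e3 e5] [e6 e7 e8]].
by do 2!split; rewrite ?hf ?hg //; move=> *; rewrite ?hg ?e8.
Qed.

(** Once [dok] fails, sums and marks are no longer tracked. That no mark exceeds [c.+1] is still
    known, and it suffices for the next candidate, whose own mark is larger. *)
Definition dinv c ds i (v : nat -> nat) (a : nat -> nat -> nat) :=
  [/\ v 41 = c %/ E ^ i, v 44 = dok ds, forall x, a 8 x <= c.+1 &
   dok ds -> [/\ v 42 = dxr ds, v 43 = dwt ds & forall x, (a 8 x == c.+1) = (x \in dends ds)]].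

Lemma digs_S c i : digs c i.+1 = rcons (digs c i) (dig c i).
Proof. by rewrite /digs -addn1 iotaD map_cat cats1. Qed.

Lemma dends_rcons ds d : dends (rcons ds d) = dends ds ++ [:: du d; dv d].
Proof. by rewrite /dends map_rcons flatten_rcons. Qed.

Lemma dok_rcons ds d : d < E ->
  dok (rcons ds d) = [&& dok ds, g d != 0, du d \notin dends ds & dv d \notin dends ds].
Proof.
move=> dE; rewrite /dok all_rcons dends_rcons cat_uniq /= inE orbF.
case: (altP (g d =P 0)) => //= [_|g0]; first by rewrite andbF.
by rewrite negb_or (g_uv dE g0) /= !andbT -!andbA.
Qed.

Lemma dxr_lt ds : dxr ds < T2.
Proof.
by elim/last_ind: ds => //= ds d _; rewrite /dxr foldl_rcons.
Qed.

Lemma dwt_le c i : dok (digs c i) -> dwt (digs c i) <= i * wm.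
Proof.
elim: i => [|i IH]; first by rewrite /dwt big_nil.
have dE : dig c i < E by rewrite ltn_mod !muln_gt0 n_gt0.
rewrite digs_S dok_rcons // /dwt -cats1 big_cat big_seq1 /= => /and4P[hd g0 _ _]; have := IH hd.
by have [_] := g_ok dE g0; rewrite /dwt mulSn; lia.
Qed.

Lemma tri_digit c i v a : bvars v a -> i < h -> c < B -> v 40 = c -> dinv c (digs c i) i v a ->
  tri pdigit 300 (fun v' a' => dinv c (digs c i.+1) i.+1 v' a') v a.
Proof.
move=> [[h2 h5 h6 h4] [r0 r1 r7]] hi hc h40 [h41 h44 st hok].
have E0 : 0 < E by rewrite !muln_gt0 n_gt0.
have dE : dig c i < E by rewrite ltn_mod.
rewrite digs_S /dinv dok_rcons //; set d := dig c i in dE *; set ds := digs c i in h44 hok *.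
have TZ : T2 < Z by apply: leq_ltn_trans TT_lt; rewrite leq_pmulr.
have nZ : n < Z by apply: leq_ltn_trans E_lt; rewrite -mulnA leq_pmulr // muln_gt0 n_gt0.
have gB : g d < Z by case: (eqVneq (g d) 0) => [->|/(g_ok dE)[]]; lia.
have ub : du d < n by rewrite ltn_divLR // ltn_divLR // -mulnA mulnC // mulnA.
have vb : dv d < n by rewrite ltn_mod.
have hb x y : ((x : bool) * (y : bool))%N = (x && y) by case: x; case: y.
eapply tri_le.
  eapply tri_seq; asn; first by slv.
  eapply tri_seq; asn; first by slv.
  rewrite [ev _ _ _]/= [ev _ _ _]/= /upd /= h6 h41 -/(dig c i) -/d -divnMA -expnSr.
  eapply tri_seq; asn; first by rewrite /=; slv.
  rewrite [ev _ _ _]/= r1 /upd /=; set v1 := (fun y : nat => _).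
  have v1_44 : v1 44 = dok ds by [].
  eapply tri_if.
  - rewrite /= v1_44 /v1 /=; repeat split; have := leq_b1 (dok ds) => hbb; by eapply mulW; [eassumption|lia|lia].
  - rewrite [ev _ _ _]/= v1_44 /v1 /= -/v1 muln_eq0 negb_or eqb0 negbK => /andP[dk g0].
    have [h42 h43 hst] := hok dk; have [g1 g2] := g_ok dE g0.
    eapply tri_seq; asn; first by slv.
    eapply tri_seq; asn; first by slv.
    rewrite [ev _ _ _]/= [ev _ _ _]/= /upd /v1 /= h2 -/(du d) -/(dv d); set v2 := (fun y : nat => _).
    have s1 x : (a 8 x < c + 1) = (x \notin dends ds).
      by rewrite -hst addn1 ltn_neqAle st andbT.
    eapply tri_if.
    + rewrite /= /v2 /= h40 !s1 hb; slv.
    + rewrite [ev _ _ _]/= /v2 /= h40 !s1 hb -/v2 eqb0 negbK => /andP[nu nv].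
      eapply tri_seq; eapply tri_put.
      * by [].
      * by rewrite /= /v2 /= h40; slv.
      * by rewrite /=; slv.
      eapply tri_seq; eapply tri_put.
      * by [].
      * by rewrite /= /v2 /= h40; slv.
      * by rewrite /=; slv.
      rewrite [ev _ _ (V 49)]/= [ev _ _ (V 39)]/= ![ev _ _ (_ + _)%ex]/= /v2 /= h40 -/v2.
      have xb := dxr_lt ds; have gb : d %% T2 < T2 by rewrite ltn_mod.
      have ib := idx_lt xb gb.
      have mb : dxr ds * T2 < Z by lia.
      eapply tri_seq; asn.
        by rewrite /= /v2 /= h42; slv.
      rewrite [ev _ _ _]/= /v2 /= h42 /upd2 /= r7 // -/v2.
      have wb := dwt_le dk.
      have wb2 : dwt ds + a0 (4 * g d + 1) < Z.
        apply: leq_ltn_trans wm_lt; apply: leq_trans (leq_add wb g2) _.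
        by rewrite -mulSnr leq_mul // leqW.
      asn.
        rewrite /= /upd /v2 /= h43 r0; slv.
      rewrite /= /upd /v2 /= h43 r0 dk g0 nu nv /=; split=> //; first by rewrite h44 dk.
        by move=> x; case: ifP => _; [lia|case: ifP => _; [lia|]].
      move=> _; rewrite /dxr /dwt foldl_rcons -cats1 big_cat big_seq1 /= cats1 -/(dxr ds) -/(dwt ds); split=> // x.
      rewrite dends_rcons mem_cat !inE -hst addn1.
      by case: (x == dv d); case: (x == du d); rewrite ?eqxx ?orbT ?orbF.
    + rewrite [ev _ _ _]/= /v2 /= h40 !s1 hb -/v2 => /eqP; rewrite eqb0 => nb.
      eapply tri_le; first asn; first by slv.
        rewrite /= /upd /v2 /= (negbTE nb) !andbF; split=> //.
      by rewrite /= /acost /=; lia.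
  - rewrite [ev _ _ _]/= v1_44 /v1 /= -/v1 => /eqP; rewrite muln_eq0 eqb0 => nb.
    have nb' : dok ds && (g d != 0) = false by apply/negbTE; rewrite negb_and negbK.
    eapply tri_le; first asn; first by slv.
      by rewrite /= /upd /v1 /= andbA nb' /=; split.
    by rewrite /= /acost /=; lia.
by rewrite /= /acost /=; lia.
Qed.

Definition pcode :=
  41 ::= V 40;; 42 ::= N 0;; 43 ::= N 0;; 44 ::= N 1;;
  SFor 45 (V vh) pdigit;;
  SIf (V 44) (SIf ((V 42 < V va) + (V va < V 42)) SNop
    (SIf (V 48) (SIf (V 43 + N 1 < V 48) (48 ::= V 43 + N 1;; 38 ::= V 40) SNop)
      (48 ::= V 43 + N 1;; 38 ::= V 40))) SNop.

(** Variable 48 holds one more than the least weight so far, so that 0 can mean that no candidate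
    was valid. *)
Definition best c (v : nat -> nat) :=
  (v 48 = 0 /\ forall c', c' < c -> ~~ valid_code c') \/
  (exists c0, [/\ c0 < c, valid_code c0, v 38 = c0, v 48 = (dwt (digs c0 h)).+1 &
     forall c', c' < c -> valid_code c' -> dwt (digs c0 h) <= dwt (digs c' h)]).

Lemma tri_code c v a : bvars v a -> c < B -> v 40 = c -> best c v -> (forall x, a 8 x <= c) ->
  tri pcode (150 + h * 310) (fun v' a' => best c.+1 v' /\ forall x, a' 8 x <= c.+1) v a.
Proof.
move=> hb hc h40 hbest hst.
have hb2 (x y : bool) : x + y <= 2 by case: x; case: y.
eapply tri_le.
  eapply tri_seq; asn; first by slv.
  eapply tri_seq; asn; first by slv.
  eapply tri_seq; asn; first by slv.
  eapply tri_seq; asn; first by slv.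
  rewrite [ev _ _ _]/= [ev _ _ _]/= [ev _ _ _]/= [ev _ _ _]/= h40; set v0 := upd _ _ _.
  have hb0 : bvars v0 a by case: hb => [[? ? ? ?] ?].
  eapply tri_seq; eapply (@tri_for _ _ _ h _ _ _ (fun i v' a' => dinv c (digs c i) i v' a')).
  - by case: hb0 => [[]].
  - by [].
  - by [].
  - by [].
  - rewrite /dinv /v0 /upd /= divn1 /dwt big_nil; split=> //; first by move=> x; exact: leqW.
    by move=> _; split=> // x; apply/negbTE; have := hst x; lia.
  - move=> i v1 a1 hi v1i hf hI.
    have e40 : v1 40 = c by rewrite hf.1 // /v0 /upd.
    have hb1 := bvars_frame hf isT isT hb0.
    by apply: tri_conseq (tri_digit hb1 hi hc e40 hI) (leqnn _) _.
  move=> v1 a1 _ hf [_ h44 st hok].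
  have hb1 := bvars_frame hf isT isT hb0; have [[_ _ _ h4] _] := hb1.
  have e48 : v1 48 = v 48 by rewrite hf.1.
  have e38 : v1 38 = v 38 by rewrite hf.1.
  have e40 : v1 40 = c by rewrite hf.1 // /v0 /upd.
  have skip : ~~ valid_code c -> best c.+1 v1.
    move=> nv; case: hbest => [[z1 z2]|[c0 [z1 z2 z3 z4 z5]]].
      by left; rewrite e48; split=> // c'; rewrite ltnS leq_eqVlt => /orP[/eqP->|/z2].
    right; exists c0; rewrite e48 e38; split=> //; first exact: ltnW.
    by move=> c'; rewrite ltnS leq_eqVlt => /orP[/eqP->|]; [rewrite (negbTE nv)|apply: z5].
  eapply tri_if; first by [].
  - rewrite [ev _ _ _]/= h44 eqb0 negbK => dk; have [h42 h43 _] := hok dk.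
    have wb := dwt_le dk; have wb2 : dwt (digs c h) < Z by move: wm_lt; nia.
    eapply tri_if; last first.
    + rewrite [ev _ _ _]/= h42 h4 => ne.
      have vc : valid_code c by rewrite /valid_code dk /=; move: ne; case: ltngtP.
      have set_best v' : v' 48 = (dwt (digs c h)).+1 -> v' 38 = c ->
        (forall c', c' < c -> valid_code c' -> dwt (digs c h) <= dwt (digs c' h)) -> best c.+1 v'.
        move=> k1 k2 k3; right; exists c; split=> // c'.
        by rewrite ltnS leq_eqVlt => /orP[/eqP->|]; [|apply: k3].
      eapply tri_if; first by [].
      * rewrite [ev _ _ _]/= e48 => nz.
        case: hbest => [[z1 z2]|[c0 [z1 z2 z3 z4 z5]]]; first by rewrite z1 in nz.
        eapply tri_if; first by rewrite /= h43; slv.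
        -- rewrite [ev _ _ _]/= h43 e48 z4 addn1 ltnS eqb0 negbK => lt.
           eapply tri_seq; asn; first by rewrite /= h43; slv.
           asn; first by [].
           split=> //; apply: set_best; rewrite /upd /= ?h43 ?addn1 ?e40 //.
           by move=> c' hc' vc'; apply: leq_trans (ltnW lt) (z5 _ hc' vc').
        -- rewrite [ev _ _ _]/= h43 e48 z4 addn1 ltnS => /eqP; rewrite eqb0 -leqNgt => ge.
           eapply tri_le; first apply: tri_nop; last by [].
           split=> //; right; exists c0; rewrite e48 e38; split=> //; first exact: ltnW.
           by move=> c'; rewrite ltnS leq_eqVlt => /orP[/eqP->|]; [|apply: z5].
      * rewrite [ev _ _ _]/= e48 => z.
        case: hbest => [[z1 z2]|[c0 [z1 z2 z3 z4 z5]]]; last by rewrite z4 in z.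
        eapply tri_le; first (eapply tri_seq; asn; [by rewrite /= h43; slv|asn; [by []|]]).
           split=> //; apply: set_best; rewrite /upd /= ?h43 ?addn1 ?e40 //.
           by move=> c' hc' vc'; have := z2 _ hc'; rewrite vc'.
        by rewrite /=; lia.
    + rewrite [ev _ _ _]/= h42 h4 => ne.
      eapply tri_le; first apply: tri_nop.
        split=> //; apply: skip; rewrite /valid_code dk /=.
        by move: ne; case: ltngtP.
      by rewrite /=; lia.
    + by rewrite /= h42 h4; slv; apply: leq_ltn_trans (hb2 _ _) (smallW Z_W isT).
  - rewrite [ev _ _ _]/= h44 => /eqP; rewrite eqb0 => ndk.
    eapply tri_le; first apply: tri_nop.
      by split=> //; apply: skip; rewrite /valid_code (negbTE ndk).
    by rewrite /= /acost /=; lia.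
by rewrite /=; lia.
Qed.

Definition pbrute :=
  48 ::= N 0;; SFor 40 (V vprod) pcode;;
  SIf (V 48) (0 ::= N 1;; 41 ::= V 38;;
    SFor 45 (V vh) (46 ::= V 41 mod V vE;; 41 ::= V 41 / V vE;; SPut 0 (V 45) (G 1 (V 46) - N 1)))
    (0 ::= N 0).

Lemma tri_brute v a : bvars v a -> v vprod = B -> (forall x, a 8 x = 0) ->
  tri pbrute (100 + h * 100 + B * (160 + h * 310)) (fun v' a' =>
    (v' 0 = 0 /\ forall c, c < B -> ~~ valid_code c) \/
    (v' 0 = 1 /\ exists c0, [/\ c0 < B, valid_code c0,
      forall c, c < B -> valid_code c -> dwt (digs c0 h) <= dwt (digs c h) &
      forall i, i < h -> a' 0 i = (g (dig c0 i)).-1])) v a.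
Proof.
move=> hb h17 ha.
have E0 : 0 < E by rewrite !muln_gt0 n_gt0.
eapply tri_le.
  eapply tri_seq; asn; first by slv.
  rewrite [ev _ _ _]/=; set v0 := upd _ _ _.
  have hb0 : bvars v0 a by case: hb => [[? ? ? ?] ?].
  eapply tri_seq; eapply (@tri_for _ _ _ B _ _ _ (fun c v' a' => best c v' /\ forall x, a' 8 x <= c)).
  - by [].
  - by [].
  - by [].
  - by [].
  - by split; [left|move=> x; rewrite ha].
  - move=> c v1 a1 hc v1c hf [i1 i2].
    have hb1 := bvars_frame hf isT isT hb0.
    by apply: tri_conseq (tri_code hb1 hc v1c i1 i2) (leqnn _) _.
  move=> v1 a1 _ hf [hbest _].
  have hb1 := bvars_frame hf isT isT hb0; have [[h2 h5 h6 h4] [r0 r1 r7]] := hb1.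
  eapply tri_if; first by [].
  - move=> nz; rewrite [ev _ _ _]/= in nz.
    case: hbest => [[z1 z2]|[c0 [z1 z2 z3 z4 z5]]]; first by rewrite z1 in nz.
    eapply tri_seq; asn; first by slv.
    eapply tri_seq; asn; first by slv.
    rewrite [ev _ _ _]/= [ev _ _ _]/= /upd /= z3; set v2 := (fun y : nat => _).
    eapply (@tri_for _ _ _ h _ _ _ (fun i v' a' => v' 41 = c0 %/ E ^ i /\
      forall j, j < i -> a' 0 j = (g (dig c0 j)).-1)).
    + by [].
    + by [].
    + by [].
    + by [].
    + by rewrite /upd /v2 /= divn1.
    + move=> i v3 a3 hi v3i hf3 [i1 i2].
      have e6 : v3 6 = E by rewrite hf3.1.
      have eA : a3 1 =1 g by move=> x; rewrite hf3.2.
      have dE : dig c0 i < E by rewrite ltn_mod.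
      eapply tri_seq; asn; first by slv.
      eapply tri_seq; asn; first by slv.
      rewrite [ev _ _ _]/= [ev _ _ _]/= /upd /= e6 i1 -/(dig c0 i) -divnMA -expnSr.
      eapply tri_put.
      * by [].
      * by rewrite /=; slv.
      * by rewrite /= v3i /valid /=; lia.
      rewrite /= v3i eA; split=> // j; rewrite ltnS leq_eqVlt /upd2 /= /upd subn1.
      by case/orP=> [/eqP->|hj]; [rewrite eqxx|rewrite ifF ?i2 //; apply/negbTE; lia].
    + move=> v3 a3 _ hf3 [_ i2]; right; split; first by rewrite hf3.1.
      by exists c0; split.
  - move=> z; rewrite [ev _ _ _]/= in z.
    case: hbest => [[z1 z2]|[c0 [z1 z2 z3 z4 z5]]]; last by rewrite z4 in z.
    eapply tri_le; first asn; first by slv.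
      by left.
    by rewrite /=; lia.
by rewrite /= /acost /=; lia.
Qed.

End BruteForce.

(** * Coins and runs *)

Fixpoint toss_free s :=
  match s with
  | SToss _ => false
  | SSeq s1 s2 | SIf _ s1 s2 => toss_free s1 && toss_free s2
  | SFor _ _ s => toss_free s
  | _ => true
  end.

(** Both the result and the clock agree, which makes the starting time of the tosses independent of
    the coins. *)
Lemma toss_free_sem w w' s c : toss_free s -> sem w s c = sem w' s c.
Proof.
elim: s c => [|x e|k e1 e2|x|s1 IH1 s2 IH2|e s1 IH1 s2 IH2|x e s IH] c //=.
- by move=> /andP[h1 h2]; rewrite IH1 // IH2.
- by move=> /andP[h1 h2]; rewrite IH1 // IH2.
- move=> h; have ei i c0 : iter i (forstep (sem w s) x) c0 = iter i (forstep (sem w' s) x) c0.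
    by elim: i => //= i ->; rewrite /forstep IH.
  by rewrite !ei.
Qed.

Definition pflip := SFor 30 (V 19) (SToss 31;; SPut 2 (V 30) (V 31)).

Definition flip_frame (v : nat -> nat) (a : nat -> nat -> nat) (b : nat -> bool) v' a' :=
  [/\ forall y, y \notin [:: 30; 31] -> v' y = v y, forall k, k != 2 -> a' k = a k
    & forall i, i < v 19 -> a' 2 i = b i].

(** A round takes 28 steps: 7 of loop overhead, 1 for the [SSeq], 1 for the toss and 19 for the
    store. The first toss comes 15 steps after the start. *)
Lemma flip_sem W Bs w v a t : 16 < 2 ^ W -> Bs + (16 * v 19 + 2) < 2 ^ W ->
  let c := sem w pflip (MkSt v a t) in
  [/\ ok W Bs w pflip (MkSt v a t), st c = t + 13 + 28 * v 19 &
      flip_frame v a (fun i => w (t + 15 + 28 * i)) (sv c) (sa c)].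
Proof.
move=> W_gt hF; set c0 := MkSt (upd v 30 0) a (t + 12).
pose c i := iter i (forstep (sem w (SToss 31;; SPut 2 (V 30) (V 31))) 30) c0.
have main i : [/\ st (c i) = t + 12 + 28 * i, sv (c i) 30 = i,
    forall y, y \notin [:: 30; 31] -> sv (c i) y = v y, forall k, k != 2 -> sa (c i) k = a k
    & forall j, j < i -> sa (c i) 2 j = w (t + 15 + 28 * j)].
  elim: i => [|i [h1 h2 h3 h4 h5]].
    split=> //; first by rewrite muln0 addn0.
    by move=> y; rewrite !inE negb_or => /andP[hy _]; rewrite /c /= /upd (negbTE hy).
  rewrite /c iterS -/(c i) /forstep /= h1; split.
  - by rewrite /acost /=; lia.
  - by rewrite /upd /= h2.
  - by move=> y hy; move: (hy); rewrite !inE negb_or /upd => /andP[/negbTE-> /negbTE->]; apply: h3.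
  - by move=> k hk; rewrite /upd2 (negbTE hk) h4.
  - move=> j; rewrite ltnS leq_eqVlt /upd2 /= /upd /= h2 => /orP[/eqP->|hj].
      by rewrite eqxx; congr (nat_of_bool (w _)); lia.
    by rewrite ifF ?h5 //; apply/negbTE; lia.
have [m1 m2 m3 m4 m5] := main (v 19).
split.
- rewrite /pflip [ok _ _ _ _ _]/=; split=> // i hi; rewrite -/(c0) -/(c i).
  have [h1 h2 h3 h4 h5] := main i; split=> //.
  have b1 (b : bool) : b < 2 ^ W by case: b; lia.
  by split=> //=; rewrite /upd /= h2 /valid /addr /=; lia.
- by rewrite /= -/c0 -/(c (v 19)) m1; lia.
- by split=> //=; rewrite -/c0 -/(c (v 19)).
Qed.

(* Stores the address Bs in register 3, that is in variable 1. *)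
Definition prefix :=
  Seq (Const 1 1) (Seq (Read 4 1) (Seq (Const 1 4) (Seq (Op Mul 4 4 1) (Seq (Op Add 4 4 1)
  (Seq (Const 1 0) (Seq (Read 1 1) (Op Add 3 4 1))))))).

(** Register 1 is a temporary of the compiled code; at the end it is set to 0, the address at which
    the output list starts. Register 0 is variable 0, the answer flag. *)
Definition program S := Seq prefix (Seq (cs S) (Const 1 0)).

Section Run.
Variables (W : nat) (input : seq nat).
Let n := nth 0 input 0.
Let ne := nth 0 input 1.
Let Bs := 4 + 4 * ne + n.
Hypothesis W_gt : 16 < 2 ^ W.
Hypothesis Bs_W : Bs < 2 ^ W.
Hypothesis input_size : size input = 3 + 4 * ne.
Hypothesis input_lt : forall i, nth 0 input i < 2 ^ W.

Definition start_vars : nat -> nat := upd (fun=> 0) 1 Bs.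
Definition start_arrays k i := nth 0 input (addr Bs k i).

Lemma prefix_run w S : exists r m, go W w 0 (init W (program S) input) 17
    (State [:: cs S; Const 1 0] r m) /\ Rel W Bs start_vars start_arrays r m.
Proof.
have wd x : x < 2 ^ W -> word W x = x by move=> h; rewrite /word modn_small.
have p0 : 0 < 2 ^ W by lia.
pose m a := word W (nth 0 input a).
have hm z : m z < 2 ^ W by rewrite /m /word ltn_mod.
have m0 : m 0 = n by rewrite /m wd.
have m1 : m 1 = ne by rewrite /m wd.
eexists; exists m; split.
  do 17 (apply: go_cons => /=); apply: go_refl.
  by [].
have w1 : word W 1 = 1 by apply: wd; lia.
have w4 : word W 4 = 4 by apply: wd; lia.
have w0 : word W 0 = 0 by apply: wd; lia.
rewrite /=; split.
- move=> x; rewrite /start_vars /upd; case: x => [|[|x]] //=.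
  + rewrite w1 w4 w0 -/(m 1) -/(m 0) m1 m0 !wd //; try by move: Bs_W; rewrite /Bs; lia.
  + by do 4 (rewrite ifF; last by apply/negbTE; lia).
- by move=> x /=; do ?(case: ifP => _ //); rewrite /word ltn_mod.
- by move=> k i _; rewrite /m wd.
- by [].
- by rewrite /start_vars /upd eqxx.
Qed.

Lemma foldl_halted s coins : halted s -> foldl (step W) s coins = s.
Proof. by case: s => [[|//] r m] _; elim: coins. Qed.

Lemma run_program w S (coins : seq bool) : (forall i, w i = nth false coins i) ->
  let c := sem w S (MkSt start_vars start_arrays 17) in
  ok W Bs w S (MkSt start_vars start_arrays 17) -> st c < size coins ->
  let s := run W (program S) input coins in
  [/\ halted s, reg s 0 = sv c 0, reg s 1 = 0 & forall i, i < Bs -> cell s i = sa c 0 i].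
Proof.
move=> hw c hok hT s.
have [r [m [g1 hR]]] := prefix_run w S.
have [r' [m' [g2 [hv hr hm _ _] _]]] := @cs_correct W Bs w W_gt S (MkSt start_vars start_arrays 17) r m [:: Const 1 0] hR hok.
have g3 : go W w (st c) (State [:: Const 1 0] r' m') (st c).+1
   (State [::] [eta r' with 1 |-> word W 0] m') by apply: go_cons; apply: go_refl.
have [k [ek es]] := go_trans (go_trans g1 g2) g3.
have sE : s = State [::] [eta r' with 1 |-> word W 0] m'.
  have ec : coins = [seq w i | i <- iota 0 (st c).+1] ++ drop (st c).+1 coins.
    rewrite -[LHS](cat_take_drop (st c).+1); congr (_ ++ _).
    apply: (@eq_from_nth _ false); first by rewrite size_map size_iota size_takel.
    move=> i; rewrite size_takel // => hi.
    by rewrite (nth_map 0) ?size_iota // nth_iota // nth_take // hw.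
  have {}ek : k = (st c).+1 by move: ek; rewrite -/c; lia.
  rewrite /s /run ec foldl_cat -ek -es foldl_halted //.
rewrite sE /=; split=> //; first by rewrite -(hv 0).
  by rewrite /word modn_small //; lia.
by move=> i hi; rewrite -(hm 0 i).
Qed.

(** [v], [a] and [t1] are chosen before the coins. This is legitimate because [ppre] is toss-free;
    afterwards the outcome is described by the coins at the positions [t1 + 28 * i]. *)
Lemma run_random (ppre ppost : stm) T1 (T2 : (nat -> nat) -> nat) (Qpre : _ -> _ -> Prop)
    (Qpost : (nat -> nat) -> (nat -> nat -> nat) -> (nat -> bool) -> (nat -> nat) -> (nat -> nat -> nat) -> Prop) :
  toss_free ppre ->
  (forall w, tri W Bs w ppre T1 Qpre start_vars start_arrays) ->
  (forall v a, Qpre v a -> Bs + (16 * v 19 + 2) < 2 ^ W) ->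
  (forall w v a b v' a', Qpre v a -> flip_frame v a b v' a' ->
     tri W Bs w ppost (T2 v) (Qpost v a b) v' a') ->
  exists v a t1, Qpre v a /\ forall coins : seq bool,
    60 + T1 + T2 v + 28 * v 19 <= size coins ->
    let s := run W (program (ppre;; (pflip;; ppost))) input coins in
    t1 + 28 * v 19 <= size coins /\
    exists v' a', [/\ Qpost v a (fun i => nth false coins (t1 + 28 * i)) v' a', halted s,
      reg s 0 = v' 0, reg s 1 = 0 & forall i, i < Bs -> cell s i = a' 0 i].
Proof.
move=> htf hpre hF hpost.
pose c1 := sem (fun=> false) ppre (MkSt start_vars start_arrays 18).
have [_ q1 t1] := triW (hpre (fun=> false)) 18.
exists (sv c1), (sa c1), (st c1 + 16); split=> // coins hT.
pose w i := nth false coins i.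
have [o2 q2 t2] := triW (hpre w) 18.
have e1 : sem w ppre (MkSt start_vars start_arrays 18) = c1 by apply: toss_free_sem.
have [o3 t3 f3] := @flip_sem W Bs w (sv c1) (sa c1) (st c1 + 1) W_gt (hF _ _ q1).
have {}f3 : flip_frame (sv c1) (sa c1) (fun i => nth false coins (st c1 + 16 + 28 * i))
    (sv (sem w pflip (MkSt (sv c1) (sa c1) (st c1 + 1)))) (sa (sem w pflip (MkSt (sv c1) (sa c1) (st c1 + 1)))).
  case: f3 => k1 k2 k3; split=> // i hi; rewrite k3 // /w; congr (nat_of_bool (nth _ _ _)); lia.
set c2 := sem w pflip _ in o3 t3 f3.
have [o4 q4 t4] := triW (hpost w _ _ _ _ _ q1 f3) (st c2).
have okS s1 s2 v a t : ok W Bs w (SSeq s1 s2) (MkSt v a t) =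
  (ok W Bs w s1 (MkSt v a (t + 1)) /\ ok W Bs w s2 (sem w s1 (MkSt v a (t + 1)))) by [].
have semS s1 s2 v a t : sem w (SSeq s1 s2) (MkSt v a t) =
  sem w s2 (sem w s1 (MkSt v a (t + 1))) by [].
have eta c : c = MkSt (sv c) (sa c) (st c) by case: c.
have oS : ok W Bs w (ppre;; (pflip;; ppost)) (MkSt start_vars start_arrays 17).
  rewrite okS e1 (eta c1) okS -/c2 (eta c2); split; first exact: o2.
  by split; [exact: o3|exact: o4].
have eS : sem w (ppre;; (pflip;; ppost)) (MkSt start_vars start_arrays 17) =
    sem w ppost (MkSt (sv c2) (sa c2) (st c2)).
  by rewrite semS e1 (eta c1) semS -/c2 -(eta c2).
have tS : st (sem w ppost (MkSt (sv c2) (sa c2) (st c2))) < size coins.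
  by apply: leq_trans hT; move: t1 t3 t4; rewrite -/c1; lia.
have := run_program (w := w) (coins := coins) (fun=> erefl) oS; rewrite eS => /(_ tS) [k1 k2 k3 k4].
split; first by move: t1 hT; rewrite -/c1; lia.
exists (sv (sem w ppost (MkSt (sv c2) (sa c2) (st c2)))), (sa (sem w ppost (MkSt (sv c2) (sa c2) (st c2)))).
by split.
Qed.

End Run.

(** * The whole solver *)

Section Solver.
Variables (t K : nat).
Local Notation T2 := (2 ^ t).
Variables (chi : nat -> nat -> bool) (xr : nat -> nat -> nat).

(** All decisions about sizes, including the number of coins in variable 19, are taken before the
    first toss. *)
Definition ppre :=
  ptab 5 (fun i => chi (i %/ T2) (i %% T2)) (T2 * T2);;
  ptab 7 (fun i => xr (i %/ T2) (i %% T2)) (T2 * T2);;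
  pread T2;; pprod;; pQ K;;
  SIf (V vn mod N 2) (19 ::= N 0)
    (SIf (V vwm1 < V vprod) (19 ::= V vE * V vq) (19 ::= N 0)).

Definition pmain :=
  passem;; psieve;; pfind;; vN ::= V vh * V vwm + N 1;; plevels T2;;
  SIf (V 0) (pdel T2;; pout) SNop.

(** For odd n there is no perfect matching. For n = 0 the empty set is the only candidate, and it is
    feasible iff the demand is zero. *)
Definition ppost :=
  SIf (V vn mod N 2) (0 ::= N 0) (
  SIf (V vn) (SIf (V vwm1 < V vprod) pmain (pbrute T2))
    (0 ::= (V va < N 1))).

Lemma toss_free_ptab k f m : toss_free (ptab k f m).
Proof. by elim: m => //= m ->. Qed.

Lemma toss_free_ppre : toss_free ppre.
Proof. by rewrite /ppre /= !toss_free_ptab. Qed.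

Variables (W Bs Z : nat).
Hypothesis Z_W : Zbound W Z.
Hypothesis Bs_lt : Bs < Z.
Variables (n ne al : nat) (a0 eu ev' wt ga : nat -> nat).
Hypothesis Bs_eq : Bs = 4 + 4 * ne + n.
Hypothesis a0_0 : a0 0 = n.
Hypothesis a0_1 : a0 1 = ne.
Hypothesis a0_2 : a0 2 = al.
Hypothesis a0_u : forall e, e < ne -> a0 (4 * e + 3) = eu e.
Hypothesis a0_v : forall e, e < ne -> a0 (4 * e + 4) = ev' e.
Hypothesis a0_w : forall e, e < ne -> a0 (4 * e + 5) = wt e.
Hypothesis a0_g : forall e, e < ne -> a0 (4 * e + 6) = ga e.
Hypothesis eu_lt : forall e, e < ne -> eu e < n.
Hypothesis ev_lt : forall e, e < ne -> ev' e < n.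
Hypothesis uv_ne : forall e, e < ne -> eu e != ev' e.
Hypothesis ga_lt : forall e, e < ne -> ga e < T2.
Hypothesis al_lt : al < T2.
Hypothesis nnT_lt : n * n * T2 < Z.
Hypothesis TT_lt : T2 * T2 < Z.
Hypothesis xr_lt : forall x y, xr x y < T2.
Let wm := wmx wt ne.
Let h := n %/ 2.
Local Notation E := (n * n * T2).
Hypothesis K_gt0 : 0 < K.
Local Notation Y := (Yb K n wm).
Hypothesis YZ : n.+1 * (8 * Y) < Z.
Hypothesis EYZ : n * n * T2 * (2 * Y) < Z.
Hypothesis XZ : forall q, 2 ^ q < 2 * Y -> 4 * primes_to q + 8 < Z.

Definition qspec q (v : nat -> nat) := [/\ Y <= 2 ^ q, 2 ^ q < 2 * Y,
    v vQ = 2 ^ q, v vq = q & v vlg = 2 * q + 6] /\ v vX = primes_to q.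

Definition prodspec (v : nat -> nat) := v vwm1 = maxn 1 wm /\
  ((v vprod <= maxn 1 wm /\ v vprod = E ^ h) \/ (maxn 1 wm < v vprod <= E ^ h)).

Definition main_case (v : nat -> nat) := ~~ odd n && (v vwm1 < v vprod).

Definition pre_spec (v : nat -> nat) (a : nat -> nat -> nat) :=
  [/\ [/\ v vn = n, v va = al, v vh = h, v vE = E & v vwm = wm],
      prodspec v, (exists q, qspec q v), gspec n T2 eu ev' wt ga ne (a 1) &
      v 19 = if main_case v then E * v vq else 0] /\
  [/\ a 0 = a0, forall c g, c < T2 -> g < T2 -> a 5 (c * T2 + g) = chi c g,
      forall x y, x < T2 -> y < T2 -> a 7 (x * T2 + y) = xr x y &
      forall k, k \notin [:: 0; 1; 5; 7] -> forall i, a k i = 0].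

Definition Tpre := 1000 + 40 * (T2 * T2) + ne * 310 + h * 70 + Y * 70.

Lemma T2_pos : 0 < T2. Proof. by rewrite expn_gt0. Qed.

Lemma YZ1 : 8 * Y < Z.
Proof. by apply: leq_ltn_trans YZ; rewrite leq_pmull. Qed.

Lemma Y_gt0 : 0 < Y.
Proof. by rewrite !muln_gt0 K_gt0. Qed.

Lemma Y_wm : n.+1 * n.+1 * wm.+1 <= Y.
Proof. by rewrite /Yb leq_mul2r; apply/orP; right; rewrite leq_mul2r; apply/orP; right; rewrite leq_pmull // muln_gt0 K_gt0. Qed.

Lemma tri_pre w v a : v vn = 0 -> a 0 = a0 -> (forall k, k != 0 -> forall i, a k i = 0) ->
  tri W Bs w ppre Tpre pre_spec v a.
Proof.
move=> _ ha0 haz; have T20 := T2_pos; have Y1 := YZ1.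
have T2Z : T2 < Z by apply: leq_ltn_trans TT_lt; rewrite leq_pmulr.
have wZ : wm.+1 < Z.
  by apply: leq_ltn_trans Y1; apply: leq_trans (leq_trans _ Y_wm) _; [rewrite leq_pmull|rewrite leq_pmull].
eapply tri_le.
  eapply tri_seq; apply: tri_call (tri_tab w Z_W Bs_lt v a _ _ _) _; [by []|exact: ltnW|move=> i _; case: (chi _ _); lia|].
  move=> v1 a1 h5 hf1.
  eapply tri_seq; apply: tri_call (tri_tab w Z_W Bs_lt v1 a1 _ _ _) _; [by []|exact: ltnW| |].
    by move=> i _; apply: ltn_trans (xr_lt _ _) _.
  move=> v2 a2 h7 hf2.
  have f1 k : k != 5 -> a1 k = a k.
    move=> k5; apply: hf1.2; apply/negP => /amods_ptab; rewrite inE; exact/negP.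
  have f2 k : k != 7 -> a2 k = a1 k.
    move=> k5; apply: hf2.2; apply/negP => /amods_ptab; rewrite inE; exact/negP.
  have a20 : a2 0 = a0 by rewrite f2 // f1.
  have a21 i : a2 1 i = 0 by rewrite f2 // f1 // haz.
  eapply tri_seq; apply: tri_call (tri_read w Z_W Bs_lt T20 Bs_eq a0_0 a0_1 a0_2 a0_u a0_v a0_w a0_g eu_lt ev_lt uv_ne ga_lt nnT_lt T2Z v2 a20 a21) _.
  move=> v3 a3 [[g1 g2 g3 g4 g5] [g6 g7]] hf3.
  eapply tri_seq; apply: tri_call (tri_prod w Z_W Bs_lt T20 Bs_eq a0_0 a0_1 a0_2 nnT_lt T2Z a3 g4 g5 g6 _ _ _) _; [|by []|by []|].
    by rewrite /h; case: (n) => [|n']; [left|right; rewrite !muln_gt0 T20].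
  move=> v4 a4 hp hf4.
  have i2 : v4 vn = n by rewrite hf4.1.
  have i7 : v4 vwm = wm by rewrite hf4.1.
  have Y2 : 2 * Y < Z by lia.
  eapply tri_seq; apply: tri_call (tri_Q w Z_W Bs_lt K_gt0 Y2 XZ a4 i2 i7) _.
  move=> v5 a5 [q hq] hf5.
  have a5E k : k \notin [:: 1; 5; 7] -> a5 k = a k.
    rewrite !inE !negb_or => /and3P[k1 k5 k7].
    have f3 : a3 k = a2 k by apply: hf3.2; rewrite /= !inE (negbTE k1).
    by rewrite hf5.2 // hf4.2 // f3 f2 // f1.
  have a55 : a5 5 = a1 5 by rewrite hf5.2 // hf4.2 // hf3.2 // f2.
  have a57 : a5 7 = a2 7 by rewrite hf5.2 // hf4.2 // hf3.2.
  have a51 : a5 1 = a3 1 by rewrite hf5.2 // hf4.2.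
  have fin v' : (forall y, y != 19 -> v' y = v5 y) -> v' 19 = (if main_case v5 then E * v5 vq else 0) ->
      pre_spec v' a5.
    move=> hv h19; split; split.
    - by split; rewrite hv // hf5.1 // hf4.1.
    - by rewrite /prodspec !hv // !hf5.1.
    - by exists q; rewrite /qspec !hv.
    - by rewrite a51.
    - by rewrite h19 /main_case !hv.
    - by rewrite a5E.
    - move=> c g hc hg; rewrite a55 h5; last exact: idx_lt.
      by rewrite divnMDl ?T2_pos // modnMDl modn_small // divn_small // addn0.
    - move=> c g hc hg; rewrite a57 h7; last exact: idx_lt.
      by rewrite divnMDl ?T2_pos // modnMDl modn_small // divn_small // addn0.
    - move=> k hk i; rewrite a5E; first by rewrite haz //; move: hk; rewrite inE; case: (k == 0).
      by move: hk; rewrite !inE; case: (k == 0).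
  have j2 : v5 vn = n by rewrite hf5.1.
  have jE : v5 vE = E by rewrite hf5.1 // hf4.1.
  have [[q1 q2 q3 q4 q5] q6] := hq.
  have qZ : E * q < Z.
    apply: leq_ltn_trans EYZ; rewrite leq_mul2l; apply/orP; right.
    exact: ltnW (ltn_trans (ltn_expl q (isT : 1 < 2)) q2).
  have qZ2 : q < Z.
    by apply: leq_ltn_trans Y1; apply: ltnW; apply: ltn_trans (ltn_expl q (isT : 1 < 2)) _; lia.
  eapply (@tri_le _ _ _ (7 + 2 + (9 + 2 + 30))); last exact: leqnn.
    eapply tri_if; first by rewrite /=; slv.
    - rewrite [ev _ _ _]/= j2 modn2 eqb0 negbK => od; eapply tri_le; first asn; first by slv.
        by apply: fin => [y /negbTE hy|]; rewrite /upd ?hy //= /main_case od.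
      by rewrite /=; lia.
    - rewrite [ev _ _ _]/= j2 modn2 => /eqP; rewrite eqb0 => od.
      eapply tri_if; first by [].
      + rewrite [ev _ _ _]/= eqb0 negbK => lt; eapply tri_le; first asn; first by rewrite /= jE q4; slv.
          by apply: fin => [y /negbTE hy|]; rewrite /upd ?hy //= /main_case od lt jE.
        by rewrite /=; lia.
      + rewrite [ev _ _ _]/= => /eqP; rewrite eqb0 => /negbTE lt.
        eapply tri_le; first asn; first by slv.
          by apply: fin => [y /negbTE hy|]; rewrite /upd ?hy //= /main_case od lt.
        by rewrite /=; lia.
by rewrite /Tpre /h; lia.
Qed.

Variables (v0 : nat -> nat) (s0 : nat -> nat -> nat).
Hypothesis pre : pre_spec v0 s0.

Let g0 := s0 1.
Let q := v0 vq.
Definition the_prime := last_prime (2 ^ q) (primes_to q).+1.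
Let p := the_prime.
Let lg := 2 * q + 6.
Let Np := h * wm + 1.
Local Notation tT := (Ttest n h lg T2 Np).

Definition coords (b : nat -> bool) d := horner (fun i => b (d * q + i)) q.

Definition Tpost :=
  200 + (if main_case v0 then
    1000 + E * (70 + q * 60) + primes_to q * 120 + lg * primes_to q * 60
    + q.+1 * (120 + h.+1 * (60 + tT)) + E * (100 + tT) + E * 150
  else if ~~ odd n then h * 100 + v0 vprod * (160 + h * 310) else 0).

Definition post_spec (b : nat -> bool) (v' : nat -> nat) (a' : nat -> nat -> nat) :=
  if odd n then v' 0 = 0 else
  if n == 0 then v' 0 = (al == 0) else
  if main_case v0 then
    let X := coords b in
    let L := levels p n h lg T2 Np al q a0 X chi g0 q.+1 in
    (v' 0 != 0) = L.1.2 /\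
    (L.1.2 -> forall i, i < n ->
      let o := outs (dels p n lg T2 Np al a0 X chi L.1.1 g0 E) E in
      i < size o -> a' 0 i = nth 0 o i)
  else
    (v' 0 = 0 /\ forall c, c < E ^ h -> ~~ valid_code n h T2 al g0 xr c) \/
    (v' 0 = 1 /\ exists c0, [/\ c0 < E ^ h, valid_code n h T2 al g0 xr c0,
      forall c, c < E ^ h -> valid_code n h T2 al g0 xr c ->
         dwt a0 g0 (digs n T2 c0 h) <= dwt a0 g0 (digs n T2 c h) &
      forall i, i < h -> a' 0 i = (g0 (dig n T2 c0 i)).-1]).

Lemma the_primeP : prime p && (2 ^ q < p <= primes_to q).
Proof.
rewrite -[p <= _]ltnS; apply: last_primeP.
by have [r r_pr hr] := exists_prime q; exists r => //; rewrite ltnS.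
Qed.

Lemma q_spec : qspec q v0.
Proof.
have [[_ _ [q' hq] _ _] _] := pre; rewrite /q.
by have [[_ _ _ -> _] _] := hq.
Qed.

Lemma g0_ok d : d < E -> g0 d != 0 -> [/\ 4 * g0 d + 1 < Bs, a0 (4 * g0 d + 1) <= wm
  & exists e, [/\ e < ne, g0 d = e.+1 & ecls n T2 eu ev' ga e = d]].
Proof.
have [[_ _ _ hg _] _] := pre => hd nz; case: (hg d hd) => [[z _]|[e [e1 e2 e3 e4]]].
  by rewrite /g0 z in nz.
rewrite /g0 e2 (_ : 4 * e.+1 + 1 = 4 * e + 5); last by lia.
rewrite a0_w //; split; first by rewrite Bs_eq; lia.
  exact: (leq_bigmax (Ordinal e1)).
by exists e.
Qed.

Lemma slot_ends u v c : u < n -> v < n -> c < T2 ->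
  du n T2 (slot n T2 u v c) = u /\ dv n T2 (slot n T2 u v c) = v.
Proof.
move=> hu hv hc; have n0 : 0 < n by lia.
rewrite /du /dv /slot divnMDl ?T2_pos // (divn_small hc) addn0 divnMDl // modnMDl.
by rewrite (divn_small hv) addn0 modn_small.
Qed.

Lemma primes_to_lt : primes_to q < 2 ^ lg.
Proof.
have : 2 * q + 8 <= 2 ^ (q + 4).
  elim: (q) => // i IH; rewrite addSn expnS; have : 16 <= 2 ^ (i + 4) by rewrite expnD -[X in X <= _]mul1n leq_mul // expn_gt0.
  by move: (2 ^ (i + 4)) IH => x; lia.
move=> hq; rewrite /primes_to /lg (_ : 2 * q + 6 = 1 + (q + (q + 4)) + 1); last by lia.
rewrite addn1 expnS expnD expn1 expnD; have : 0 < 2 ^ q by rewrite expn_gt0.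
by move: (2 ^ q) (2 ^ (q + 4)) hq => x y; nia.
Qed.

Lemma tri_main b w v a : 0 < n -> main_case v0 -> flip_frame v0 s0 b v a ->
  tri W Bs w pmain (1100 + E * (70 + q * 60) + primes_to q * 120 + lg * primes_to q * 60
    + q.+1 * (120 + h.+1 * (60 + tT)) + E * (100 + tT) + E * 150) (post_spec b) v a.
Proof.
move=> n0 mc [hv ha hb].
have [[[p1 p2 p3 p4 p5] p6 _ p8 p9] [p10 p11 p12 p13]] := pre.
have [[q1 q2 q3 q4 q5] q6] := q_spec.
have /and3P[pp pQ' pX] := the_primeP.
have Y1 := YZ1; have Y0 := Y_gt0; have XZ' := XZ q2; have T20 := T2_pos.
have ev_n : n = 2 * h by move: mc; rewrite /main_case /h => /andP[od _]; lia.
have h0 : 0 < h by lia.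
have EqZ : E * q < Z.
  apply: leq_ltn_trans EYZ; rewrite leq_mul2l; apply/orP; right.
  exact: ltnW (ltn_trans (ltn_expl q (isT : 1 < 2)) q2).
have F : v0 19 = E * q by rewrite p9 mc.
have Yn : n.+1 * n.+1 * wm.+1 <= 2 ^ q by apply: leq_trans Y_wm q1.
have NpQ : Np < 2 ^ q by apply: leq_trans Yn; rewrite /Np; nia.
have Y2 : 2 * Y < Z by lia.
have QZ : 2 ^ q < Z by lia.
have Q2 : 2 < 2 ^ q by apply: leq_trans Yn; nia.
have hgok : gok Bs n lg T2 a0 g0.
  move=> d hd nz; have [k1 k2 _] := g0_ok hd nz; split=> //; apply: leq_ltn_trans k2 _.
  apply: leq_ltn_trans (ltn_trans pQ' (leq_ltn_trans pX primes_to_lt)).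
  by apply: leq_trans Yn; nia.
have pZ : p < Z by lia.
have kZ : h.+1 * 2 ^ q.+2 < Z.
  apply: leq_ltn_trans YZ; rewrite leq_mul //; first by lia.
  by rewrite !expnS; lia.
have lgp : p < 2 ^ lg by apply: leq_ltn_trans pX primes_to_lt.
have Nph : Np < p by apply: ltn_trans NpQ pQ'.
have nBs : n < Bs by lia.
have eE : v vE = E by rewrite hv.
have eq : v vq = q by rewrite hv.
have hbit i : i < E * q -> (b i : nat) <= 1 by case: (b i).
have hba i : i < E * q -> a 2 i = b i by rewrite -F; apply: hb.
eapply tri_le.
  eapply tri_seq; apply: tri_call (tri_assem w Z_W Bs_lt K_gt0 Y2 q2 eE eq EqZ nnT_lt hbit hba) _.
  move=> v1 a1 h3 hf1.
  have e11 : v1 vX = primes_to q by rewrite hf1.1 // hv.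
  have z6 i : a1 6 i = 0 by rewrite hf1.2 // ha // p13.
  eapply tri_seq; apply: tri_call (tri_sieve w Z_W Bs_lt K_gt0 Y2 q2 e11 XZ' primes_to_lt z6) _.
  move=> v2 a2 h6 hf2.
  have f8 : v2 vQ = 2 ^ q by rewrite hf2.1 // hf1.1 // hv.
  have f11 : v2 vX = primes_to q by rewrite hf2.1.
  eapply tri_seq; apply: tri_call (tri_find w Z_W Bs_lt K_gt0 Y2 q2 f8 f11 XZ' (ltnW Q2) h6) _.
  move=> v3 a3 h12 hf3.
  have vE y : y \notin [:: 11; 12; 20; 21; 22; 23; 30; 31; 32; 33] -> v3 y = v0 y.
    move=> hy; have sub (l : seq nat) : all (fun z => z \in [:: 11; 12; 20; 21; 22; 23; 30; 31; 32; 33]) l -> y \notin l.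
      by move=> /allP hl; apply: contra hy => /hl.
    by rewrite hf3.1 ?hf2.1 ?hf1.1 ?hv //; apply: sub.
  have c5 : v3 vh = h by rewrite vE.
  have c7 : v3 vwm = wm by rewrite vE.
  have hwZ : h * wm < Z by move: NpQ; rewrite /Np; lia.
  eapply tri_seq; asn; first by rewrite /= c5 c7; slv.
  rewrite [ev _ _ _]/= c5 c7 -/Np; set v4 := upd _ _ _.
  pose X := coords b.
  have X_lt d : d < E -> X d < p.
    move=> _; apply: ltn_trans pQ'; apply: horner_lt => j _; by case: (b _).
  have hv0 : vars0 p n h lg Np al v4.
    by split; first split; rewrite /v4 /upd /=; try exact: h12; rewrite ?vE.
  have hA : arrs n T2 a0 g0 X chi a3.
    split.
    - by rewrite hf3.2 // hf2.2 // hf1.2 // ha.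
    - by move=> x; rewrite hf3.2 // hf2.2 // hf1.2 // ha.
    - by move=> d hd; rewrite hf3.2 // hf2.2 // h3.
    - by move=> c g hc hg; rewrite hf3.2 // hf2.2 // hf1.2 // ha // p11.
  have d8 : v4 vQ = 2 ^ q by rewrite /v4 /upd /= vE.
  have d9 : v4 vq = q by rewrite /v4 /upd /= vE.
  have p3' : 2 < p by lia.
  eapply tri_seq; apply: tri_call (tri_levels w Z_W Bs_lt pp p3' pZ n0 nnT_lt ev_n lgp TT_lt T20 Nph al_lt nBs kZ X_lt hgok hv0 hA d8 d9) _.
  move=> v5 a5 [h15 hfl] hf5.
  set L := levels _ _ _ _ _ _ _ _ _ _ _ _ _ in h15 hfl.
  have hA5 := arrs_frame hf5 isT hA.
  have hv5 := vars0_frame hf5 isT hv0.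
  have d6 : v5 6 = E by rewrite hf5.1 // /v4 /upd /= vE.
  have mn : n == 0 = false by lia.
  have od : odd n = false by rewrite ev_n mul2n odd_double.
  eapply tri_if; first by [].
  - rewrite [ev _ _ _]/= => nz.
    eapply tri_seq; apply: tri_call (tri_del w Z_W Bs_lt pp p3' pZ n0 nnT_lt ev_n lgp TT_lt T20 Nph al_lt nBs kZ X_lt hgok hv5 hA5 h15 d6) _.
    move=> v6 a6 h1 hf6.
    have d2 : v6 vn = n by rewrite hf6.1 // hf5.1 // /v4 /upd /= vE.
    have d6' : v6 6 = E by rewrite hf6.1.
    apply: tri_call (tri_out w Z_W Bs_lt pp p3' pZ n0 nnT_lt ev_n lgp TT_lt T20 Nph al_lt nBs kZ d2 d6' h1) _ => v7 a7 ho hf7.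
    rewrite /post_spec od mn mc /= -/L -hfl nz hf7.1 // hf6.1 //; split=> // _ i hi; exact: ho.
  - rewrite [ev _ _ _]/= => z; eapply tri_le; first apply: tri_nop.
      by rewrite /post_spec od mn mc /= -/L -hfl z.
    by rewrite /=; lia.
by rewrite /=; lia.
Qed.

Lemma tri_post b w v a : flip_frame v0 s0 b v a ->
  tri W Bs w ppost Tpost (post_spec b) v a.
Proof.
move=> hff; have [hv ha hb] := hff.
have [[[p1 p2 p3 p4 p5] p6 _ p8 p9] [p10 p11 p12 p13]] := pre.
have e2 : v vn = n by rewrite hv.
have T20 := T2_pos.
have [e18 hp] := p6.
have cE : (v vwm1 < v vprod) = (v0 vwm1 < v0 vprod) by rewrite !hv.
rewrite /Tpost; set Tb := if main_case v0 then _ else _.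
eapply (@tri_le _ _ _ (7 + 2 + (3 + 2 + (9 + 2 + (130 + Tb))))); last by lia.
eapply tri_if; first by rewrite /=; slv.
- rewrite [ev _ _ _]/= e2 modn2 eqb0 negbK => od.
  eapply tri_le; first asn; first by slv.
    by rewrite /post_spec od.
  by rewrite /=; lia.
- rewrite [ev _ _ _]/= e2 modn2 => /eqP; rewrite eqb0 => nod.
  have od := negbTE nod.
  eapply tri_if; first by [].
  + rewrite [ev _ _ _]/= e2 -lt0n => n0.
    eapply tri_if; first by [].
    * rewrite [ev _ _ _]/= cE eqb0 negbK => lt.
      have mc : main_case v0 by rewrite /main_case nod.
      by apply: tri_le (tri_main w n0 mc hff) _; rewrite /Tb mc; lia.
    * rewrite [ev _ _ _]/= cE => /eqP; rewrite eqb0 => nlt.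
      have mc : main_case v0 = false by rewrite /main_case (negbTE nlt) andbF.
      case: hp => [[l1 l2]|/andP[l1 _]]; last by rewrite e18 l1 in nlt.
      have mn : n == 0 = false by lia.
      have Y1 := YZ1; have yw := Y_wm.
      have wmY : wm.+1 <= Y by apply: leq_trans yw; rewrite leq_pmull.
      have hw : h.+1 * wm.+1 < Z.
        apply: leq_ltn_trans YZ; rewrite leq_mul //; first by rewrite ltnS leq_div.
        by lia.
      have BZ : (v0 vprod).+1 < Z.
        by apply: leq_ltn_trans Y1; move: l1; move: (v0 vprod) => x; lia.
      have hBs : h < Bs by rewrite Bs_eq /h; have := leq_div n 2; lia.
      have bg d : d < E -> g0 d != 0 -> 4 * g0 d + 1 < Bs /\ a0 (4 * g0 d + 1) <= wm.
        by move=> hd /(g0_ok hd)[].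
      have guv d : d < E -> g0 d != 0 -> du n T2 d != dv n T2 d.
        move=> hd /(g0_ok hd)[_ _ [e [e1 _ <-]]].
        have hu := eu_lt e1; have hv' := ev_lt e1; have hn := uv_ne e1.
        have [-> ->] // := @slot_ends (minn (eu e) (ev' e)) (maxn (eu e) (ev' e)) (ga e) ltac:(lia) ltac:(lia) (ga_lt e1).
        by lia.
      have hbv : bvars n h T2 al a0 g0 xr v a.
        split; first by split; rewrite hv.
        by split; rewrite !ha.
      have a8 x : a 8 x = 0 by rewrite ha // p13.
      have e17 : v vprod = v0 vprod by rewrite hv.
      apply: tri_conseq (tri_brute w Z_W Bs_lt n0 T20 nnT_lt TT_lt BZ hw hBs xr_lt bg guv hbv e17 a8) _ _.
        by rewrite /Tb mc nod; lia.
      by move=> v' a' hh; rewrite /post_spec od mn mc -l2.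
  + rewrite [ev _ _ _]/= e2 => z.
    eapply tri_le; first asn; first by slv.
      by rewrite /post_spec od z /upd /= hv // p2 ltnS leqn0.
    by rewrite /=; lia.
Qed.

End Solver.

(** * Correctness of the test and of the search *)

Section Codes.
Variable t : nat.

Definition dec (c : nat) : 'rV['F_2]_t := (\row_j (odd (c %/ 2 ^ j))%:R)%R.

Lemma F2_natb (x : 'F_2) : ((x != 0)%:R = x)%R.
Proof. by case: x => [[|[|//]] ?]; apply/val_inj. Qed.

Lemma encode_lt (a : 'rV['F_2]_t) : encode_vec a < 2 ^ t.
Proof.
case: t a => [|t'] a; first by rewrite /encode_vec big_ord0.
rewrite /encode_vec (eq_bigr (fun i : 'I_t'.+1 => (a ord0 (inord i) != 0)%R * 2 ^ i)).
  exact: (bin_lt (fun i => a ord0 (inord i) != 0)%R).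
by move=> i _; rewrite inord_val.
Qed.

Lemma encode_inj : injective (@encode_vec t).
Proof.
case: t => [|t'] a b; first by move=> _; apply/rowP => -[].
have e (c : 'rV['F_2]_t'.+1) : encode_vec c = \sum_(i < t'.+1) (c ord0 (inord i) != 0)%R * 2 ^ i.
  by apply: eq_bigr => i _; rewrite inord_val.
rewrite !e => /(@bin_inj (fun i => a ord0 (inord i) != 0)%R (fun i => b ord0 (inord i) != 0)%R) h.
apply/rowP => j; rewrite -[a 0%R j]F2_natb -[b 0%R j]F2_natb.
by have := h j (ltn_ord j); rewrite inord_val => ->.
Qed.

Lemma odd_sum_div (f : nat -> bool) m j : j < m -> odd ((\sum_(i < m) f i * 2 ^ i) %/ 2 ^ j) = f j.
Proof.
elim: m => // m IH hj; rewrite big_ord_recr /=.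
have hb := bin_lt f j; have := hj; rewrite ltnS leq_eqVlt => /orP[/eqP ej|lt].
  by rewrite -ej divnDMl ?expn_gt0 // divn_small //; case: (f j).
rewrite (_ : f m * 2 ^ m = f m * 2 ^ (m - j) * 2 ^ j); last by rewrite -mulnA -expnD subnK // ltnW.
rewrite divnDMl ?expn_gt0 // oddD IH // oddM oddX /= (_ : (m - j == 0) = false) ?andbF ?addbF //.
by apply/negbTE; rewrite subn_eq0 -ltnNge.
Qed.

Lemma encodeK : cancel (@encode_vec t) dec.
Proof.
move=> a; apply/rowP => j; rewrite mxE; case: t a j => [|t'] a j; first by case: j.
have e : encode_vec a = \sum_(i < t'.+1) (a ord0 (inord i) != 0)%R * 2 ^ i.
  by apply: eq_bigr => i _; rewrite inord_val.
by rewrite e (odd_sum_div (fun i => a ord0 (inord i) != 0)%R) ?ltn_ord // inord_val F2_natb.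
Qed.

(** [encode_vec] is an injection between two sets with 2^t elements, hence onto. *)
Lemma decK c : c < 2 ^ t -> encode_vec (dec c) = c.
Proof.
pose f (a : 'rV['F_2]_t) := Ordinal (encode_lt a).
have fi : injective f by move=> a b /(congr1 val) /encode_inj.
have cE : #|codom f| = #|'I_(2 ^ t)|.
  by rewrite card_codom // card_mx card_Fp // mul1n card_ord.
have sE : codom f =i 'I_(2 ^ t) by apply/(subset_cardP cE); exact/subsetP.
move=> hc; have /codomP[a /(congr1 val) /= e] : Ordinal hc \in codom f by rewrite sE.
by rewrite {1}e encodeK.
Qed.

Lemma sum_dec (V : nmodType) (G : 'rV['F_2]_t -> V) :
  (\sum_(c < 2 ^ t) G (dec c) = \sum_a G a)%R.
Proof.
rewrite [RHS](reindex (fun c : 'I_(2 ^ t) => dec c)) //.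
exists (fun a => Ordinal (encode_lt a)) => [c|a] _; last exact: encodeK.
by apply/val_inj; rewrite /= decK.
Qed.

Definition chart c g := dotp (dec c) (dec g).
Definition xort c g := encode_vec (dec c + dec g)%R.

End Codes.

Section CardMatching.
Variables (E V : finType) (lo hi : E -> V).
Hypothesis lohi : forall e, lo e != hi e.

(** Double counting of the pairs of an edge and one of its ends. *)
Lemma card_matches (M : {set E}) : matches lo hi (enum V) M -> 2 * #|M| = #|V|.
Proof.
move/forallP => h.
transitivity (\sum_(x : V) deg lo hi M x); last first.
  by rewrite (eq_bigr (fun=> 1)) ?sum1_card // => x _; rewrite (eqP (h x)) mem_enum.
rewrite /deg; under eq_bigr => x _ do rewrite -sum1dep_card big_mkcondr.
rewrite exchange_big /= mulnC -sum_nat_const; apply: eq_bigr => e _.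
rewrite -big_mkcond /= sum1dep_card.
have -> : [set x | at_end lo hi e x] = [set lo e; hi e].
  by apply/setP => x; rewrite !inE /at_end !(eq_sym x).
by rewrite cards2 lohi.
Qed.

End CardMatching.

(** * The graph whose edges are the slots *)

Section Slots.
Variables (t n h wm al : nat) (a0 g0 : nat -> nat).
Local Notation T2 := (2 ^ t).
Local Notation Ns := (n * n * T2).
Hypothesis n2h : n = 2 * h.
Hypothesis n_gt1 : 1 < n.
Hypothesis g0_w : forall d, d < Ns -> g0 d != 0 -> a0 (4 * g0 d + 1) <= wm.
Hypothesis g0_uv : forall d, d < Ns -> g0 d != 0 -> du n T2 d < dv n T2 d.

Let x0 : 'I_n := Ordinal (ltnW n_gt1).
Let x1 : 'I_n := Ordinal n_gt1.
(** A slot that does not encode a pair u < v receives the dummy ends 0 and 1, so that every slot is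
    an edge with distinct ends, as [pf_matchings] demands. Such slots are empty and carry the value
    0. *)
Definition slo (d : 'I_Ns) : 'I_n := if du n T2 d < dv n T2 d then insubd x0 (du n T2 d) else x0.
Definition shi (d : 'I_Ns) : 'I_n := if du n T2 d < dv n T2 d then insubd x0 (dv n T2 d) else x1.

Lemma T2_pos' : 0 < T2. Proof. by rewrite expn_gt0. Qed.

Lemma dv_lt d : dv n T2 d < n.
Proof. by rewrite ltn_mod; lia. Qed.

Lemma slohi d : slo d != shi d.
Proof.
rewrite /slo /shi; case: ifP => // lt; apply/eqP => /(congr1 val).
by rewrite !val_insubd (ltn_trans lt) dv_lt // => e; rewrite e ltnn in lt.
Qed.

Lemma slohiE (d : 'I_Ns) : g0 d != 0 -> val (slo d) = du n T2 d /\ val (shi d) = dv n T2 d.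
Proof.
move=> nz; have lt := g0_uv (ltn_ord d) nz.
by rewrite /slo /shi lt !val_insubd (ltn_trans lt) dv_lt.
Qed.

Definition act (g : nat -> nat) : {set 'I_Ns} := [set d : 'I_Ns | g d != 0].
(** The possible contents of array 1 once some slots have been deleted. *)
Definition gsub (g : nat -> nat) := forall d, d < Ns -> g d != 0 -> g d = g0 d.
Definition wD dj (D : {set 'I_Ns}) := \sum_(d in D) a0 (4 * g0 d + 1) %/ dj.
Definition smatch := matches slo shi (enum 'I_n).
Definition sfeas (D : {set 'I_Ns}) :=
  [&& D \subset act g0, smatch D & (\sum_(d in D) dec t (d %% T2) == dec t al)%R].

Lemma card_sfeas D : sfeas D -> #|D| = h.
Proof.
case/and3P=> _ /(card_matches slohi) hD _; rewrite card_ord in hD.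
by apply/eqP; rewrite -(eqn_pmul2l (isT : 0 < 2)) hD {1}n2h.
Qed.

Lemma wD_le dj D : sfeas D -> wD dj D <= h * wm.
Proof.
move=> hD; rewrite -(card_sfeas hD) -sum_nat_const; apply: leq_sum => d dD.
apply: leq_trans (leq_div _ _) _; apply: g0_w => //.
by case/and3P: hD => /subsetP /(_ _ dD); rewrite inE.
Qed.

Variables (p lg : nat).
Hypothesis p_pr : prime p.
Hypothesis p_gt2 : 2 < p.
Let Np := h * wm + 1.
Hypothesis Np_lt : Np < p.
Hypothesis al_lt : al < T2.
Hypothesis wm_lt : h * wm < 2 ^ lg.

Variable sg : {set 'I_Ns} -> 'F_p.
Hypothesis sg_nz : forall D, smatch D -> (sg D != 0)%R.
Hypothesis sgE : forall z : 'I_Ns -> 'F_p, (pf x0 (arcs slo shi z) (enum 'I_n) =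
  \sum_(D | smatch D) sg D * \prod_(d in D) z d)%R.

Local Notation amxt := (amx p n T2).
Local Notation chi := (chart t).

Lemma sum_slot (z : nat -> 'F_p) (u v : 'I_n) :
  (\sum_(d < Ns | (du n T2 d == u) && (dv n T2 d == v)) z d = \sum_(g < T2) z (slot n T2 u v g))%R.
Proof.
have sl (g : 'I_T2) : slot n T2 u v g < Ns.
  rewrite /slot; apply: (@leq_trans ((u * n + v).+1 * T2)); first by rewrite mulSn; have := ltn_ord g; lia.
  by rewrite leq_mul2r idx_lt ?orbT.
have n0 : 0 < n by lia.
rewrite (reindex_onto (fun g => Ordinal (sl g)) (fun d => Ordinal (ltn_pmod d T2_pos'))) /=; last first.
  move=> d /andP[/eqP hu /eqP hv]; apply/val_inj; rewrite /= /slot -hu -hv /du /dv.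
  by rewrite -divn_eq -divn_eq.
apply: eq_big => //= g; apply/andP; rewrite /du /dv /slot divnMDl ?T2_pos' //.
rewrite (divn_small (ltn_ord g)) addn0 divnMDl // modnMDl (divn_small (ltn_ord v)) addn0 modn_small // !eqxx.
by split=> //; apply/eqP/val_inj; rewrite /= modnMDl modn_small.
Qed.

Definition zval dj g X y c (d : nat) : 'F_p :=
  (if g d == 0%N then 0 else (-1) ^+ chi c (d %% T2) * ((X d)%:R * y%:R ^+ (a0 (4 * g d + 1) %/ dj)))%R.

Lemma amx_arcs dj g X y c (u v : 'I_n) : gsub g ->
  amxt dj a0 g X chi y c u v = arcs slo shi (fun d => zval dj g X y c d) u v.
Proof.
move=> hg; have n0 : 0 < n by lia.
have tE (x x' : 'I_n) : (\sum_(d | (slo d == x) && (shi d == x')) zval dj g X y c d =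
    tval p n T2 dj a0 g X chi y c x x')%R.
  transitivity (\sum_(d < Ns | (du n T2 d == x) && (dv n T2 d == x')) zval dj g X y c d)%R.
    rewrite [LHS]big_mkcond [RHS]big_mkcond; apply: eq_bigr => d _.
    case: (eqVneq (g d) 0) => [z|nz]; first by rewrite /zval z eqxx !if_same.
    have [e1 e2] : val (slo d) = du n T2 d /\ val (shi d) = dv n T2 d by apply: slohiE; rewrite -hg.
    by rewrite -!val_eqE e1 e2.
  rewrite sum_slot; apply: eq_bigr => ga _; rewrite /zval /sterm.
  by rewrite [slot _ _ _ _ _ %% _]modnMDl modn_small.
have t0 (x x' : 'I_n) : x' <= x -> tval p n T2 dj a0 g X chi y c x x' = 0%R.
  move=> le; rewrite -tE big1 // => d /andP[/eqP e1 /eqP e2]; rewrite /zval.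
  case: eqVneq => // nz; have nz0 : g0 d != 0 by rewrite -hg.
  have [e3 e4] := slohiE nz0; have := g0_uv (ltn_ord d) nz0.
  by rewrite -e3 -e4 e1 e2 ltnNge le.
rewrite /arcs !tE /amx; case: ltngtP => [lt|lt|e].
- by rewrite (t0 v u) ?subr0 // ltnW.
- by rewrite (t0 u v) ?sub0r // ltnW.
- by rewrite !t0 ?subr0 // e.
Qed.

(** Each Pfaffian is a signed sum over slot matchings in which a slot carries a character value of
    its parity. Multiplicativity merges these values and the one at alpha into the character at
    alpha plus the parity of the matching; by orthogonality only matchings of parity alpha remain,
    as x = -x over GF(2). *)
Lemma charsumE dj g X y : gsub g ->
  (charsum p n T2 dj al a0 g X chi y T2 = 2%:R ^+ t *
   \sum_(D | sfeas D && (D \subset act g)) sg D * (\prod_(d in D) (X d)%:R) * y%:R ^+ wD dj D)%R.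
Proof.
move=> hg; rewrite /charsum.
transitivity (\sum_(c < T2) \sum_(D | smatch D && (D \subset act g)) bsgn 'F_p (dotp (dec t c) (dec t al + \sum_(d in D) dec t (d %% T2)))
   * (sg D * (\prod_(d in D) (X d)%:R) * y%:R ^+ wD dj D))%R.
  apply: eq_bigr => c _.
  have -> : pf 0%N (amxt dj a0 g X chi y c) (iota 0 n) = pf x0 (arcs slo shi (fun d => zval dj g X y c d)) (enum 'I_n).
    by rewrite -val_enum_ord; apply: pf_map => u v _ _; rewrite amx_arcs.
  rewrite sgE big_distrr /= [RHS]big_mkcondr /=; apply: eq_bigr => D mD.
  case: ifP => [sD|/subsetPn[d dD]]; last first.
    by rewrite inE negbK => z; rewrite (bigD1 d) //= /zval z !(mul0r, mulr0).
  rewrite dotpDr /bsgn signr_addb -/(bsgn 'F_p (dotp _ (\sum_(d in D) _))) dotp_sum -!mulrA; congr (_ * _)%R.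
  rewrite [RHS]mulrCA; congr (_ * _)%R; rewrite /wD -prodrXr -!big_split /=; apply: eq_bigr => d dD.
  have := subsetP sD d dD; rewrite inE => nz; rewrite /zval (negbTE nz) hg //.
rewrite exchange_big /= big_distrr /= [RHS]big_mkcond [LHS]big_mkcond /=; apply: eq_bigr => D _.
rewrite /sfeas; case: (boolP (smatch D)) => mD; last by rewrite andbF.
case: (boolP (D \subset act g)) => sD /=; last by rewrite !andbF.
have -> /= : D \subset act g0.
  by apply: subset_trans sD _; apply/subsetP => d; rewrite !inE => nz; rewrite -hg.
rewrite -big_distrl /= (sum_dec (fun a => bsgn 'F_p (dotp a (dec t al + \sum_(d in D) dec t (d %% T2)))))%R.
rewrite sum_characters ?two_neq0 //.
have -> : (dec t al + \sum_(d in D) dec t (d %% T2) == 0)%R = (\sum_(d in D) dec t (d %% T2) == dec t al)%R.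
  have oppE (x : 'rV['F_2]_t) : (- x = x)%R.
    by apply/rowP => j; rewrite mxE; case: (x 0%R j) => [[|[|//]] ?]; apply/val_inj.
  by rewrite addrC -{1}[dec t al]oppE subr_eq0.
by case: ifP => _; rewrite ?andbT ?mul0r // andbF.
Qed.

Definition msum dj g k (X : nat -> nat) : 'F_p :=
  (\sum_(D | [&& sfeas D, D \subset act g & wD dj D == k]) sg D * (\prod_(d in D) (X d)%:R))%R.

Lemma nat_neq0 i : 0 < i -> i <= Np -> (i%:R != 0 :> 'F_p)%R.
Proof.
move=> i0 iN; rewrite -(dvdn_pcharf (pchar_Fp p_pr)); apply/negP => /(dvdn_leq i0).
by move: Np_lt; lia.
Qed.

(** Since [k] is at most every occurring weight, the factor (i + 1)^(-k) turns (i + 1)^w into (i +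
    1)^(w - k) with a natural exponent below [Np], to which [findiff] applies. *)
Lemma testsumE dj g k X : gsub g ->
  (forall D, sfeas D -> D \subset act g -> k < 2 ^ lg /\ k <= wD dj D) ->
  (testsum p n lg T2 dj Np al a0 g X chi k Np = - (2%:R ^+ t * msum dj g k X))%R.
Proof.
move=> hg hk; rewrite /testsum.
transitivity (2%:R ^+ t * \sum_(D | sfeas D && (D \subset act g)) sg D * (\prod_(d in D) (X d)%:R) *
   \sum_(i < Np) (-1) ^+ i.+1 * 'C(Np, i.+1)%:R * (i.+1%:R ^+ (wD dj D - k)) : 'F_p)%R.
  rewrite big_distrr /=; under [RHS]eq_bigr => D _ do rewrite !big_distrr /=.
  rewrite [RHS]exchange_big /=; apply: eq_bigr => i _; rewrite charsumE // !big_distrr /=.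
  apply: eq_bigr => D /andP[fD sD]; have [k1 k2] := hk D fD sD.
  have i0 := nat_neq0 (isT : 0 < i.+1) (ltn_ord i).
  rewrite (modn_small k1) -{1}(subnK k2) exprD exprVn.
  by field; rewrite expf_neq0.
rewrite /msum -mulrN; congr (_ * _)%R; rewrite -sumrN.
rewrite [LHS]big_mkcond [RHS]big_mkcond /=; apply: eq_bigr => D _.
case: (boolP (sfeas D)) => //= fD; case: (boolP (D \subset act g)) => //= sD.
have [_ k2] := hk D fD sD; have wb := wD_le dj fD.
have lt : wD dj D - k < Np by rewrite /Np; lia.
(* The program omits y = 0, which has no inverse. That term is 0^(w - k), equal to 1 if w = k and to
   0 otherwise, so the sum over positive y is -1 or 0 accordingly. *)
have := findiff 'F_p lt; rewrite big_ord_recl /= expr0 bin0 !mul1r => /eqP; rewrite addrC addr_eq0.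
under eq_bigr => i _ do rewrite /bump /= add1n.
move=> /eqP ->; rewrite expr0n subn_eq0; case: (eqVneq (wD dj D) k) => [->|ne].
  by rewrite leqnn mulrN mulr1.
by rewrite (_ : (wD dj D <= k) = false) ?oppr0 ?mulr0 //; apply/negbTE; rewrite -ltnNge ltn_neqAle eq_sym ne.
Qed.

Lemma tstE dj g k X : gsub g ->
  (forall D, sfeas D -> D \subset act g -> k < 2 ^ lg /\ k <= wD dj D) ->
  tst p n lg T2 Np al a0 X chi dj g k = (msum dj g k X != 0)%R.
Proof.
move=> hg hk; rewrite /tst testsumE // oppr_eq0 mulf_eq0 negb_or.
by rewrite expf_neq0 // two_neq0.
Qed.

Lemma msum0 dj g k X : (forall D, sfeas D -> D \subset act g -> wD dj D != k) -> msum dj g k X = 0%R.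
Proof. by move=> hD; rewrite /msum big1 // => D /and3P[h1 h2 /eqP h3]; have := hD D h1 h2; rewrite h3 eqxx. Qed.

Variable q : nat.
Hypothesis wm_q : wm < 2 ^ q.
Hypothesis q_p : 2 ^ q < p.

Local Notation tstt X := (tst p n lg T2 Np al a0 X chi).
Local Notation levs X := (levels p n h lg T2 Np al q a0 X chi g0).
Local Notation delt X := (dels p n lg T2 Np al a0 X chi).

Definition within g dj k D := [&& sfeas D, D \subset act g & wD dj D == k].

Lemma feas_act D : sfeas D -> D \subset act g0. Proof. by case/and3P. Qed.

Lemma scan_none X dj k i : (forall D, ~~ sfeas D) -> iter i (sstep p n lg T2 Np al a0 X chi dj g0) (k, false) = (k + i, false).
Proof.
move=> nf; elim: i => [|i IH]; first by rewrite addn0.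
rewrite iterS IH /sstep /= tstE ?msum0 ?eqxx ?addnS // => D fD; by have := nf D; rewrite fD.
Qed.

Definition djl l := 2 ^ q %/ 2 ^ l.

Lemma levels_S X l : (levs X l.+1).1 =
  iter h.+1 (sstep p n lg T2 Np al a0 X chi (djl l) g0) (2 * (levs X l).1.1, false).
Proof. by rewrite {1}/levels iterS -/(levels _ _ _ _ _ _ _ _ _ _ _ _ l) {1}/lstep levels_dj. Qed.

Lemma levels_none X l : (forall D, ~~ sfeas D) -> (levs X l).1.2 = false.
Proof. by move=> nf; case: l => // l; rewrite levels_S scan_none. Qed.

(** * The search when a solution exists *)

Section Feasible.
Variables (D0 : {set 'I_Ns}).
Hypothesis D0_feas : sfeas D0.

Definition minw dj := wD dj [arg min_(D < D0 | sfeas D) wD dj D].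

Lemma minw_le dj D : sfeas D -> minw dj <= wD dj D.
Proof. by rewrite /minw; case: arg_minnP => // D1 _ h1; apply: h1. Qed.

Lemma minwP dj : exists D, within g0 dj (minw dj) D.
Proof.
rewrite /minw; case: arg_minnP => // D1 f1 _; exists D1.
by rewrite /within f1 eqxx (feas_act f1).
Qed.

Lemma minw_lg dj : minw dj < 2 ^ lg.
Proof. by apply: leq_ltn_trans wm_lt; apply: leq_trans (minw_le dj D0_feas) (wD_le dj D0_feas). Qed.

Definition good_level X l := (msum (djl l) g0 (minw (djl l)) X != 0)%R.

(** Every candidate that is tested is at most the minimum, as [tstE] requires. Below the minimum the
    tested sum is empty, so the scan cannot stop early. *)
Lemma scan_min X dj k : (msum dj g0 (minw dj) X != 0)%R -> k <= minw dj <= k + h ->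
  iter h.+1 (sstep p n lg T2 Np al a0 X chi dj g0) (k, false) = (minw dj, true).
Proof.
move=> hm /andP[h1 h2].
have tE k' : k' <= minw dj -> tstt X dj g0 k' = (k' == minw dj).
  move=> le; rewrite tstE //; last first.
    move=> D fD _; split; first exact: leq_ltn_trans le (minw_lg dj).
    exact: leq_trans le (minw_le dj fD).
  case: (eqVneq k' (minw dj)) => [->|ne]; first by rewrite hm.
  rewrite msum0 ?eqxx // => D fD _.
  by have := minw_le dj fD; move: le ne; clear; lia.
have s1 i : i <= minw dj - k -> iter i (sstep p n lg T2 Np al a0 X chi dj g0) (k, false) = (k + i, false).
  elim: i => [|i IH] hi; first by rewrite addn0.
  rewrite iterS IH; last by lia.
  rewrite /sstep /= tE; last by lia.
  by rewrite (_ : (k + i == minw dj) = false) ?addnS //; lia.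
have s2 i : iter i (sstep p n lg T2 Np al a0 X chi dj g0) (minw dj, true) = (minw dj, true).
  by elim: i => // i IH; rewrite iterS IH.
rewrite (_ : h.+1 = h - (minw dj - k) + (minw dj - k).+1); last by move: h2; lia.
rewrite iterD iterS s1 // (_ : k + (minw dj - k) = minw dj); last by lia.
by rewrite /sstep /= tE // eqxx s2.
Qed.

(** The integer part of a/d is twice that of a/(2d) or one more, and a feasible set has h slots. *)
Lemma wD_double d D : 0 < d -> sfeas D -> 2 * wD (2 * d) D <= wD d D <= 2 * wD (2 * d) D + h.
Proof.
move=> d0 fD; rewrite -(card_sfeas fD) /wD big_distrr /= -sum1_card -big_split /=.
have aux a : 2 * (a %/ (2 * d)) <= a %/ d <= 2 * (a %/ (2 * d)) + 1.
  have -> : a %/ (2 * d) = (a %/ d) %/ 2 by rewrite mulnC divnMA.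
  by move: (a %/ d) => x; lia.
by apply/andP; split; apply: leq_sum => e _; case/andP: (aux (a0 (4 * g0 e + 1))).
Qed.

Lemma minw_double d : 0 < d -> 2 * minw (2 * d) <= minw d <= 2 * minw (2 * d) + h.
Proof.
move=> d0; have [D /and3P[fD _ /eqP eD]] := minwP d; have [D' /and3P[fD' _ /eqP eD']] := minwP (2 * d).
have /andP[h1 _] := wD_double d0 fD; have /andP[_ h2] := wD_double d0 fD'.
have h3 := minw_le d fD'; have h4 := minw_le (2 * d) fD.
by rewrite -{1 2}eD -{1 2}eD' in h1 h2 h3 h4 *; lia.
Qed.

(** At level 0 the divisor 2^q exceeds all weights, so the minimum is 0, which is where the scan
    starts. From then on [minw_double] puts the minimum into the window of h + 1 candidates. *)
Lemma levels_ok X l : (forall l, l <= q -> good_level X l) -> l <= q ->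
  (levs X l.+1).1 = (minw (djl l), true).
Proof.
move=> hg; elim: l => [|l IH] hl.
  have e0 : djl 0 = 2 ^ q by rewrite /djl divn1.
  rewrite levels_S scan_min //; first exact: hg.
  rewrite muln0 add0n /=; apply: (@leq_trans 0) => //; rewrite leqn0; apply/eqP.
  have [D /and3P[fD _ /eqP <-]] := minwP (djl 0).
  rewrite /wD big1 //= => d dD; rewrite e0 divn_small //; apply: leq_ltn_trans wm_q; apply: g0_w => //.
  by have := subsetP (feas_act fD) d dD; rewrite inE.
have {}IH := IH (ltnW hl).
have e1 : djl l = 2 * djl l.+1.
  rewrite /djl -!expnB // ?(ltnW hl) // -expnS; congr (2 ^ _); lia.
by rewrite levels_S IH scan_min //; [exact: hg|rewrite [(_, true).1]/= e1; apply: minw_double; rewrite divn_gt0 ?expn_gt0 // leq_exp2l].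
Qed.

Let k := minw 1.

Definition has_opt g := [exists D, within g 1 k D].

(** A deletion step that consults the truth instead of a test. The sequence [ideal] does not involve
    the random weights, which makes the events [good_del] amenable to a union bound. *)
Definition idstep g d := if (g d != 0) && has_opt (upd g d 0) then upd g d 0 else g.
Definition ideal m := foldl idstep g0 (iota 0 m).
Definition good_del X d :=
  has_opt (upd (ideal d) d 0) ==> (msum 1 (upd (ideal d) d 0) k X != 0)%R.

Lemma idealS m : ideal m.+1 = idstep (ideal m) m.
Proof. by rewrite /ideal -[m.+1]addn1 iotaD foldl_cat. Qed.

Lemma gsub_upd g d : gsub g -> gsub (upd g d 0).
Proof. by move=> hg d' hd'; rewrite /upd; case: ifP => // _; apply: hg. Qed.

Lemma ideal_sub m : gsub (ideal m).
Proof.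
elim: m => // m IH; rewrite idealS /idstep; case: ifP => // _; exact: gsub_upd.
Qed.

(** An error could only be a wrong refusal to delete, which [good_del] excludes: when no optimum
    survives the deletion, the tested sum is empty and the test fails with certainty. *)
Lemma dels_ok X m : (forall d, d < Ns -> good_del X d) -> m <= Ns -> delt X k g0 m = ideal m.
Proof.
move=> hg; elim: m => // m IH hm.
have -> : delt X k g0 m.+1 = dstep p n lg T2 Np al a0 X chi k (delt X k g0 m) m.
  by rewrite /dels -[m.+1]addn1 iotaD foldl_cat.
rewrite (IH (ltnW hm)) idealS /dstep /idstep; case: eqVneq => //= nz.
have hs : gsub (upd (ideal m) m 0) by apply: gsub_upd; apply: ideal_sub.
rewrite tstE //; last by move=> D fD _; split; [apply: minw_lg|apply: minw_le].
have := hg m hm; rewrite /good_del; case: (boolP (has_opt _)) => [_ /= ->//|no _].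
rewrite msum0 ?eqxx // => D fD sD; apply: contra no => wk; apply/existsP; exists D.
by rewrite /within fD sD wk.
Qed.

Lemma has_opt_ideal m : has_opt (ideal m).
Proof.
elim: m => [|m IH]; first by apply/existsP; exact: minwP.
by rewrite idealS /idstep; case: ifP => // /andP[].
Qed.

Lemma has_opt_mono g g' : act g \subset act g' -> has_opt g -> has_opt g'.
Proof.
move=> s /existsP[D /and3P[h1 h2 h3]]; apply/existsP; exists D.
by rewrite /within h1 h3 (subset_trans h2 s).
Qed.

(** A slot kept in its own round was indispensable then; deleting further slots can only make it
    more so, by [has_opt_mono]. *)
Lemma ideal_min m d : d < m -> ideal m d != 0 -> ~~ has_opt (upd (ideal m) d 0).
Proof.
elim: m => // m IH; rewrite ltnS leq_eqVlt idealS /idstep => /orP[/eqP->|lt].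
  case: ifP => [_|nb nz]; first by rewrite /upd eqxx.
  by move: nb; rewrite nz /= => ->.
case: ifP => [_|_]; last exact: IH.
rewrite {1}/upd; case: ifP => // _ nz; apply: contra (IH lt nz); apply: has_opt_mono.
by apply/subsetP => e; rewrite !inE /upd; case: ifP => // _; case: ifP.
Qed.

(** Some optimum [D] survives, and no other slot can be left: being outside [D], it would not be
    indispensable. *)
Lemma ideal_opt : exists D, [/\ sfeas D, wD 1 D = k & forall d : 'I_Ns, (ideal Ns d != 0) = (d \in D)].
Proof.
have /existsP[D /and3P[fD sD /eqP wDk]] := has_opt_ideal Ns.
exists D; split=> // d; apply/idP/idP => [nz|dD]; last by have := subsetP sD d dD; rewrite inE.
case: (boolP (d \in D)) => // dD; have := ideal_min (ltn_ord d) nz => /negP[].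
apply/existsP; exists D; rewrite /within fD wDk eqxx andbT /=; apply/subsetP => e eD.
have := subsetP sD e eD; rewrite !inE /upd; case: ifP => // /eqP/val_inj ed.
by rewrite -ed eD in dD.
Qed.

Definition good X := (forall l, l <= q -> good_level X l) /\ (forall d, d < Ns -> good_del X d).

Lemma search_ok X : good X ->
  let L := levs X q.+1 in
  L.1.2 /\ exists D, [/\ sfeas D, forall D', sfeas D' -> wD 1 D <= wD 1 D' &
    let o := outs (delt X L.1.1 g0 Ns) Ns in
    size o = h /\ forall e, (e \in o) = [exists d in D, e == (g0 d).-1]].
Proof.
move=> [hl hd] L.
have eL : L.1 = (k, true) by rewrite /L levels_ok // /djl divnn expn_gt0.
rewrite eL; split=> //; have [D [fD wDk hD]] := ideal_opt; exists D; split=> //.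
  by move=> D' fD'; rewrite wDk; apply: minw_le.
rewrite /= dels_ok // /outs; split.
  rewrite size_map size_filter -(card_sfeas fD) -val_enum_ord count_map cardE /enum_mem size_filter.
  rewrite (eq_count (a2 := fun d : 'I_Ns => d \in D)); last exact: hD.
  by rewrite (eq_filter (a2 := predT)) ?filter_predT.
move=> e; apply/mapP/existsP => [[d]|[d /andP[dD /eqP->]]].
  rewrite mem_filter mem_iota add0n => /andP[nz /andP[_ lt]] ->.
  by exists (Ordinal lt); rewrite -hD nz /= (ideal_sub lt nz).
exists (val d); first by rewrite mem_filter hD dD mem_iota /= ltn_ord.
by rewrite (ideal_sub (ltn_ord d)) // hD.
Qed.

Definition Xf (f : {ffun 'I_Ns * 'I_q -> bool}) d :=
  horner (fun i => if (insub d, insub i) is (Some d', Some i') then f (d', i') else false) q.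

Lemma horner_ext b b' i : (forall j, j < i -> b j = b' j) -> horner b i = horner b' i.
Proof. by elim: i => //= i IH hb; rewrite hb // IH // => j hj; apply: hb; apply: ltnW. Qed.

(** The Schwartz-Zippel lemma in degree h, with the q-bit strings as sample set; they inject into
    the field because 2^q < p. The set [D] provides a non-zero coefficient. *)
Lemma msum_zeros dj g k' D : within g dj k' D ->
  #|[set f | msum dj g k' (Xf f) == 0%R]| * 2 ^ q <= h * 2 ^ (Ns * q).
Proof.
move=> hD; pose c M := if within g dj k' M then sg M else 0%R : 'F_p.
pose hb (u : {ffun 'I_q -> bool}) i := if insub i is Some i' then u i' : nat else 0.
have hb1 u i : i < q -> hb u i <= 1.
  by move=> hi; rewrite /hb insubT; case: (u _).
pose v (u : {ffun 'I_q -> bool}) : 'F_p := (horner (hb u) q)%:R%R.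
have v_inj : injective v.
  move=> u u' e.
  have b1 u1 : horner (hb u1) q < p by apply: ltn_trans q_p; apply: horner_lt; exact: hb1.
  have {}e : horner (hb u) q = horner (hb u') q.
    have := congr1 (fun x : 'F_p => nat_of_ord x) e; rewrite !val_Fp_nat //.
    by rewrite !modn_small.
  apply/ffunP => i; have := horner_inj (hb1 u) (hb1 u') e (ltn_ord i).
  by rewrite /hb valK; case: (u i); case: (u' i).
have hc M : (c M != 0%R) -> #|M| <= h.
  by rewrite /c; case: ifP => [/and3P[fM _ _] _|_]; [rewrite card_sfeas|rewrite eqxx].
have hc0 : c D != 0%R by rewrite /c hD sg_nz //; case/and3P: hD => /and3P[].
have := schwartz_zippel v_inj hc hc0; rewrite !card_ffun !card_bool !card_ord -expnM (mulnC q).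
apply: leq_trans; rewrite leq_mul2r; apply/orP; right.
pose cur (f : {ffun 'I_Ns * 'I_q -> bool}) := [ffun d => [ffun i => f (d, i)]].
have cur_inj : injective cur.
  move=> f f' /ffunP e; apply/ffunP => -[d i]; have := e d; rewrite !ffunE => /ffunP /(_ i).
  by rewrite !ffunE.
rewrite -(card_imset _ cur_inj); apply: subset_leq_card; apply/subsetP => x /imsetP[f].
rewrite !inE => /eqP hf ->; rewrite -hf /mpeval /msum; apply/eqP; rewrite [RHS]big_mkcond /=; apply: eq_bigr => M _.
rewrite /c /within; case: ifP => _; last by rewrite mul0r.
congr (_ * _)%R; apply: eq_bigr => d _; rewrite /v ffunE; congr (_%:R)%R; apply: horner_ext => i hi.
by rewrite /hb valK insubT ffunE.
Qed.

Definition goodb X := [forall l : 'I_q.+1, good_level X l] && [forall d : 'I_Ns, good_del X d].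

Lemma goodbP X : reflect (good X) (goodb X).
Proof.
apply: (iffP andP) => [[/forallP h1 /forallP h2]|[h1 h2]]; split.
- by move=> l hl; exact: (h1 (Ordinal (hl : l < q.+1))).
- by move=> d hd; exact: (h2 (Ordinal hd)).
- by apply/forallP => l; apply: h1; rewrite -ltnS.
- by apply/forallP => d; apply: h2.
Qed.

(** The union bound over the q + 1 levels and the [Ns] deletions, each failing for at most h out of
    every 2^q weight assignments. *)
Lemma bad_count : #|[set f | ~~ goodb (Xf f)]| * 2 ^ q <= (q.+1 + Ns) * h * 2 ^ (Ns * q).
Proof.
pose B1 (l : 'I_q.+1) := [set f | ~~ good_level (Xf f) l].
pose B2 (d : 'I_Ns) := [set f | ~~ good_del (Xf f) d].
have sub : [set f | ~~ goodb (Xf f)] \subset (\bigcup_l B1 l) :|: (\bigcup_d B2 d).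
  apply/subsetP => f; rewrite !inE negb_and !negb_forall => /orP[] /existsP[l hl]; apply/orP.
    by left; apply/bigcupP; exists l; rewrite ?inE.
  by right; apply/bigcupP; exists l; rewrite ?inE.
have un (I : finType) (B : I -> {set {ffun 'I_Ns * 'I_q -> bool}}) :
    (forall i, #|B i| * 2 ^ q <= h * 2 ^ (Ns * q)) -> #|\bigcup_i B i| * 2 ^ q <= #|I| * (h * 2 ^ (Ns * q)).
  move=> hB; rewrite -[leqRHS]sum_nat_const.
  apply: (@leq_trans (\sum_i #|B i| * 2 ^ q)); last exact: leq_sum.
  rewrite -big_distrl leq_mul2r; apply/orP; right.
  elim/big_rec2: _ => [|i m S _ IH]; first by rewrite cards0.
  by apply: leq_trans (leq_card_setU _ _) _; rewrite leq_add2l.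
have c1 (l : 'I_q.+1) : #|B1 l| * 2 ^ q <= h * 2 ^ (Ns * q).
  have [D hD] := minwP (djl l); apply: leq_trans (msum_zeros hD).
  by rewrite leq_mul2r; apply/orP; right; apply: subset_leq_card; apply/subsetP => f; rewrite !inE negbK.
have c2 (d : 'I_Ns) : #|B2 d| * 2 ^ q <= h * 2 ^ (Ns * q).
  rewrite /B2 /good_del; case: (boolP (has_opt _)) => [/existsP[D hD]|_].
    apply: leq_trans (msum_zeros hD).
    by rewrite leq_mul2r; apply/orP; right; apply: subset_leq_card; apply/subsetP => f; rewrite !inE negbK.
  by rewrite (_ : [set _ | _] = set0) ?cards0 //; apply/setP => f; rewrite !inE.
have h1 := un _ _ c1; have h2 := un _ _ c2; rewrite !card_ord in h1 h2.
apply: leq_trans (leq_mul (subset_leq_card sub) (leqnn _)) _.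
apply: leq_trans (leq_mul (leq_card_setU _ _) (leqnn _)) _.
have -> : (q.+1 + Ns) * h * 2 ^ (Ns * q) = q.+1 * (h * 2 ^ (Ns * q)) + Ns * (h * 2 ^ (Ns * q)).
  by move: (2 ^ (Ns * q)) Ns => x y; ring.
by rewrite [leqLHS]mulnDl leq_add.
Qed.

Lemma msum_ext dj g k' X X' : (forall d, d < Ns -> X d = X' d) -> msum dj g k' X = msum dj g k' X'.
Proof. by move=> e; apply: eq_bigr => D _; congr (_ * _)%R; apply: eq_bigr => d _; rewrite e. Qed.

Lemma goodb_ext X X' : (forall d, d < Ns -> X d = X' d) -> goodb X = goodb X'.
Proof.
move=> e; congr (_ && _); apply: eq_forallb => i; rewrite /good_level /good_del (msum_ext _ _ _ e) //.
Qed.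

End Feasible.

End Slots.

(** * Instances and slots *)

Lemma nth_blocks (T : Type) (f : T -> seq nat) (s : seq T) x k i j :
  (forall y, size (f y) = k) -> i < size s -> j < k ->
  nth 0 (flatten (map f s)) (k * i + j) = nth 0 (f (nth x s i)) j.
Proof.
move=> fk; elim: s i => // y s IH [|i] hi hj /=; rewrite nth_cat fk.
  by rewrite muln0 hj.
by rewrite mulnS ifF -?IH //; [congr nth; lia|lia].
Qed.

(** * Layout of the input *)

Section Encoding.
Variables (t : nat) (I : instance t).
Local Notation inp := (nth 0 (encode I)).

Lemma size_encode : size (encode I) = 3 + 4 * ne I.
Proof.
rewrite size_cat size_flatten /shape -map_comp sumnE big_map /=.
by rewrite big_const_seq count_predT -cardE card_ord iter_addn_0.
Qed.

Lemma inp_edge (e : 'I_(ne I)) : [/\ inp (4 * e + 3) = (ends e).1, inp (4 * e + 4) = (ends e).2,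
  inp (4 * e + 5) = wt e & inp (4 * e + 6) = encode_vec (par e)].
Proof.
have main j : j < 4 -> inp (4 * e + 3 + j) =
    nth 0 [:: val (ends e).1; val (ends e).2; wt e; encode_vec (par e)] j.
  move=> hj; rewrite /encode nth_cat /= ifF; last by lia.
  rewrite (_ : 4 * e + 3 + j - 3 = 4 * e + j); last by lia.
  by rewrite (nth_blocks e) ?size_enum_ord // nth_ord_enum.
by split; [have := main 0 isT|have := main 1 isT|have := main 2 isT|have := main 3 isT];
  rewrite ?addn0 // -addnA.
Qed.

Lemma wmx_wmax : wmx (fun e => inp (4 * e + 5)) (ne I) = wmax I.
Proof. by apply: eq_bigr => e _; have [_ _ -> _] := inp_edge e. Qed.

End Encoding.

(** * Slot sets and edge sets *)

Section Translation.
Variables (t : nat) (I : instance t).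
Local Notation T2 := (2 ^ t).
Local Notation n := (nv I).
Local Notation Ns := (n * n * T2).
Local Notation inp := (nth 0 (encode I)).
Let eu e := inp (4 * e + 3).
Let ev' e := inp (4 * e + 4).
Let wt' e := inp (4 * e + 5).
Let ga e := inp (4 * e + 6).
Let al := encode_vec (demand I).

Lemma eu_lt e : e < ne I -> eu e < n.
Proof. by move=> he; rewrite /eu; have [-> _ _ _] := inp_edge (Ordinal he). Qed.

Lemma ev_lt e : e < ne I -> ev' e < n.
Proof. by move=> he; rewrite /ev'; have [_ -> _ _] := inp_edge (Ordinal he). Qed.

Lemma uv_ne e : e < ne I -> eu e != ev' e.
Proof. by move=> he; rewrite /eu /ev'; have [-> -> _ _] := inp_edge (Ordinal he); have := ends_neq (Ordinal he). Qed.

Lemma ga_lt e : e < ne I -> ga e < T2.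
Proof. by move=> he; rewrite /ga; have [_ _ _ ->] := inp_edge (Ordinal he); apply: encode_lt. Qed.

Variable g0 : nat -> nat.
Hypothesis g0_spec : gspec n T2 eu ev' wt' ga (ne I) g0.
Let h := n %/ 2.
Hypothesis n_gt1 : 1 < n.
Hypothesis n2h : n = 2 * h.

Definition cls e := ecls n T2 eu ev' ga e.

Lemma cls_lt (e : 'I_(ne I)) : cls e < Ns.
Proof.
have hu := eu_lt (ltn_ord e); have hv := ev_lt (ltn_ord e); have hg := ga_lt (ltn_ord e).
rewrite /cls /ecls /slot; apply: (@leq_trans ((minn (eu e) (ev' e) * n + maxn (eu e) (ev' e)).+1 * T2)).
  by rewrite mulSn; lia.
by rewrite leq_mul2r idx_lt ?orbT //; lia.
Qed.

Definition co (e : 'I_(ne I)) : 'I_Ns := Ordinal (cls_lt e).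

Lemma cls_ends (e : 'I_(ne I)) : [/\ du n T2 (cls e) = minn (ends e).1 (ends e).2,
  dv n T2 (cls e) = maxn (ends e).1 (ends e).2 & cls e %% T2 = encode_vec (par e)].
Proof.
have [e1 e2 _ e4] := inp_edge e; have hg := encode_lt (par e).
have T20 : 0 < T2 by rewrite expn_gt0.
have hm : maxn (ends e).1 (ends e).2 < n by have := ltn_ord (ends e).1; have := ltn_ord (ends e).2; lia.
rewrite /cls /ecls /eu /ev' /ga e1 e2 e4 /du /dv /slot !divnMDl // (divn_small hg) !addn0 modnMDl.
have n0 : 0 < n by lia.
by rewrite divnMDl // modnMDl (divn_small hm) addn0 !modn_small.
Qed.

Lemma g0_act (e : 'I_(ne I)) : g0 (cls e) != 0.
Proof.
case: (g0_spec (cls_lt e)) => [[_ h1]|[e' [_ -> _ _]] //].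
by have := h1 e (ltn_ord e); rewrite eqxx.
Qed.

Lemma g0_rep d : d < Ns -> g0 d != 0 -> exists e : 'I_(ne I), [/\ g0 d = e.+1, cls e = d &
  forall e' : 'I_(ne I), cls e' = d -> wt e <= wt e'].
Proof.
move=> hd nz; case: (g0_spec hd) => [[z _]|[e [e1 e2 e3 e4]]]; first by rewrite z in nz.
exists (Ordinal e1); split=> // e' ce; have := e4 e' (ltn_ord e') ce.
by rewrite /wt'; have [_ _ -> _] := inp_edge e'; have [_ _ -> _] := inp_edge (Ordinal e1).
Qed.

Lemma g0_uv d : d < Ns -> g0 d != 0 -> du n T2 d < dv n T2 d.
Proof.
move=> hd nz; have [e [_ <- _]] := g0_rep hd nz; have [-> -> _] := cls_ends e.
by have := ends_neq e; rewrite -val_eqE /=; lia.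
Qed.

Lemma g0_wE d (e : 'I_(ne I)) : g0 d = e.+1 -> inp (4 * g0 d + 1) = wt e.
Proof. by move=> ->; rewrite (_ : 4 * e.+1 + 1 = 4 * e + 5); [have [_ _ -> _] := inp_edge e|lia]. Qed.

Lemma g0_w d : d < Ns -> g0 d != 0 -> inp (4 * g0 d + 1) <= wmax I.
Proof.
move=> hd nz; have [e [e1 _ _]] := g0_rep hd nz; rewrite (g0_wE e1).
exact: (leq_bigmax e).
Qed.

Local Notation sloI := (@slo t n n_gt1).
Local Notation shiI := (@shi t n n_gt1).
Local Notation sfeasI := (@sfeas t n al g0 n_gt1).
Local Notation wDI := (@wD t n inp g0 1).

Lemma at_end_co e x : at_end sloI shiI (co e) x = (x \in endset e).
Proof.
have [e1 e2] := slohiE n2h n_gt1 g0_uv (g0_act e : g0 (co e) != 0); have [d1 d2 _] := cls_ends e.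
rewrite /at_end -!val_eqE /= e1 e2 /= d1 d2 !inE -!val_eqE /= !(eq_sym (val x)).
by rewrite /minn /maxn; case: ltnP => _ //; exact: orbC.
Qed.

Section OneSet.
Variable M : {set 'I_(ne I)}.
Hypothesis co_inj : {in M &, injective co}.

Lemma smatch_co : @smatch t n n_gt1 (co @: M) = perfect_matching M.
Proof.
apply: eq_forallb => x; rewrite mem_enum; congr (_ == _).
rewrite -(card_in_imset (f := co)); last by move=> e e'; rewrite !inE => /andP[h1 _] /andP[h2 _]; apply: co_inj.
apply: eq_card => d; rewrite !inE; apply/andP/imsetP => [[/imsetP[e eM ->]]|[e]].
  by rewrite at_end_co => hx; exists e => //; rewrite inE eM.
by rewrite inE => /andP[eM hx] ->; split; [exact: imset_f|rewrite at_end_co].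
Qed.

Lemma parity_co : (\sum_(d in co @: M) dec t (d %% T2) = parity M)%R.
Proof.
rewrite big_imset //=; apply: eq_bigr => e _.
by have [_ _ ->] := cls_ends e; rewrite encodeK.
Qed.

Lemma act_co : co @: M \subset act t n g0.
Proof. by apply/subsetP => d /imsetP[e _ ->]; rewrite inE g0_act. Qed.

Lemma feasible_co : sfeasI (co @: M) = feasible M.
Proof. by rewrite /sfeas act_co smatch_co parity_co /al encodeK. Qed.

Lemma weight_co : wDI (co @: M) <= weight M.
Proof.
rewrite /wD big_imset //=; apply: leq_sum => e _; rewrite divn1.
have [e' [e1 e2 e3]] := g0_rep (cls_lt e) (g0_act e).
by rewrite (g0_wE e1); apply: e3.
Qed.

Lemma weight_rep_co : (forall e, e \in M -> g0 (cls e) = e.+1) -> wDI (co @: M) = weight M.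
Proof.
by move=> hM; rewrite /wD big_imset //=; apply: eq_bigr => e eM; rewrite divn1 (g0_wE (hM e eM)).
Qed.

End OneSet.

(** Edges in the same slot share both ends, so a perfect matching contains at most one of them. *)
Lemma co_inj_matching M : perfect_matching M -> {in M &, injective co}.
Proof.
move=> /forallP pm e e' eM eM' ce; have := pm (ends e).1 => /cards1P[f hf].
have i1 : e \in [set e in M | (ends e).1 \in endset e].
  by rewrite inE eM !inE eqxx.
have i2 : e' \in [set e'' in M | (ends e).1 \in endset e''].
  by rewrite inE eM' -at_end_co -ce at_end_co !inE eqxx.
have : e \in [set e'' in M | (ends e).1 \in endset e''] by rewrite inE eM !inE eqxx.
by move: i2; rewrite hf !inE => /eqP -> /eqP ->.
Qed.

(** The stored, hence lightest, edges of the slots in [D]. *)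
Definition edges_of (D : {set 'I_Ns}) := [set e : 'I_(ne I) | (g0 (cls e) == e.+1) && (co e \in D)].

Lemma edges_of_inj D : {in edges_of D &, injective co}.
Proof.
move=> e e'; rewrite !inE => /andP[/eqP h1 _] /andP[/eqP h2 _] /(congr1 val) /= ce.
by apply/val_inj; move: h1; rewrite ce h2 => -[].
Qed.

Lemma co_edges_of (D : {set 'I_Ns}) : D \subset act t n g0 -> co @: edges_of D = D.
Proof.
move=> /subsetP sD; apply/setP => d; apply/imsetP/idP => [[e]|dD]; first by rewrite inE => /andP[_ ?] ->.
have := sD d dD; rewrite inE => nz; have [e [e1 e2 _]] := g0_rep (ltn_ord d) nz.
have ed : co e = d by apply/val_inj.
by exists e; rewrite // inE ed dD andbT e2 e1.
Qed.

(** A feasible edge set occupies distinct slots, and replacing each edge by the stored one of its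
    slot keeps it feasible without increasing its weight. *)
Lemma slot_optimal D : sfeasI D -> (forall D', sfeasI D' -> wDI D <= wDI D') -> optimal (edges_of D).
Proof.
move=> fD opt; have aD : D \subset act t n g0 by case/and3P: fD.
have inj := @edges_of_inj D; have cD := co_edges_of aD.
rewrite /optimal -(feasible_co inj) cD fD; apply/forallP => M; apply/implyP => fM.
have injM : {in M &, injective co} by apply: co_inj_matching; case/andP: fM.
rewrite -(weight_rep_co inj); last by move=> e; rewrite inE => /andP[/eqP].
rewrite cD; apply: leq_trans (weight_co injM); apply: opt.
by rewrite feasible_co.
Qed.

Lemma no_slot_no_feasible : (forall D, ~~ sfeasI D) -> ~~ [exists M : {set 'I_(ne I)}, feasible M].
Proof.
move=> nf; apply/existsP => -[M fM].
have injM : {in M &, injective co} by apply: co_inj_matching; case/andP: fM.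
by have := nf (co @: M); rewrite feasible_co // fM.
Qed.

Lemma output_edges_of D (s : state) : sfeasI D ->
  (forall x, (x \in [seq cell s (reg s 1 + i) | i <- iota 0 n./2]) = [exists d in D, x == (g0 d).-1]) ->
  output I s = edges_of D.
Proof.
move=> fD hs; apply/setP => e; rewrite !inE hs.
have aD : D \subset act t n g0 by case/and3P: fD.
apply/existsP/andP => [[d /andP[dD /eqP ed]]|[/eqP h1 h2]].
  have := subsetP aD d dD; rewrite inE => nz; have [e' [e1 e2 _]] := g0_rep (ltn_ord d) nz.
  have ee : e' = e by apply/val_inj; rewrite /= ed e1.
  have cd : co e = d by apply/val_inj; rewrite /= -ee.
  by rewrite cd dD -ee e2 e1.
by exists (co e); rewrite h2 /= h1.
Qed.

(** Multiplicities in the list of ends are degrees, so the test [uniq (dends ds)] of the exhaustive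
    search says that the slots are disjoint. *)
Lemma count_dends (D : {set 'I_Ns}) (x : 'I_n) : D \subset act t n g0 ->
  count_mem (val x) (dends n T2 (map val (enum D))) = deg sloI shiI D x.
Proof.
move=> /subsetP aD; rewrite /dends /deg -sum1dep_card big_mkcondr /= -big_enum /=.
have : {subset enum D <= act t n g0} by move=> d; rewrite mem_enum; apply: aD.
elim: (enum D) => [|d s IH] hs; first by rewrite big_nil.
rewrite /= IH; last by move=> y hy; apply: hs; rewrite inE hy orbT.
rewrite big_cons addnA; congr (_ + _); have nz : g0 d != 0 by have := hs d (mem_head _ _); rewrite inE.
have [e1 e2] := slohiE n2h n_gt1 g0_uv nz; have := g0_uv (ltn_ord d) nz.
rewrite /at_end -!val_eqE e1 e2 /=.
by case: eqP => [->|_]; case: eqP => //= ->; rewrite ?ltnn.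
Qed.

Lemma dxr_sum ds : dxr T2 (xort t) ds = encode_vec (\sum_(d <- ds) dec t (d %% T2))%R.
Proof.
elim/last_ind: ds => [|ds d IH].
  by rewrite /dxr big_nil /encode_vec /= big1 // => j _; rewrite mxE eqxx.
by rewrite /dxr foldl_rcons -/(dxr T2 (xort t) ds) IH /xort encodeK -cats1 big_cat big_seq1.
Qed.

Lemma code_of (s : seq nat) : all (fun d => d < Ns) s ->
  exists2 c, c < Ns ^ size s & digs n T2 c (size s) = s.
Proof.
elim: s => [|d s IH] /=; first by exists 0.
move=> /andP[hd /IH[c hc hs]]; have E0 : 0 < Ns by apply: leq_ltn_trans hd.
exists (c * Ns + d).
  rewrite expnSr; apply: (@leq_trans (c.+1 * Ns)); first by rewrite mulSn; lia.
  by rewrite leq_mul2r hc orbT.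
rewrite /digs /= /dig expn0 divn1 modnMDl modn_small //; congr (_ :: _).
rewrite -[RHS]hs /digs -[1]addn0 iotaDl -map_comp; apply: eq_map => i /=.
by rewrite /dig add1n expnS divnMA divnMDl // (divn_small hd) addn0.
Qed.

Lemma valid_sfeas D : sfeasI D -> exists2 c, c < Ns ^ h &
  valid_code n h T2 al g0 (xort t) c /\ dwt inp g0 (digs n T2 c h) = wDI D.
Proof.
move=> fD; have szD : size (map val (enum D)) = h.
  rewrite size_map -cardE; exact: (card_sfeas n2h fD).
have allD : all (fun d => d < Ns) (map val (enum D)) by apply/allP => d /mapP[d' _ ->]; exact: ltn_ord.
have [c] := code_of allD; rewrite szD => hc hs; exists c => //.
have /and3P[aD mD /eqP pD] := fD.
rewrite /valid_code /dok hs dxr_sum !big_map; split; last first.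
  by rewrite /dwt big_map big_enum /=; apply: eq_bigr => d _; rewrite divn1.
rewrite big_enum /= pD decK ?encode_lt // eqxx andbT; apply/andP; split.
  by apply/allP => d /mapP[d']; rewrite mem_enum => /(subsetP aD); rewrite inE => ? ->.
apply: count_mem_uniq => x; case: (boolP (x \in _)) => [xin|/count_memPn //].
have xn : x < n.
  move: xin => /flattenP[s /mapP[d /mapP[d' d'D ->] ->]]; rewrite !inE.
  have lt := @dv_lt t n h n2h n_gt1 (val d').
  move: d'D; rewrite mem_enum => /(subsetP aD); rewrite inE => nz.
  by have lt2 := g0_uv (ltn_ord d') nz; case/orP=> /eqP ->; [exact: ltn_trans lt2 lt|exact: lt].
rewrite (count_dends (Ordinal xn) aD); have /forallP/(_ (Ordinal xn)) := mD.
by rewrite mem_enum => /eqP.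
Qed.

Lemma sfeas_valid c : valid_code n h T2 al g0 (xort t) c -> exists2 D, sfeasI D &
  wDI D = dwt inp g0 (digs n T2 c h) /\
  forall x, (x \in [seq (g0 (dig n T2 c i)).-1 | i <- iota 0 h]) = [exists d in D, x == (g0 d).-1].
Proof.
move=> /andP[/andP[hact huniq] /eqP hx].
have E0 : 0 < Ns by rewrite !muln_gt0 expn_gt0 /=; lia.
have hlt d : d \in digs n T2 c h -> d < Ns by move=> /mapP[i _ ->]; rewrite ltn_mod.
have uds : uniq (digs n T2 c h).
  move: huniq; elim: (digs n T2 c h) => //= d s IH; rewrite /dends /= => /and3P[h1 h2 h3].
  rewrite IH // andbT; apply: contra h1 => ds; rewrite inE; apply/orP; right.
  by apply/flattenP; exists [:: du n T2 d; dv n T2 d]; [apply/map_f|rewrite inE eqxx].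
pose D := [set d : 'I_Ns | val d \in digs n T2 c h].
have pD : perm_eq (map val (enum D)) (digs n T2 c h).
  apply: uniq_perm => //; first by rewrite map_inj_uniq ?enum_uniq //; exact: val_inj.
  move=> x; apply/mapP/idP => [[d]|xin]; first by rewrite mem_enum inE => ? ->.
  by exists (Ordinal (hlt x xin)) => //; rewrite mem_enum inE.
have aD : D \subset act t n g0.
  by apply/subsetP => d; rewrite !inE => dd; have := allP hact _ dd.
have pE : perm_eq (dends n T2 (map val (enum D))) (dends n T2 (digs n T2 c h)).
  by apply/perm_flatten/perm_map.
exists D; last split.
- apply/and3P; split=> //; last first.
    apply/eqP; rewrite -hx dxr_sum encodeK -(perm_big _ pD) big_map big_enum //.
  apply/forallP => x; rewrite mem_enum -(count_dends x aD).
  have ue : uniq (dends n T2 (map val (enum D))) by rewrite (perm_uniq pE).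
  rewrite count_uniq_mem // eqb1.
  have sz : size (dends n T2 (map val (enum D))) = n.
    rewrite (perm_size pE) /dends size_flatten /shape -map_comp sumnE big_map.
    rewrite (eq_bigr (fun=> 2)) // big_const_seq count_predT /digs size_map size_iota iter_addn_0.
    exact/esym.
  have sub : {subset dends n T2 (map val (enum D)) <= iota 0 n}.
    move=> y /flattenP[s /mapP[d /mapP[d' d'D ->] ->]]; rewrite mem_iota add0n /= !inE.
    have lt := @dv_lt t n h n2h n_gt1 (val d').
    move: d'D; rewrite mem_enum => /(subsetP aD); rewrite inE => nz.
    by have lt2 := g0_uv (ltn_ord d') nz; case/orP=> /eqP ->; [exact: ltn_trans lt2 lt|exact: lt].
  have le : size (iota 0 n) <= size (dends n T2 (map val (enum D))) by rewrite size_iota sz.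
  (* The ends are n distinct numbers below n, hence all of them: disjointness of h slots already
     means that every vertex is covered. *)
  by have [_ ->] := uniq_min_size ue sub le; rewrite mem_iota /=.
- by rewrite /dwt -(perm_big _ pD) big_map big_enum /=; apply: eq_bigr => d _; rewrite divn1.
- move=> x; rewrite (map_comp (fun d => (g0 d).-1)) -/(digs n T2 c h).
  apply/mapP/existsP => [[d dd ->]|[d /andP[dD /eqP->]]].
    by exists (Ordinal (hlt d dd)); rewrite inE dd eqxx.
  by exists (val d); rewrite // inE in dD *.
Qed.

End Translation.

(** * Correctness of the solver *)

Lemma perfect_matching_card t (I : instance t) (M : {set 'I_(ne I)}) :
  perfect_matching M -> 2 * #|M| = nv I.
Proof.
move=> /forallP pm; rewrite -[RHS]card_ord.
apply: (@card_matches _ _ (fun e => (ends e).1) (fun e => (ends e).2)); first exact: ends_neq.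
apply/forallP => x; apply/eqP; transitivity 1; last by rewrite mem_enum.
rewrite -[RHS](eqP (pm x)); apply: eq_card => e.
by rewrite !inE /at_end !(eq_sym x).
Qed.

Lemma no_vertices t (I : instance t) : nv I = 0 -> forall M : {set 'I_(ne I)}, M = set0.
Proof.
move=> n0 M; apply/setP => e; have : 0 < nv I := leq_ltn_trans (leq0n _) (ltn_ord (ends e).1).
by rewrite n0.
Qed.

Lemma sqr_le_exp2 q : q.+1 * q.+1 <= 4 * 2 ^ q.
Proof.
elim: q => // -[|[|[|q]]] //; rewrite [2 ^ q.+4]expnS; move: (2 ^ q.+3) => x; lia.
Qed.

Section Solver.
Variables (t L : nat).
Hypothesis L_gt0 : 0 < L.
Local Notation T2 := (2 ^ t).
(* With this factor in Yb the failure probability is at most 1 / L, by failure_bound. *)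
Definition Kc := 16 * L * L * T2.
(** With M = 1000 Kc^2 T2^2 the bound [Z] below is M S^10, at most S^(M + 10) because S is at least
    2. As 128 is at most S^7, 100 Z^2 stays below S to the power 7 + 2 (M + 10) + 3. *)
Definition cword := 2 * (1000 * Kc * Kc * (T2 * T2)) + 30.
Definition solver := ppre t Kc (chart t) (xort t);; (pflip;; ppost t).

Lemma T2_gt0 : 0 < T2. Proof. by rewrite expn_gt0. Qed.

Lemma Kc_gt0 : 0 < Kc.
Proof. by rewrite !muln_gt0 L_gt0 T2_gt0. Qed.

(** Each of the two terms is at most half of 2^q. For the deletions this comes from the cube of n in
    [Yb]. For the levels, compare squares: (q + 1)^2 is at most 4 2^q, and 16 h^2 L^2 is at most
    2^q. *)
Lemma failure_bound q n h wm : Yb Kc n wm <= 2 ^ q -> 2 * h = n ->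
  (q.+1 + n * n * T2) * h * L <= 2 ^ q.
Proof.
move=> hY hn; have T0 := T2_gt0.
have n3 : 16 * L * L * T2 * (n * n * n) <= 2 ^ q.
  apply: leq_trans hY; rewrite /Yb /Kc; apply: leq_trans (leq_pmulr _ _) => //.
  rewrite -!mulnA; do 4 (rewrite leq_mul2l; apply/orP; right).
  by rewrite !leq_mul.
have h1 : n * n * T2 * h * L * 2 <= 2 ^ q.
  by apply: leq_trans n3; rewrite -hn; move: T0 L_gt0; move: (T2) => T *; nia.
have h2 : q.+1 * h * L * 2 <= 2 ^ q.
  have s := sqr_le_exp2 q.
  have hh : 16 * (h * h * (L * L)) <= 2 ^ q.
    apply: leq_trans n3; rewrite -hn.
    have : h * h <= 2 * h * (2 * h) * (2 * h) by case: (h) => // k; nia.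
    move: T0; move: (h * h) (2 * h * (2 * h) * (2 * h)) (T2) => x y T T0 xy.
    have -> : 16 * (x * (L * L)) = 16 * L * L * 1 * x by ring.
    by rewrite leq_mul // leq_mul2l T0 orbT.
  rewrite -leq_sqr -!mulnn; move: s hh; move: (2 ^ q) => x s hh.
  apply: (@leq_trans (4 * x * (4 * (h * h * (L * L))))); last by nia.
  apply: leq_trans (leq_mul s (leqnn _)); lia.
by rewrite (mulnDl _ _ h) (mulnDl _ _ L); lia.
Qed.

(** * All numbers of a run fit in a word *)

Section OneInstance.
Variable I : instance t.
Local Notation n := (nv I).
Local Notation inp := (nth 0 (encode I)).
Let eu e := inp (4 * e + 3).
Let ev' e := inp (4 * e + 4).
Let wt' e := inp (4 * e + 5).
Let ga e := inp (4 * e + 6).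
Let al := encode_vec (demand I).
(** Chosen so that 2^W is exactly [S ^ cword]. *)
Let S := 2 ^ (trunc_log 2 (instance_size I)).+1.
Let W := word_size I cword.
Let Bs := 4 + 4 * ne I + n.
Let wm := wmx wt' (ne I).
Let y := Kc * (S * S * S * S).
Let Z := 1000 * (y * y * (T2 * T2) * (S * S)).

Lemma S_gt : instance_size I < S.
Proof. exact: trunc_log_ltn. Qed.

Lemma S_ge2 : 2 <= S.
Proof. by rewrite /S expnS leq_pmulr // expn_gt0. Qed.

Lemma wm_lt_S : wm < S.
Proof.
apply: leq_ltn_trans S_gt; rewrite /wm /wt' wmx_wmax /instance_size; apply: leq_trans (leq_addl _ _).
by apply/bigmax_leqP => e _; rewrite (bigD1 e) //= leq_addr.
Qed.

Lemma n_ne_lt_S : n + ne I < S.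
Proof. by apply: leq_ltn_trans S_gt; rewrite /instance_size leq_addr. Qed.

Lemma Yb_le : Yb Kc n wm <= y.
Proof.
have h1 := n_ne_lt_S; have h2 := wm_lt_S; have h3 : n < S by lia.
by rewrite /Yb /y -!mulnA leq_mul // !leq_mul.
Qed.

Lemma S_le_y : S <= y.
Proof.
have := S_ge2; rewrite /y => s2; rewrite (_ : Kc * (S * S * S * S) = S * (Kc * (S * S * S))); last by ring.
by rewrite leq_pmulr // !muln_gt0 ?expn_gt0 L_gt0 /=; lia.
Qed.

Lemma Z_ge1 : 1000 * (y * y) <= Z.
Proof.
have := S_ge2; have := T2_gt0; rewrite /Z leq_mul2l /= => T0 s2.
by rewrite -mulnA leq_pmulr // !muln_gt0 T0; lia.
Qed.

Lemma Z_ge2 : 1000 * (y * (S * S * T2)) <= Z.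
Proof.
have := S_ge2; have := T2_gt0; have := S_le_y; rewrite /Z leq_mul2l /= => ys T0 s2.
rewrite (_ : y * y * (T2 * T2) * (S * S) = y * (S * S * T2) * (y * T2)); last by ring.
by rewrite leq_pmulr // muln_gt0 T0; lia.
Qed.

Lemma Z_ge3 : 1000 * (T2 * T2) <= Z.
Proof.
have := S_ge2; have := S_le_y; rewrite /Z leq_mul2l /= => ys s2.
by rewrite -mulnA mulnCA leq_pmulr // !muln_gt0; lia.
Qed.

Lemma word_pow : 2 ^ W = S ^ cword.
Proof. by rewrite /W /word_size mulnC expnM. Qed.

Lemma Zb : Zbound W Z.
Proof.
have s2 := S_ge2; have z1 := Z_ge1; have ys := S_le_y.
apply/andP; split; last by nia.
rewrite word_pow /cword; set M := 1000 * Kc * Kc * (T2 * T2).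
have ZE : Z = M * S ^ 10 by rewrite /Z /M /y !expnS expn0 muln1; ring.
have hM : M <= S ^ M.
  by apply: leq_trans (ltnW (ltn_expl M (isT : 1 < 2))) _; rewrite leq_exp2r // !muln_gt0 ?expn_gt0 L_gt0.
have h7 : 128 <= S ^ 7 by apply: (@leq_trans (2 ^ 7)) => //; rewrite leq_exp2r.
rewrite (_ : 2 * M + 30 = 7 + (M + 10) + (M + 10) + 3); last by lia.
rewrite !expnD -!expnD addnA; apply: (@leq_trans (S ^ 7 * S ^ (M + 10) * S ^ (M + 10) * S ^ 3)).
  rewrite -[ltnLHS]muln1; apply: (@leq_trans (S ^ 7 * S ^ (M + 10) * S ^ (M + 10))).
    have hz : Z <= S ^ (M + 10) by rewrite ZE expnD leq_mul.
    have Z0 : 0 < Z by nia.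
    rewrite muln1; apply: (@leq_trans (128 * Z * Z)); first by nia.
    by rewrite !leq_mul.
  by rewrite leq_pmulr // expn_gt0; lia.
by rewrite !expnD !mulnA.
Qed.

Lemma Bs_Z : Bs < Z.
Proof. have := Z_ge1; have := n_ne_lt_S; have := S_le_y; have := S_ge2; rewrite /Bs; nia. Qed.

Lemma nnT_Z : n * n * T2 < Z.
Proof.
have h := n_ne_lt_S; have ys := S_le_y; have s2 := S_ge2; apply: leq_trans Z_ge2.
have : n * n * T2 <= S * S * T2 by rewrite !leq_mul //; lia.
have := T2_gt0; move: (n * n * T2) => x T0 hx; have : 0 < S * S * T2 by rewrite !muln_gt0 T0; lia.
by move: (S * S * T2) hx => z; nia.
Qed.

Lemma TT_Z : T2 * T2 < Z.
Proof. by apply: leq_trans Z_ge3; have := T2_gt0; move: (T2) => T; nia. Qed.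

Lemma nY_Z : n.+1 * (8 * Yb Kc n wm) < Z.
Proof.
have h := n_ne_lt_S; have ys := S_le_y; have s2 := S_ge2; have hy := Yb_le; apply: leq_trans Z_ge1.
apply: (@leq_ltn_trans (y * (8 * y))); last by nia.
by rewrite leq_mul //; lia.
Qed.

Lemma EY_Z : n * n * T2 * (2 * Yb Kc n wm) < Z.
Proof.
have h := n_ne_lt_S; have ys := S_le_y; have s2 := S_ge2; have hy := Yb_le; apply: leq_trans Z_ge2.
have : n * n * T2 <= S * S * T2 by rewrite !leq_mul //; lia.
have := T2_gt0; move: (n * n * T2) => x T0 hx; have : 0 < S * S * T2 by rewrite !muln_gt0 T0; lia.
move: (S * S * T2) hx => z hx z0; apply: (@leq_ltn_trans (z * (2 * y))); last by nia.
by rewrite leq_mul //; lia.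
Qed.

Lemma primes_Z q : 2 ^ q < 2 * Yb Kc n wm -> 4 * primes_to q + 8 < Z.
Proof.
have h := ltn_expl q (isT : 1 < 2); have ys := S_le_y; have s2 := S_ge2; have hy := Yb_le => hq.
apply: leq_trans Z_ge1; rewrite /primes_to; move: (2 ^ q) h hq => x h hq.
apply: (@leq_ltn_trans (4 * (2 * (2 * y * (4 * y + 8))) + 8)); last by nia.
by rewrite leq_add2r leq_mul2l /= leq_mul2l /= leq_mul //; lia.
Qed.

Lemma inp_lt i : inp i < 2 ^ W.
Proof.
have zb := Zb; have nS := n_ne_lt_S; have ys := S_le_y; have z1 := Z_ge1; have s2 := S_ge2; have zT := TT_Z.
have TZ : T2 < Z by apply: leq_ltn_trans zT; rewrite leq_pmulr // T2_gt0.
have SZ : S < Z by nia.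
apply: (ltZW zb); case: i => [|[|[|i]]]; rewrite /=; try lia.
  exact: ltn_trans (encode_lt _) TZ.
case: (ltnP i (4 * ne I)) => hi; last first.
  by rewrite (_ : nth _ _ _ = 0) ?(leq_trans _ SZ) // nth_default //; have := size_encode I; rewrite /=; lia.
have he : i %/ 4 < ne I by rewrite ltn_divLR // mulnC.
have [e1 e2 e3 e4] := inp_edge (Ordinal he); have := divn_eq i 4; have := ltn_pmod i (isT : 0 < 4).
have w1 : wt (Ordinal he) <= wm by rewrite /wm /wt' wmx_wmax; apply: leq_bigmax.
have := wm_lt_S; have u1 := ltn_ord (ends (Ordinal he)).1; have u2 := ltn_ord (ends (Ordinal he)).2.
have g1 := encode_lt (par (Ordinal he)).
rewrite /= in e1 e2 e3 e4; change (nth 0 (flatten _) i) with (inp i.+3).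
case: (i %% 4) => [|[|[|[|//]]]] hw _ hi4.
- by rewrite (_ : i.+3 = 4 * (i %/ 4) + 3) ?e1; lia.
- by rewrite (_ : i.+3 = 4 * (i %/ 4) + 4) ?e2; lia.
- by rewrite (_ : i.+3 = 4 * (i %/ 4) + 5) ?e3; lia.
- by rewrite (_ : i.+3 = 4 * (i %/ 4) + 6) ?e4; lia.
Qed.

Local Notation pre := (pre_spec t Kc (chart t) (xort t) n (ne I) al inp eu ev' wt' ga).
Local Notation post := (post_spec t (chart t) (xort t) n (ne I) al inp wt').

Lemma solver_run : exists v a t1, pre v a /\ forall coins : seq bool,
    60 + Tpre t Kc n (ne I) wt' + Tpost t n (ne I) wt' v + 28 * v 19 <= size coins ->
    let s := run W (program solver) (encode I) coins in
    t1 + 28 * v 19 <= size coins /\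
    exists v' a', [/\ post v a (fun i => nth false coins (t1 + 28 * i)) v' a', halted s,
      reg s 0 = v' 0, reg s 1 = 0 & forall i, i < Bs -> cell s i = a' 0 i].
Proof.
have zb := Zb; have bz := Bs_Z; have nz := nnT_Z; have tz := TT_Z; have K0 := Kc_gt0.
have nyz := nY_Z; have eyz := EY_Z; have xz := primes_Z.
have xl x x' : xort t x x' < T2 by apply: encode_lt.
have all_ : al < T2 by apply: encode_lt.
have n0E : nth 0 (encode I) 0 = n by [].
have n1E : nth 0 (encode I) 1 = ne I by [].
have n2E : nth 0 (encode I) 2 = al by [].
apply: (@run_random W (encode I)).
- exact: (smallW zb).
- exact: (ltZW zb).
- exact: size_encode.
- exact: inp_lt.
- exact: toss_free_ppre.
- move=> w; apply: (tri_pre (chart t) zb bz (al := al) (a0 := inp) (eu := eu) (ev' := ev') (wt := wt') (ga := ga)) => //.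
  + by move=> e he; exact: eu_lt.
  + by move=> e he; exact: ev_lt.
  + by move=> e he; exact: uv_ne.
  + by move=> e he; exact: ga_lt.
  + move=> k k0 i; rewrite /start_arrays /addr (negbTE k0) nth_default // size_encode n0E n1E; lia.
- move=> v a [[[_ _ _ _ _] _ [q [[q1 q2 q3 q4 q5] q6]] _ h19] _].
  have hv : v 19 < Z.
    apply: leq_ltn_trans eyz; rewrite h19; case: ifP => // _; rewrite q4 leq_mul2l; apply/orP; right.
    exact: ltnW (ltn_trans (ltn_expl q (isT : 1 < 2)) q2).
  case/andP: zb; rewrite n0E n1E -/Bs; nia.
- move=> w v a b v' a' hpre hf.
  apply: (tri_post zb bz (al := al) (a0 := inp) (eu := eu) (ev' := ev') (wt := wt') (ga := ga)) hpre _ _ _ _ hf => //.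
  + by move=> e he; exact: eu_lt.
  + by move=> e he; exact: ev_lt.
  + by move=> e he; exact: uv_ne.
  + by move=> e he; exact: ga_lt.
Qed.

Lemma odd_infeasible : odd n -> ~~ [exists M : {set 'I_(ne I)}, feasible M].
Proof.
move=> od; apply/existsP => -[M /andP[/perfect_matching_card hM _]].
by rewrite -hM mul2n odd_double in od.
Qed.

(** * Outcome of a run and number of failing coin strings *)

Section Run.
Variables (v : nat -> nat) (a : nat -> nat -> nat) (t1 : nat).
Hypothesis pre_va : pre v a.
Let q := v 9.
Let g0 := a 1.
Let h := n %/ 2.
Local Notation Ns := (n * n * T2).

Lemma run_g0 : gspec n T2 eu ev' wt' ga (ne I) g0.
Proof. by case: pre_va => [[]]. Qed.

Lemma half_h : n./2 = h.
Proof. by rewrite /h divn2. Qed.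

Lemma brute_solved b v' a' s : 0 < n -> ~~ odd n -> main_case n v = false -> post v a b v' a' ->
  reg s 0 = v' 0 -> reg s 1 = 0 -> (forall i, i < Bs -> cell s i = a' 0 i) -> solved I s.
Proof.
move=> n0 nod mc; rewrite /post_spec (negbTE nod) (_ : (n == 0) = false); last by lia.
rewrite mc => hpost r0 r1 hc; have n2h : n = 2 * h by rewrite /h; lia.
have n_gt1 : 1 < n by lia.
rewrite /solved r0; case: hpost => [[-> nv]|[-> [c [c1 c2 c3 c4]]]] /=.
  apply: (no_slot_no_feasible run_g0 (n_gt1 := n_gt1) n2h) => D; apply/negP => fD.
  have [c hc' [vc _]] := valid_sfeas run_g0 n2h fD.
  by have := nv c hc'; rewrite vc.
have [D fD [wD hD]] := sfeas_valid run_g0 n_gt1 n2h c2.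
rewrite (output_edges_of run_g0 n2h fD); last first.
  move=> x; rewrite -hD half_h; congr (_ \in _); apply/eq_in_map => i; rewrite mem_iota add0n => /andP[_ hi].
  by rewrite r1 add0n hc ?c4 // /Bs; move: hi; rewrite /h; lia.
apply: (slot_optimal run_g0 n2h fD) => D' fD'.
have [c' hc' [vc' <-]] := valid_sfeas run_g0 n2h fD'.
by rewrite wD; apply: c3.
Qed.

Let p := the_prime v.
Let lg := 2 * q + 6.

Section Main.
Hypothesis n_gt0 : 0 < n.
Hypothesis mc : main_case n v.

Lemma main_odd : ~~ odd n. Proof. by case/andP: mc. Qed.

Lemma main_n2h : n = 2 * h. Proof. by have := main_odd; rewrite /h; lia. Qed.

Lemma main_gt1 : 1 < n. Proof. by have := main_n2h; lia. Qed.

Lemma main_Q : n.+1 * n.+1 * wm.+1 <= 2 ^ q.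
Proof.
have [[q1 _ _ _ _] _] := q_spec pre_va.
exact: leq_trans (Y_wm _ _ _ Kc_gt0) q1.
Qed.

Lemma main_p : [/\ prime p, 2 < p, 2 ^ q < p, h * wm + 1 < p & wm < 2 ^ q].
Proof.
have /and3P[pp pQ _] := the_primeP v; have hQ := main_Q; have n1 := main_gt1; have n2 := main_n2h.
have h4 : 4 * wm.+1 <= 2 ^ q by apply: leq_trans hQ; rewrite leq_mul2r; apply/orP; right; nia.
have h5 : h * wm + 1 <= 2 ^ q by apply: leq_trans hQ; nia.
by rewrite -/p -/q in pp pQ *; split=> //; lia.
Qed.

Lemma main_lg : h * wm < 2 ^ lg.
Proof.
have [_ _ _ _ _] := main_p; have hQ := main_Q; have n2 := main_n2h.
apply: (@leq_trans (2 ^ q)); first by apply: leq_trans hQ; nia.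
by rewrite leq_exp2l // /lg; lia.
Qed.

Lemma run_w d : d < Ns -> g0 d != 0 -> inp (4 * g0 d + 1) <= wm.
Proof. by move=> hd nz; rewrite /wm /wt' wmx_wmax; apply: (g0_w run_g0 main_gt1 main_n2h hd nz). Qed.

Local Notation sfeas := (@sfeas t n al g0 main_gt1).

Variable sg : {set 'I_Ns} -> 'F_p.
Hypothesis sg_nz : forall D, smatch main_gt1 D -> (sg D != 0)%R.
Hypothesis sgE : forall z : 'I_Ns -> 'F_p,
  (pf (Ordinal (ltnW main_gt1)) (arcs (@slo t n main_gt1) (@shi t n main_gt1) z) (enum 'I_n) =
  \sum_(D | smatch main_gt1 D) sg D * \prod_(d in D) z d)%R.

(** Without a solution all tested sums are empty, so the answer is right for all coins. *)
Lemma main_none b v' a' s : (forall D, ~~ sfeas D) -> post v a b v' a' ->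
  reg s 0 = v' 0 -> solved I s.
Proof.
move=> nf hpost r0; move: hpost; rewrite /post_spec (negbTE main_odd) (_ : (n == 0) = false); last by lia.
rewrite mc => -[h1 _]; have [pp p2 _ hp _] := main_p.
have := levels_none main_n2h run_w (g0_uv run_g0 main_gt1 main_n2h) pp p2 hp (encode_lt _) main_lg sgE (v 9) (coords v b) (v 9).+1 nf.
rewrite -/al -/h -/q -/lg -/p in h1 *; rewrite /solved r0 => hl.
move: h1; rewrite hl => /negbT; rewrite negbK => /eqP ->.
exact: (no_slot_no_feasible run_g0 (n_gt1 := main_gt1) main_n2h nf).
Qed.

Lemma main_good D0 b v' a' s : sfeas D0 -> good al inp g0 main_gt1 sg q D0 (coords v b) -> post v a b v' a' ->
  reg s 0 = v' 0 -> reg s 1 = 0 -> (forall i, i < Bs -> cell s i = a' 0 i) -> solved I s.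
Proof.
move=> f0 hg hpost r0 r1 hc; move: hpost; rewrite /post_spec (negbTE main_odd) (_ : (n == 0) = false); last by lia.
rewrite mc => -[h1 h2]; have [pp p2 qp hp wq] := main_p.
have [hl [D [fD opt [so mo]]]] := search_ok main_n2h run_w (g0_uv run_g0 main_gt1 main_n2h) pp p2 hp (encode_lt _) main_lg sgE wq qp f0 hg.
have {}h2 := h2 hl; rewrite /solved r0 h1 hl.
rewrite (output_edges_of run_g0 main_n2h fD); first exact: (slot_optimal run_g0 main_n2h fD opt).
move=> x; rewrite -mo; congr (_ \in _); rewrite half_h -[RHS]take_size so -(map_nth_iota0 0) ?so //.
apply/eq_in_map => i; rewrite mem_iota add0n => /andP[_ hi].
have hn : i < n by have := main_n2h; lia.
by rewrite r1 add0n hc ?h2 ?so // /Bs; lia.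
Qed.

End Main.

Lemma small_card (T : nat) (A : {set T.-tuple bool}) : A = set0 -> #|A| * L <= 2 ^ T.
Proof. by move=> ->; rewrite cards0. Qed.

(** Only the algebraic branch on a feasible instance can fail. There the failing coin strings are
    contained in the preimage of the bad weight assignments under the projection to the tossed
    positions. *)
Lemma solver_fails T :
  60 + Tpre t Kc n (ne I) wt' + Tpost t n (ne I) wt' v + 28 * v 19 <= T ->
  (forall coins : seq bool,
    60 + Tpre t Kc n (ne I) wt' + Tpost t n (ne I) wt' v + 28 * v 19 <= size coins ->
    let s := run W (program solver) (encode I) coins in
    t1 + 28 * v 19 <= size coins /\
    exists v' a', [/\ post v a (fun i => nth false coins (t1 + 28 * i)) v' a', halted s,
      reg s 0 = v' 0, reg s 1 = 0 & forall i, i < Bs -> cell s i = a' 0 i]) ->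
  #|[set coins : T.-tuple bool | ~~ solved I (run W (program solver) (encode I) coins)]| * L <= 2 ^ T.
Proof.
move=> hT hrun.
have all_solved : (forall coins : T.-tuple bool, solved I (run W (program solver) (encode I) coins)) ->
    #|[set coins : T.-tuple bool | ~~ solved I (run W (program solver) (encode I) coins)]| * L <= 2 ^ T.
  by move=> hs; apply: small_card; apply/setP => c; rewrite !inE hs.
have hr (coins : T.-tuple bool) : let s := run W (program solver) (encode I) coins in
    t1 + 28 * v 19 <= T /\
    exists v' a', [/\ post v a (fun i => nth false coins (t1 + 28 * i)) v' a', halted s,
      reg s 0 = v' 0, reg s 1 = 0 & forall i, i < Bs -> cell s i = a' 0 i].
  by have := hrun coins; rewrite size_tuple => /(_ hT).
case: (boolP (odd n)) => od.
  apply: all_solved => coins; have [_ [v' [a' [hp _ r0 _ _]]]] := hr coins.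
  by move: hp; rewrite /post_spec od => h0; rewrite /solved r0 h0 /=; exact: odd_infeasible.
case: (posnP n) => n0.
  apply: all_solved => coins; have [_ [v' [a' [hp _ r0 _ _]]]] := hr coins.
  have e0 : (n == 0) = true by apply/eqP.
  move: hp; rewrite /post_spec (negbTE od) e0 => h0.
  have fE (M : {set 'I_(ne I)}) : feasible M = (al == 0).
    have -> : feasible M = (parity M == demand I).
      apply: andb_idl => _; apply/forallP => x.
      have ng : 0 < n := leq_ltn_trans (leq0n _) (ltn_ord x).
      by exfalso; rewrite n0 in ng.
    rewrite (no_vertices n0 M) /parity big_set0 -(inj_eq (@encode_inj t)) eq_sym -/al.
    by congr (_ == _); rewrite /encode_vec big1 // => j _; rewrite mxE eqxx.
  rewrite /solved r0 h0 eqb0 negbK; case: ifP => al0.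
    rewrite /optimal fE al0; apply/forallP => M; apply/implyP => _.
    by rewrite (no_vertices n0 M) (no_vertices n0 (output _ _)).
  by apply/existsP => -[M]; rewrite fE al0.
case: (boolP (main_case n v)) => mc; last first.
  apply: all_solved => coins; have [_ [v' [a' [hp _ r0 r1 hc]]]] := hr coins.
  exact: brute_solved n0 od (negbTE mc) hp r0 r1 hc.
have gt1 := main_gt1 n0 mc; have n2h := main_n2h n0 mc.
have [pp p2 qp hp wq] := main_p n0 mc.
have [sg [sgnz sgE]] := @pf_matchings 'F_p _ _ (Ordinal (ltnW gt1)) (@slo t n gt1) (@shi t n gt1)
  (slohi n2h gt1) (enum 'I_n) (enum_uniq _).
(* [slo] and [shi] carry a proof of 1 < n; it is exchanged for the one that occurs in the lemmas
   above. *)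
rewrite (bool_irrelevance gt1 (main_gt1 n0 mc)) in sg sgnz sgE *.
case: (boolP [exists D, @sfeas t n al g0 (main_gt1 n0 mc) D]) => [/existsP[D0 f0]|nf]; last first.
  apply: all_solved => coins; have [_ [v' [a' [hpo _ r0 r1 hc]]]] := hr coins.
  apply: (main_none sgE _ hpo r0) => D; apply: contra nf => fD; apply/existsP; by exists D.
have [[_ _ _ _ h19] _] := pre_va; rewrite mc -/q in h19.
(* Any coins would do: what is wanted is that all tosses fall before time [T], a fact that does not
   depend on the coins. *)
have [hpos _] := hr [tuple of nseq T false]; rewrite h19 in hpos.
have posT (di : 'I_Ns * 'I_q) : t1 + 28 * (di.1 * q + di.2) < T.
  apply: leq_trans hpos; rewrite ltn_add2l ltn_pmul2l //.
  apply: (@leq_trans (di.1.+1 * q)); first by rewrite mulSn; have := ltn_ord di.2; lia.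
  by rewrite leq_mul2r ltn_ord orbT.
pose pos di := Ordinal (posT di).
have pos_inj : injective pos.
  move=> [d i] [d' i'] /(congr1 val) /= /eqP; rewrite eqn_add2l eqn_pmul2l //.
  by rewrite (idx_eq _ _ (ltn_ord i') (ltn_ord i)) => /andP[/eqP/val_inj -> /eqP/val_inj ->].
pose P (b : {ffun 'I_Ns * 'I_q -> bool}) := ~~ goodb al inp g0 (main_gt1 n0 mc) sg q D0 (Xf b).
have sub : [set coins : T.-tuple bool | ~~ solved I (run W (program solver) (encode I) coins)]
    \subset [set w : T.-tuple bool | P [ffun d => tnth w (pos d)]].
  apply/subsetP => coins; rewrite !inE; apply: contra => hg.
  have [_ [v' [a' [hpo _ r0 r1 hc]]]] := hr coins.
  apply: (main_good sgE f0 _ hpo r0 r1 hc); apply/goodbP.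
  rewrite -(goodb_ext _ _ _ _ _ _ _ (X := Xf [ffun d => tnth coins (pos d)])) // => d hd.
  apply: horner_ext => i hi; rewrite !insubT ffunE (tnth_nth false) /=.
  by [].
have bc := bad_count inp n2h pp sgnz qp f0.
have [[hY _ _ _ _] _] := q_spec pre_va.
have fb := failure_bound hY (esym n2h).
have e := card_proj_coins P pos_inj; rewrite card_prod !card_ord in e.
have hb : #|[set b | P b]| * L <= 2 ^ (Ns * q).
  have q0 : 0 < 2 ^ q by rewrite expn_gt0.
  rewrite -(leq_pmul2r q0); move: bc fb; rewrite -/P -/q.
  move: #|_| ((_ + _) * _) (2 ^ (Ns * q)) (2 ^ q) => x z u u' bc fb.
  by apply: (@leq_trans (z * u * L)); [rewrite mulnAC leq_mul2r bc orbT|rewrite mulnAC mulnC leq_mul2l fb orbT].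
have N0 : 0 < 2 ^ (Ns * q) by rewrite expn_gt0.
rewrite -(leq_pmul2r N0).
apply: (@leq_trans (#|[set w : T.-tuple bool | P [ffun d => tnth w (pos d)]]| * L * 2 ^ (Ns * q))).
  by rewrite leq_mul2r leq_mul2r subset_leq_card ?orbT.
by rewrite mulnAC e mulnAC mulnC leq_mul2l hb orbT.
Qed.

End Run.
End OneInstance.
End Solver.

(** * The running time *)

(* f = O(w^a N^b l^c) *)
Definition Ob (f : nat -> nat -> nat -> nat) a b c :=
  exists C, forall w N l, 0 < w -> 0 < N -> 0 < l -> f w N l <= C * (w ^ a * N ^ b * l ^ c).

Lemma Ob_le f a b c a' b' c' : Ob f a b c -> a <= a' -> b <= b' -> c <= c' -> Ob f a' b' c'.
Proof.
move=> [C hC] ha hb hc; exists C => w N l w0 N0 l0; apply: leq_trans (hC w N l w0 N0 l0) _.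
by rewrite !leq_mul // leq_pexp2l.
Qed.

Lemma Ob_c k : Ob (fun _ _ _ => k) 0 0 0.
Proof. by exists k => w N l _ _ _; rewrite !expn0 !muln1. Qed.

Lemma Ob_w : Ob (fun w _ _ => w) 1 0 0.
Proof. by exists 1 => w N l _ _ _; rewrite !expn0 !muln1 mul1n. Qed.

Lemma Ob_N : Ob (fun _ N _ => N) 0 1 0.
Proof. by exists 1 => w N l _ _ _; rewrite !expn0 muln1 !mul1n. Qed.

Lemma Ob_l : Ob (fun _ _ l => l) 0 0 1.
Proof. by exists 1 => w N l _ _ _; rewrite !expn0 !mul1n. Qed.

Lemma Ob_D f g a b c a' b' c' : Ob f a b c -> Ob g a' b' c' ->
  Ob (fun w N l => f w N l + g w N l) (maxn a a') (maxn b b') (maxn c c').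
Proof.
move=> hf hg.
have [C hC] := Ob_le hf (leq_maxl a a') (leq_maxl b b') (leq_maxl c c').
have [C' hC'] := Ob_le hg (leq_maxr a a') (leq_maxr b b') (leq_maxr c c').
by exists (C + C') => w N l w0 N0 l0; rewrite mulnDl leq_add ?hC ?hC'.
Qed.

Lemma Ob_M f g a b c a' b' c' : Ob f a b c -> Ob g a' b' c' ->
  Ob (fun w N l => f w N l * g w N l) (a + a') (b + b') (c + c').
Proof.
move=> [C hC] [C' hC']; exists (C * C') => w N l w0 N0 l0.
rewrite !expnD; apply: leq_trans (leq_mul (hC w N l w0 N0 l0) (hC' w N l w0 N0 l0)) _.
by apply: eq_leq; ring.
Qed.

Section Bounds.
Variables (t L : nat).
Local Notation T2 := (2 ^ t).
Local Notation K := (Kc t L).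
Let c1 := K + t + 15.
Let c2 := 2 * c1 + 8.

(** Stands in for [q.+1], [2 * q + 6] and [2 * q + 8], which are O(n log n) in the main case; the
    bounds that follow copy the shape of the running times. *)
Definition bA (w N l : nat) := c2 * (N * l).
Definition bY (w N l : nat) := K * (2 * N) * (2 * N) * (2 * N) * (2 * w).
Definition bP w N l := 2 * (2 * bY w N l * bA w N l).
Definition bT w N l := 50 + (2 * (N * w)) * (800 + 140 * bA w N l +
  (30 + T2 * (200 + (N * (40 + N * (200 + T2 * (410 + 70 * bA w N l)))
    + N * (500 + 70 * bA w N l + N * (350 + N * 470)))))).
Definition bpre w N l := 1000 + 40 * (T2 * T2) + (T2 * (N * N) * (2 * w)) * 310 + N * 70 + bY w N l * 70.
Definition bmain w N l := 1000 + N * N * T2 * (70 + bA w N l * 60) + bP w N l * 120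
  + bA w N l * bP w N l * 60 + bA w N l * (120 + (2 * N) * (60 + bT w N l))
  + N * N * T2 * (100 + bT w N l) + N * N * T2 * 150.
Definition bbrute (w N l : nat) := N * 100 + w * (160 + N * 310).
Definition btotal w N l := 60 + bpre w N l + (200 + (bmain w N l + bbrute w N l))
  + 28 * (N * N * T2 * bA w N l).

Ltac ob := lazymatch goal with
  | |- Ob (fun w N l => @?f w N l + @?g w N l) _ _ _ => eapply (@Ob_D f g); ob
  | |- Ob (fun w N l => @?f w N l * @?g w N l) _ _ _ => eapply (@Ob_M f g); ob
  | |- Ob (fun w _ _ => w) _ _ _ => exact Ob_w
  | |- Ob (fun _ N _ => N) _ _ _ => exact Ob_N
  | |- Ob (fun _ _ l => l) _ _ _ => exact Ob_l
  | |- Ob (fun _ _ _ => ?k) _ _ _ => exact (Ob_c k)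
  | _ => eassumption end.

(** The scan dominates: O(n log n) levels of O(n) tests, a test costing O(w n^4 log n). The n^2 2^t
    deletion tests are cheaper by a logarithm, and the sieve takes O(w n^5 log^2 n). *)
Lemma btotal_Ob : Ob btotal 1 6 2.
Proof.
have hA : Ob (fun w N l => bA w N l) 0 1 1 by rewrite /bA; eapply Ob_le; [ob|..].
have hY : Ob (fun w N l => bY w N l) 1 3 0 by rewrite /bY; eapply Ob_le; [ob|..].
have hP : Ob (fun w N l => bP w N l) 1 4 1 by rewrite /bP; eapply Ob_le; [ob|..].
have hT : Ob (fun w N l => bT w N l) 1 4 1 by rewrite /bT; eapply Ob_le; [ob|..].
have hM : Ob (fun w N l => bmain w N l) 1 6 2 by rewrite /bmain; eapply Ob_le; [ob|..].
have hB : Ob (fun w N l => bbrute w N l) 1 1 0 by rewrite /bbrute; eapply Ob_le; [ob|..].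
have hR : Ob (fun w N l => bpre w N l) 1 3 0 by rewrite /bpre; eapply Ob_le; [ob|..].
by rewrite /btotal; eapply Ob_le; [ob|..].
Qed.

Ltac mono := lazymatch goal with
  | |- is_true (?x <= ?x) => exact: (leqnn x)
  | |- is_true (?x + ?y <= ?z + ?u) => apply: (@leq_add x y z u); mono
  | |- is_true (?x * ?y <= ?z * ?u) => first [assumption | apply: (@leq_mul x y z u); mono]
  | _ => assumption end.

Variable I : instance t.
Local Notation n := (nv I).
Local Notation inp := (nth 0 (encode I)).
Let N := maxn 2 n.
Let w := maxn 1 (wmax I).
Let l := trunc_log 2 N.
Local Notation h := (n %/ 2).
Local Notation wt' := (fun e => inp (4 * e + 5)).
Local Notation E := (n * n * T2).

Lemma N_gt0 : 0 < N. Proof. by rewrite /N; lia. Qed.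
Lemma w_gt0 : 0 < w. Proof. by rewrite /w; lia. Qed.
Lemma l_gt0 : 0 < l. Proof. by rewrite /l trunc_log_gt0 /N; lia. Qed.
Lemma n_le : n <= N. Proof. by rewrite /N; lia. Qed.
Lemma h_le : h <= N. Proof. exact: leq_trans (leq_div _ _) n_le. Qed.

(** Pairwise different edges are counted by the n^2 (w_max + 1) 2^t possible values of ends, weight
    and parity. *)
Lemma ne_le : ne I <= T2 * (N * N) * (2 * w) + repeated_edges I.
Proof.
set s1 := undup [seq (endset e, wt e, par e) | e : 'I_(ne I)].
have -> : repeated_edges I = ne I - size s1 by [].
suff : size s1 <= T2 * (N * N) * (2 * w) by lia.
pose f (x : 'I_n * 'I_n * 'I_(wmax I).+1 * 'rV['F_2]_t) :=
  ([set x.1.1.1; x.1.1.2], val x.1.2, x.2).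
apply: (@leq_trans (size [seq f x | x : 'I_n * 'I_n * 'I_(wmax I).+1 * 'rV['F_2]_t])).
  apply: uniq_leq_size; first exact: undup_uniq.
  move=> y; rewrite mem_undup => /imageP[e _ ->]; apply/imageP.
  have hw : wt e < (wmax I).+1 by rewrite ltnS; apply: leq_bigmax.
  by exists ((ends e).1, (ends e).2, Ordinal hw, par e).
have -> : size [seq f x | x : 'I_n * 'I_n * 'I_(wmax I).+1 * 'rV['F_2]_t] = n * n * (wmax I).+1 * T2.
  by rewrite size_map -cardE !card_prod !card_ord card_mx card_Fp // mul1n.
have hn := n_le; have hw : (wmax I).+1 <= 2 * w by rewrite /w; lia.
by rewrite mulnC -[leqRHS]mulnA; mono.
Qed.

Lemma Yb_bound : Yb K n (wmax I) <= bY w N l.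
Proof.
have hn := n_le; have N0 : 1 < N by rewrite /N; lia.
rewrite /Yb /bY; apply: leq_mul; last by rewrite /w; lia.
by do 3 (apply: leq_mul; last by lia).
Qed.

Lemma pre_bound : Tpre t K n (ne I) wt' <= bpre w N l + 310 * repeated_edges I.
Proof.
have h1 := ne_le; have h2 := h_le; have h3 := Yb_bound.
rewrite /Tpre wmx_wmax /bpre; move: h1 h3; move: (T2 * (N * N) * (2 * w)) (bY _ _ _) (repeated_edges I) (Yb _ _ _) (40 * _).
lia.
Qed.

Variables (v : nat -> nat) (a : nat -> nat -> nat) (chi : nat -> nat -> bool) (xr : nat -> nat -> nat).
Variables (al : nat) (eu ev' ga : nat -> nat).
Hypothesis pre_va : pre_spec t K chi xr n (ne I) al inp eu ev' wt' ga v a.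
Let q := v 9.

Lemma prod_spec : prodspec t n (ne I) wt' v. Proof. by case: pre_va => [[]]. Qed.

Lemma q_spec' : [/\ 2 ^ q < 2 * Yb K n (wmax I), v 9 = q & v 19 = if main_case n v then E * q else 0].
Proof.
have [[_ q2 _ _ _] _] := q_spec pre_va; rewrite wmx_wmax in q2.
by split=> //; case: pre_va => [[]].
Qed.

(** The main case means w_max < E^h with E = n^2 2^t, so log w_max, and with it log Y, is O(n log
    n). *)
Lemma q_bound : main_case n v -> q < c1 * (N * l).
Proof.
case/andP => _ lt; have [q2 _ _] := q_spec'.
have [e18 hp] := prod_spec; rewrite wmx_wmax in e18 hp.
have {hp} lt2 : maxn 1 (wmax I) < E ^ h by case: hp => [[l1 _]|]; lia.
have hn := n_le; have hh := h_le; have l0 := l_gt0; have N0 := N_gt0; have N2 : 1 < N by rewrite /N; lia.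
have Nl : N <= 2 ^ l.+1 by apply: ltnW; exact: trunc_log_ltn.
have hE : E <= 2 ^ (2 * l.+1 + t).
  by rewrite expnD leq_mul2r; apply/orP; right; rewrite mul2n -addnn expnD leq_mul // (leq_trans hn).
have hEh : E ^ h <= 2 ^ ((2 * l.+1 + t) * N).
  have E0 : 0 < E ^ h by lia.
  rewrite expnM; apply: (@leq_trans ((2 ^ (2 * l.+1 + t)) ^ h)).
    by case: (h) => // k; rewrite leq_exp2r.
  by rewrite leq_pexp2l // expn_gt0.
have hw : (wmax I).+1 <= 2 ^ ((2 * l.+1 + t) * N).+1.
  by apply: (@leq_trans (2 * E ^ h)); [lia|rewrite expnS leq_mul].
have hn1 : n.+1 <= 2 ^ l.+2 by apply: (@leq_trans (2 * N)); [lia|rewrite expnS leq_mul].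
have hY : 2 * Yb K n (wmax I) <= 2 ^ (1 + (K + l.+2 + l.+2 + l.+2 + ((2 * l.+1 + t) * N).+1)).
  rewrite expnD expn1 leq_mul2l /= /Yb !expnD; apply: leq_mul => //; do 3 (apply: leq_mul => //).
  exact: ltnW (ltn_expl _ _).
have := leq_trans q2 hY; rewrite ltn_exp2l // => hq; apply: leq_trans hq _.
have m1 : l <= N * l by rewrite leq_pmull.
have m2 : N <= N * l by rewrite leq_pmulr.
have m0 : 0 < N * l by rewrite muln_gt0 N0.
have e : (2 * l.+1 + t) * N = 2 * (N * l) + 2 * N + t * N by ring.
have m3 : t * N <= t * (N * l) by rewrite leq_mul2l m2 orbT.
have m4 : K <= K * (N * l) by rewrite leq_pmulr.
rewrite e /c1 !mulnDl; move: m0 m1 m2 m3 m4.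
by move: (N * l) (K * _) (t * N) (t * _) => x y z u; lia.
Qed.

Lemma bA_main : main_case n v -> [/\ q.+1 <= bA w N l, 2 * q + 6 <= bA w N l & 2 * q + 8 <= bA w N l].
Proof.
move=> /q_bound hq; have : 0 < N * l by rewrite muln_gt0 N_gt0 l_gt0.
have aux x z : q < x -> 0 < z ->
    [/\ q.+1 <= 2 * x + 8 * z, 2 * q + 6 <= 2 * x + 8 * z & 2 * q + 8 <= 2 * x + 8 * z].
  by split; lia.
by rewrite /bA /c2 mulnDl -mulnA; apply: aux.
Qed.

Lemma Ttest_bound : main_case n v -> Ttest n h (2 * q + 6) T2 (h * wmax I + 1) <= bT w N l.
Proof.
move=> mc; have [_ hA _] := bA_main mc; have hn := n_le; have hh := h_le.
have hNp : h * wmax I + 1 <= 2 * (N * w).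
  have : h * wmax I <= N * w by rewrite leq_mul // /w leq_maxr.
  have : 0 < N * w by rewrite muln_gt0 N_gt0 w_gt0.
  lia.
by rewrite /Ttest /Tchars /bT; mono.
Qed.

Lemma E_le : E <= N * N * T2.
Proof. by have hn := n_le; mono. Qed.

Lemma primes_bound : main_case n v -> primes_to q <= bP w N l.
Proof.
move=> mc; have [_ _ hA] := bA_main mc; have [q2 _ _] := q_spec'.
have h1 : 2 ^ q <= 2 * bY w N l by apply: leq_trans (ltnW q2) _; rewrite leq_mul2l Yb_bound orbT.
by rewrite /primes_to /bP; mono.
Qed.

Lemma post_bound : Tpost t n (ne I) wt' v <= 200 + (bmain w N l + bbrute w N l).
Proof.
rewrite /Tpost wmx_wmax -/q leq_add2l; case: ifP => mc.
  apply: leq_trans (leq_addr _ _).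
  have hT := Ttest_bound mc; have hP := primes_bound mc; have hE := E_le; have [h1 h2 _] := bA_main mc.
  have hq : q <= bA w N l := ltnW h1.
  have hh : h.+1 <= 2 * N by have := h_le; have := N_gt0; lia.
  by rewrite /bmain; mono.
apply: leq_trans (leq_addl _ _); case: ifP => // od.
have [e18 _] := prod_spec; rewrite wmx_wmax in e18.
have hp : v 17 <= w by move: mc; rewrite /main_case od /= e18 -/w; lia.
have hh := h_le.
by rewrite /bbrute; mono.
Qed.

Lemma total_bound : 60 + Tpre t K n (ne I) wt' + Tpost t n (ne I) wt' v + 28 * v 19 <=
  btotal w N l + 310 * repeated_edges I.
Proof.
have h1 := pre_bound; have h2 := post_bound.
have h3 : v 19 <= N * N * T2 * bA w N l.
  have [_ _ ->] := q_spec'; case: ifP => // mc.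
  by have [hq _ _] := bA_main mc; have hE := E_le; have := ltnW hq => hq'; mono.
rewrite /btotal; move: h1 h2 h3.
move: (bpre _ _ _) (bmain _ _ _ + _) (N * N * _ * _) (Tpre _ _ _ _ _) (Tpost _ _ _ _ _) (v 19) (repeated_edges I).
lia.
Qed.

End Bounds.

(** * From counting failures to probability *)

Import Order.TTheory Num.Theory.

Theorem theorem5p6 (R : realType) (t : nat) (eps : R) (eps_gt0 : (0 < eps)%R) :
  exists (p : cmd) (c C : nat), forall I : instance t,
    let exec := run (word_size I c) p (encode I) in
    let T := C * (time_scale I + repeated_edges I) in
    (forall coins : T.-tuple bool, halted (exec coins)) /\
    (1 - eps <= coin_prob R T (fun coins => solved I (exec coins)))%R.
Proof.
pose L := Num.bound (eps^-1)%R.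
have hL : (eps^-1 < L%:R)%R by apply: archi_boundP; rewrite invr_ge0 ltW.
have L0 : 0 < L.
  by rewrite -(ltr_nat R); apply: lt_trans hL; rewrite invr_gt0.
have [C hC] := btotal_Ob t L.
(* 310 bounds the cost of reading one edge, so it pays for the repeated edges. *)
exists (program (solver t L)), (cword t L), (C + 310) => I exec T.
have [v [a [t1 [hpre hrun]]]] := solver_run L0 I.
have hT : 60 + Tpre t (Kc t L) (nv I) (ne I) (fun e => nth 0 (encode I) (4 * e + 5))
    + Tpost t (nv I) (ne I) (fun e => nth 0 (encode I) (4 * e + 5)) v + 28 * v 19 <= T.
  apply: leq_trans (total_bound hpre) _.
  have w0 : 0 < maxn 1 (wmax I) by lia.
  have N0 : 0 < maxn 2 (nv I) by lia.
  have l0 : 0 < trunc_log 2 (maxn 2 (nv I)) by rewrite trunc_log_gt0; lia.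
  have := hC _ _ _ w0 N0 l0.
  rewrite expn1 /T /time_scale mulnDl !mulnDr; move: (btotal _ _ _ _ _) (_ * _ * _) (repeated_edges I).
  by move=> x y z hx; move: hx; move: (C * y) (C * z) => c1 c2; lia.
split=> [coins|].
  by have := hrun coins; rewrite size_tuple => /(_ hT) [_ [v' [a' []]]].
have hF := solver_fails L0 hpre hT hrun.
rewrite /coin_prob; set F := [set _ | ~~ _] in hF; set A := [set _ | _].
have hA : #|A| + #|F| = 2 ^ T.
  have cT : #|{: T.-tuple bool}| = 2 ^ T by rewrite card_tuple card_bool.
  rewrite -cT.
  have -> : F = ~: A by apply/setP => x; rewrite !inE.
  exact: cardsC.
have P0 : (0 < (2 ^ T)%:R :> R)%R by rewrite ltr0n expn_gt0.
(* As A and F are complementary, the claim becomes |F| <= eps 2^T; it follows from |F| L <= 2^T and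
   1/eps < L. *)
rewrite ler_pdivlMr // -hA natrD mulrBl mul1r lerBlDr lerD2l -natrD hA.
have L0' : (0 < L%:R :> R)%R by rewrite ltr0n.
rewrite -(ler_pM2r L0'); apply: (@le_trans _ _ (2 ^ T)%:R%R).
  by rewrite -natrM ler_nat.
rewrite mulrAC -[leLHS]mul1r ler_pM2r //.
by rewrite mulrC -ler_pdivrMr ?mul1r 1?ltW // -[leLHS]mul1r.
Qed.
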